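(* Let $G$ be a finite group, let $\mathcal F$ be a family of subgroups of $G$, let $X$ be a $G$-space, and let $M$ be a Mackey functor for $G$ that is projective relative to $\mathcal F$. Then $X_{\mathcal F}\to X$ induces an isomorphism on Bredon homology $H^G_*(-;M)$ and on Bredon cohomology $H_G^*(-;M)$.
   Context: A $G$-space is a simplicial set with $G$-action. A collection of subgroups of $G$ is a set of subgroups closed under conjugation; a family is a collection that is also closed under passage to subgroups. Approximations. For a collection $\mathcal C$ and a $G$-space $X$, a $\mathcal C$-approximation to $X$ is a $G$-map $X_{\mathcal C}\to X$ such that all isotropy groups of simplices of $X_{\mathcal C}$ lie in $\mathcal C$ and $(X_{\mathcal C})^K\to X^K$ is a weak equivalence for every $K\in\mathcal C$. A functorial one exists: $X_{\mathcal C}$ is the homotopy coend over the orbit category $\mathcal O_{\mathcal C}$ (transitive $G$-sets with isotropy in $\mathcal C$) of the inclusion $i$ of $\mathcal O_{\mathcal C}$ in $G$-spaces with $S\mapsto \mathrm{map}_G(S,X)$; approximations are unique up to canonical zigzags of $G$-equivalences. Mackey functors. A Mackey functor for $G$ is a pair $M=(\gamma,\gamma^\natural)$ of additive functors from finite $G$-sets to abelian groups (disjoint unions go to direct sums), $\gamma$ covariant, $\gamma^\natural$ contravariant, agreeing on objects (common value $M(S)$), such that for every pullback square of finite $G$-sets with $a:X\to U$, $f:X\to Y$, $g:U\to V$, $b:Y\to V$, $ga=bf$, one has $\gamma(a)\circ\gamma^\natural(f)=\gamma^\natural(g)\circ\gamma(b)$. For a finite $G$-set $Z$, $M_Z$ is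 the Mackey functor $M_Z(T)=M(Z\times T)$, and $\theta_Z:M_Z\to M$ is given by $\gamma$ of the projections $Z\times T\to T$. $M$ is projective relative to $Z$ if $\theta_Z$ is a split surjection of Mackey functors, and projective relative to a collection $\mathcal C$ if it is projective relative to $Z=\coprod G/H$, $H$ ranging over representatives of conjugacy classes in $\mathcal C$. Bredon (co)homology. Extend $\gamma$ (resp. $\gamma^\natural$) to all $G$-sets by colimits (resp. limits) over finite $G$-subsets. $H^G_*(X;M)$ (resp. $H_G^*(X;M)$) is the (co)homology of the normalized (co)chain complex obtained by applying $\gamma$ (resp. $\gamma^\natural$) degreewise to $X$. *)

(* Defs.v *)
From HB Require Import structures.
From mathcomp Require Import fingroup action.
From mathcomp Require Import all_boot all_order all_algebra.
From mathcomp Require Import boolp finmap zify.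
From Stdlib Require Import Relation_Operators.

Set Implicit Arguments.
Unset Strict Implicit.
Unset Printing Implicit Defensive.

Import GRing.Theory.
Import Quotient.

Definition monotone m n (f : {ffun 'I_m.+1 -> 'I_n.+1}) : bool :=
  [forall i : 'I_m.+1, forall j : 'I_m.+1, (i <= j) ==> (f i <= f j)].

(* The maps [m] -> [n] of the simplex category, [n] = {0 < ... < n}. *)
Definition delta m n := {f : {ffun 'I_m.+1 -> 'I_n.+1} | monotone f}.

Lemma monotoneP m n (f : {ffun 'I_m.+1 -> 'I_n.+1}) :
  reflect {homo f : i j / i <= j} (monotone f).
Proof.
apply: (iffP forallP) => [mf i j ij | mf i].
  by move/forallP: (mf i) => /(_ j) /implyP; apply.
by apply/forallP=> j; apply/implyP; apply: mf.
Qed.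

Lemma delta_ext m n (f g : delta m n) :
  (forall i, val f i = val g i :> nat) -> f = g.
Proof. by move=> fg; apply/val_inj/ffunP => i; apply/val_inj/fg. Qed.

Definition mk_delta m n (f : 'I_m.+1 -> 'I_n.+1)
    (mf : {homo f : i j / i <= j}) : delta m n.
Proof.
by exists (finfun f); apply/monotoneP => i j ij; rewrite !ffunE; apply: mf.
Defined.

Lemma mk_deltaE m n f mf i : val (@mk_delta m n f mf) i = f i.
Proof. by rewrite /= ffunE. Qed.

Lemma delta_mono m n (f : delta m n) : {homo val f : i j / i <= j}.
Proof. exact/monotoneP/(valP f). Qed.

Definition delta_id n : delta n n := @mk_delta n n id (fun _ _ ij => ij).

Definition delta_comp m n p (g : delta n p) (f : delta m n) : delta m p :=
  @mk_delta m p (val g \o val f)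
    (fun i j ij => @delta_mono _ _ g _ _ (@delta_mono _ _ f _ _ ij)).

Lemma lift_mono n (i : 'I_n.+1) : {homo lift i : j k / j <= k}.
Proof. by move=> j k /= jk; rewrite /bump; lia. Qed.

(* The injection [n] -> [n+1] that misses i. *)
Definition coface n (i : 'I_n.+2) : delta n n.+1 := mk_delta (@lift_mono _ i).

Lemma unlift_le n (i : 'I_n.+1) (k : 'I_n.+2) : unbump i k < n.+1.
Proof. by move: (ltn_ord i) (ltn_ord k); rewrite /unbump; lia. Qed.

Lemma unlift_mono n (i : 'I_n.+1) :
  {homo (fun k : 'I_n.+2 => Ordinal (unlift_le i k)) : j k / j <= k}.
Proof. by move=> j k jk; rewrite /= /unbump; lia. Qed.

(* The surjection [n+1] -> [n] that takes the value i twice. *)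
Definition codegen n (i : 'I_n.+1) : delta n.+1 n := mk_delta (@unlift_mono _ i).

(* Taking the levels in choiceType loses no generality: by boolp, every type *)
(* has a choiceType structure.                                               *)
Record sset := SSet {
  sobj :> nat -> choiceType;
  sact : forall m n, delta m n -> sobj n -> sobj m;
  sact_id : forall n x, sact (delta_id n) x = x;
  sact_comp : forall m n p (g : delta n p) (f : delta m n) x,
    sact (delta_comp g f) x = sact f (sact g x) }.

Record smap (X Y : sset) := SMap {
  smap_fun :> forall n, X n -> Y n;
  smapP : forall m n (f : delta m n) x,
    smap_fun (sact f x) = sact f (smap_fun x) }.

Definition smap_comp X Y W (g : smap Y W) (f : smap X Y) : smap X W.
Proof.
by exists (fun n x => g n (f n x)) => m n a x; rewrite !smapP.
Defined.

Definition sprod (X Y : sset) : sset.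
Proof.
apply: (@SSet (fun n => (X n * Y n)%type : choiceType)
  (fun m n f x => (sact f x.1, sact f x.2))) => [n [x y]|m n p g f [x y]] /=.
  by rewrite !sact_id.
by rewrite !sact_comp.
Defined.

Lemma delta_compA m n p q (h : delta p q) (g : delta n p) (f : delta m n) :
  delta_comp h (delta_comp g f) = delta_comp (delta_comp h g) f.
Proof. by apply: delta_ext => i; do !rewrite /= ffunE. Qed.

Lemma delta_comp1 m n (f : delta m n) : delta_comp f (delta_id m) = f.
Proof. by apply: delta_ext => i; do !rewrite /= ffunE. Qed.

Definition simplex (k : nat) : sset.
Proof.
apply: (@SSet (fun m => delta m k : choiceType) (fun m n f x => delta_comp x f)).
- by move=> n x; apply: delta_comp1.
- by move=> m n p g f x; apply: delta_compA.
Defined.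

Definition in_horn n (k : 'I_n.+1) m (s : delta m n) : bool :=
  [exists i : 'I_n.+1, (i != k) && [forall j, val s j != i]].

Lemma in_horn_comp n (k : 'I_n.+1) m p (s : delta p n) (f : delta m p) :
  in_horn k s -> in_horn k (delta_comp s f).
Proof.
case/existsP=> i /andP[ik /forallP si]; apply/existsP; exists i.
by apply/andP; split=> //; apply/forallP => j; rewrite /= ffunE /=; apply: si.
Qed.

(* The union of the faces of the standard n-simplex opposite to the vertices *)
(* other than k.                                                             *)
Definition horn n (k : 'I_n.+1) : sset.
Proof.
apply: (@SSet (fun m => {s : delta m n | in_horn k s} : choiceType)
  (fun m p f s => exist _ (delta_comp (val s) f) (in_horn_comp f (valP s)))).
- by move=> m x; apply: val_inj; apply: delta_comp1.
- by move=> m p q g f x; apply: val_inj; apply: delta_compA.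
Defined.

Definition horn_incl n (k : 'I_n.+1) : smap (horn k) (simplex n).
Proof. by exists (fun m (s : horn k m) => sval s). Defined.

Definition kan (K : sset) : Prop :=
  forall n (k : 'I_n.+1), 0 < n -> forall h : smap (horn k) K,
  exists y : smap (simplex n) K, forall m (s : horn k m), y m (horn_incl k m s) = h m s.

Definition vertex1 (e : 'I_2) m : delta m 1 :=
  @mk_delta m 1 (fun=> e) (fun _ _ _ => leqnn e).

Definition elem_homotopy X K (f g : smap X K) : Prop :=
  exists h : smap (sprod X (simplex 1)) K,
    (forall n x, h n (x, vertex1 ord0 n) = f n x) /\
    (forall n x, h n (x, vertex1 ord_max n) = g n x).

(* This is equality in pi_0 of the mapping space; when K is a Kan complex,   *)
(* elem_homotopy is already an equivalence relation.                         *)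
Definition homotopic X K : smap X K -> smap X K -> Prop :=
  clos_refl_sym_trans _ (@elem_homotopy X K).

(* The usual intrinsic definition (Kerodon, Definition 3.1.6.12): f induces  *)
(* a bijection on homotopy classes of maps into every Kan complex.  It is    *)
(* equivalent to |f| being a homotopy equivalence.                           *)
Definition weak_equiv X Y (f : smap X Y) : Prop :=
  forall K, kan K ->
    (forall u v : smap Y K,
       homotopic (smap_comp u f) (smap_comp v f) -> homotopic u v) /\
    (forall w : smap X K, exists u : smap Y K, homotopic (smap_comp u f) w).

(* The group G is the full group of gT.  As everywhere in MathComp, actions  *)
(* are right actions; x g corresponds to g^-1 x.                             *)

Section GSets.
Variable gT : finGroupType.

Record gset := GSet { gcar :> choiceType; gset_act : {action gT &-> gcar} }.

Record fgset := FGSet { fcar : finType; fgset_act : {action gT &-> fcar} }.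

Coercion gset_of_fgset (S : fgset) : gset := GSet (fgset_act S).

Record gmap (S T : gset) := GMap {
  gfun :> S -> T;
  gfunP : forall x g, gfun (gset_act S x g) = gset_act T (gfun x) g }.

Lemma gmap_ext S T (f g : gmap S T) : f =1 g -> f = g.
Proof.
case: f g => [f fP] [g gP] /= /funext fg; subst g.
by congr GMap; apply: Prop_irrelevance.
Qed.

Lemma total_act1 (T : Type) (to : {action gT &-> T}) x : to x 1%g = x.
Proof.
case: to => to [inj mor] /=; apply: (inj 1%g).
by rewrite -mor ?inE // mulg1.
Qed.

Lemma total_actM (T : Type) (to : {action gT &-> T}) x g h :
  to x (g * h)%g = to (to x g) h.
Proof. by case: to => to [inj mor] /=; rewrite mor ?inE. Qed.

Definition gid S : gmap S S := @GMap S S id (fun _ _ => erefl).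

Definition gcomp S T U (g : gmap T U) (f : gmap S T) : gmap S U.
Proof. by exists (g \o f) => x a /=; rewrite !gfunP. Defined.

Definition sum_act (S T : fgset) (x : fcar S + fcar T) (g : gT) :
    (fcar S + fcar T)%type :=
  match x with inl s => inl (fgset_act S s g) | inr t => inr (fgset_act T t g) end.

Lemma sum_act1 S T : @sum_act S T ^~ 1%g =1 id.
Proof. by case=> x /=; rewrite total_act1. Qed.

Lemma sum_actM S T x : act_morph (@sum_act S T) x.
Proof. by case: x => x g h /=; rewrite total_actM. Qed.

Definition gsum (S T : fgset) : fgset :=
  FGSet (TotalAction (@sum_act1 S T) (@sum_actM S T)).

Definition ginl (S T : fgset) : gmap S (gsum S T) :=
  @GMap S (gsum S T) inl (fun _ _ => erefl).
Definition ginr (S T : fgset) : gmap T (gsum S T) :=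
  @GMap T (gsum S T) inr (fun _ _ => erefl).

Definition prod_act (S T : fgset) (x : fcar S * fcar T) (g : gT) :
    (fcar S * fcar T)%type := (fgset_act S x.1 g, fgset_act T x.2 g).

Lemma prod_act1 S T : @prod_act S T ^~ 1%g =1 id.
Proof. by case=> x y; rewrite /prod_act !total_act1. Qed.

Lemma prod_actM S T x : act_morph (@prod_act S T) x.
Proof. by move=> g h; rewrite /prod_act !total_actM. Qed.

Definition gprod (S T : fgset) : fgset :=
  FGSet (TotalAction (@prod_act1 S T) (@prod_actM S T)).

Definition gproj2 (S T : fgset) : gmap (gprod S T) T :=
  @GMap (gprod S T) T snd (fun _ _ => erefl).

Definition gprod_map (Z S T : fgset) (f : gmap S T) :
  gmap (gprod Z S) (gprod Z T).
Proof.
exists (fun x => (x.1, f x.2) : gprod Z T) => -[z x] g.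
by rewrite /= /prod_act /= (gfunP f x g).
Defined.

Record gspace := GSpace {
  gsp_sset :> sset;
  gsp_act : forall n, {action gT &-> gsp_sset n};
  gsp_actP : forall m n (f : delta m n) (x : gsp_sset n) g,
    sact f (gsp_act n x g) = gsp_act m (sact f x) g }.

Record gspace_map (X Y : gspace) := GSpaceMap {
  gsp_smap :> smap X Y;
  gsp_smapP : forall n (x : X n) g,
    gsp_smap n (gsp_act X n x g) = gsp_act Y n (gsp_smap n x) g }.

Definition level (X : gspace) n : gset := GSet (gsp_act X n).

Definition level_act (X : gspace) m n (f : delta m n) :
  gmap (level X n) (level X m) :=
  @GMap (level X n) (level X m) (@sact X m n f) (@gsp_actP X m n f).

Definition level_map (X Y : gspace) (p : gspace_map X Y) n :
  gmap (level X n) (level Y n) :=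
  @GMap (level X n) (level Y n) (@smap_fun X Y p n) (@gsp_smapP X Y p n).

Definition isotropy (S : gset) (x : S) : {set gT} :=
  [set g | gset_act S x g == x].

Lemma isotropy_group_set (S : gset) (x : S) : group_set (isotropy x).
Proof.
apply/group_setP; split=> [|g h]; rewrite !inE ?total_act1 //.
by rewrite total_actM => /eqP-> /eqP->.
Qed.

Definition isotropy_group (S : gset) (x : S) : {group gT} :=
  group (isotropy_group_set x).

Definition is_fixed (S : gset) (K : {group gT}) (x : S) : bool :=
  [forall g in K, gset_act S x g == x].

Lemma is_fixed_map (S T : gset) (K : {group gT}) (f : gmap S T) (x : S) :
  is_fixed K x -> is_fixed K (f x).
Proof.
move=> /forall_inP fx; apply/forall_inP => g gK.
by rewrite -gfunP (eqP (fx g gK)).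
Qed.

Definition fixed (K : {group gT}) (X : gspace) : sset.
Proof.
apply: (@SSet
  (fun n => {x : X n | is_fixed (S := level X n) K x} : choiceType)
  (fun m n f x => exist _ (sact f (val x))
                    (is_fixed_map (level_act X f) (valP x)))).
- by move=> n x; apply: val_inj; apply: sact_id.
- by move=> m n p g f x; apply: val_inj; apply: sact_comp.
Defined.

Definition fixed_map (K : {group gT}) (X Y : gspace) (p : gspace_map X Y) :
  smap (fixed K X) (fixed K Y).
Proof.
exists (fun n (x : fixed K X n) => exist _ (p n (sval x))
          (is_fixed_map (level_map p n) (svalP x)) : fixed K Y n).
by move=> m n f x; apply: val_inj; apply: smapP.
Defined.

Definition is_collection (C : {set {group gT}}) : Prop :=
  forall (H : {group gT}) g, H \in C -> (H :^ g)%G \in C.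

Definition is_family (F : {set {group gT}}) : Prop :=
  is_collection F /\
  forall H K : {group gT}, H \in F -> K \subset H -> K \in F.

(* p : Y -> X exhibits Y as a C-approximation to X. *)
Definition is_approximation (C : {set {group gT}}) (Y X : gspace)
    (p : gspace_map Y X) : Prop :=
  (forall n (y : level Y n), isotropy_group y \in C) /\
  (forall K : {group gT}, K \in C -> weak_equiv (fixed_map K p)).

Definition is_pullback (X U Y V : gset) (a : gmap X U) (f : gmap X Y)
    (g : gmap U V) (b : gmap Y V) : Prop :=
  (forall x, g (a x) = b (f x)) /\
  (forall u y, g u = b y -> exists! x, a x = u /\ f x = y).

Local Open Scope ring_scope.

(* Additivity for the empty disjoint union, M(empty) = 0, is the case where  *)
(* S and T are empty in mcov_sum.                                            *)
Record mackey := Mackey {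
  mobj :> fgset -> zmodType;
  mcov : forall S T : fgset, gmap S T -> {additive mobj S -> mobj T};
  mcon : forall S T : fgset, gmap S T -> {additive mobj T -> mobj S};
  mcov_id : forall (S : fgset) x, mcov (gid S) x = x;
  mcov_comp : forall (S T U : fgset) (g : gmap T U) (f : gmap S T) x,
    mcov (gcomp g f) x = mcov g (mcov f x);
  mcon_id : forall (S : fgset) x, mcon (gid S) x = x;
  mcon_comp : forall (S T U : fgset) (g : gmap T U) (f : gmap S T) x,
    mcon (gcomp g f) x = mcon f (mcon g x);
  mcov_sum : forall S T : fgset,
    bijective (fun x : mobj S * mobj T =>
                 mcov (ginl S T) x.1 + mcov (ginr S T) x.2);
  mcon_sum : forall S T : fgset,
    bijective (fun x : mobj (gsum S T) =>
                 (mcon (ginl S T) x, mcon (ginr S T) x));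
  mackey_pullback : forall (X U Y V : fgset) (a : gmap X U) (f : gmap X Y)
      (g : gmap U V) (b : gmap Y V), is_pullback a f g b ->
    forall y, mcov a (mcon f y) = mcon g (mcov b y) }.

Record mackey_hom (M N : mackey) := MackeyHom {
  mhom :> forall S : fgset, {additive M S -> N S};
  mhom_cov : forall (S T : fgset) (f : gmap S T) x,
    mhom T (mcov M f x) = mcov N f (mhom S x);
  mhom_con : forall (S T : fgset) (f : gmap S T) x,
    mhom S (mcon M f x) = mcon N f (mhom T x) }.

Section Shift.
Variables (M : mackey) (Z : fgset).

Lemma gprod_map_id (S : fgset) : gprod_map Z (gid S) = gid (gprod Z S).
Proof. by apply: gmap_ext => -[]. Qed.

Lemma gprod_map_comp (S T U : fgset) (g : gmap T U) (f : gmap S T) :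
  gprod_map Z (gcomp g f) = gcomp (gprod_map Z g) (gprod_map Z f).
Proof. exact: gmap_ext. Qed.

Definition distr (S T : fgset) :
  gmap (gsum (gprod Z S) (gprod Z T)) (gprod Z (gsum S T)).
Proof.
exists (fun x => match x with
                 | inl zs => (zs.1, inl zs.2) | inr zt => (zt.1, inr zt.2)
                 end : gprod Z (gsum S T)).
by case.
Defined.

Definition undistr (S T : fgset) :
  gmap (gprod Z (gsum S T)) (gsum (gprod Z S) (gprod Z T)).
Proof.
exists (fun x => match x with
                 | (z, inl s) => inl (z, s) | (z, inr t) => inr (z, t)
                 end : gsum (gprod Z S) (gprod Z T)).
by case=> z [].
Defined.

Lemma distrK S T : gcomp (undistr S T) (distr S T) = gid _.
Proof. by apply: gmap_ext => -[] []. Qed.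

Lemma undistrK S T : gcomp (distr S T) (undistr S T) = gid _.
Proof. by apply: gmap_ext => -[] z []. Qed.

Lemma shift_cov_sum (S T : fgset) :
  bijective (fun x : M (gprod Z S) * M (gprod Z T) =>
    mcov M (gprod_map Z (ginl S T)) x.1 + mcov M (gprod_map Z (ginr S T)) x.2).
Proof.
have el : gprod_map Z (ginl S T) = gcomp (distr S T) (ginl _ _).
  by apply: gmap_ext => -[].
have er : gprod_map Z (ginr S T) = gcomp (distr S T) (ginr _ _).
  by apply: gmap_ext => -[].
have db : bijective (mcov M (distr S T)).
  exists (mcov M (undistr S T)) => x;
    by rewrite -mcov_comp ?distrK ?undistrK mcov_id.
apply: eq_bij (bij_comp db (mcov_sum M (gprod Z S) (gprod Z T))) _ _ => -[x y] /=.
by rewrite raddfD /= -!mcov_comp el er.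
Qed.

Lemma shift_con_sum (S T : fgset) :
  bijective (fun x : M (gprod Z (gsum S T)) =>
    (mcon M (gprod_map Z (ginl S T)) x, mcon M (gprod_map Z (ginr S T)) x)).
Proof.
have el : gprod_map Z (ginl S T) = gcomp (distr S T) (ginl _ _).
  by apply: gmap_ext => -[].
have er : gprod_map Z (ginr S T) = gcomp (distr S T) (ginr _ _).
  by apply: gmap_ext => -[].
have db : bijective (mcon M (distr S T)).
  exists (mcon M (undistr S T)) => x;
    by rewrite -mcon_comp ?distrK ?undistrK mcon_id.
apply: eq_bij (bij_comp (mcon_sum M (gprod Z S) (gprod Z T)) db) _ _ => x /=.
by rewrite -!mcon_comp el er.
Qed.

Lemma shift_pullback (X U Y V : fgset) (a : gmap X U) (f : gmap X Y)
    (g : gmap U V) (b : gmap Y V) : is_pullback a f g b ->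
  forall y, mcov M (gprod_map Z a) (mcon M (gprod_map Z f) y) =
            mcon M (gprod_map Z g) (mcov M (gprod_map Z b) y).
Proof.
case=> sq pb; apply: mackey_pullback; split=> [[z x]|[z u] [z' y]] /=.
  by rewrite sq.
case=> <- /pb[x [[ax fx] ux]]; exists (z, x); split=> [|[w x']] /=.
  by rewrite ax fx.
by case=> -[<- ax'] [fx']; rewrite (ux x').
Qed.

(* mshift is the Mackey functor M_Z and theta is the map theta_Z. *)
Definition mshift : mackey.
Proof.
apply: (@Mackey (fun T => M (gprod Z T))
          (fun S T f => mcov M (gprod_map Z f))
          (fun S T f => mcon M (gprod_map Z f))).
- by move=> S x; rewrite gprod_map_id mcov_id.
- by move=> S T U g f x; rewrite gprod_map_comp mcov_comp.
- by move=> S x; rewrite gprod_map_id mcon_id.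
- by move=> S T U g f x; rewrite gprod_map_comp mcon_comp.
- exact: shift_cov_sum.
- exact: shift_con_sum.
- exact: shift_pullback.
Defined.

Definition theta : mackey_hom mshift M.
Proof.
apply: (@MackeyHom mshift M (fun T => mcov M (gproj2 Z T))) => S T f x /=.
  by rewrite -!mcov_comp; congr (mcov M _ x); apply: gmap_ext.
apply: mackey_pullback; split=> [//|s [z t] /= fs].
by exists (z, s); split=> [|[z' s'] [/= <- [-> _]]] //; rewrite fs.
Defined.

End Shift.

Definition split_surjection (M N : mackey) (t : mackey_hom M N) : Prop :=
  exists s : mackey_hom N M, forall S x, t S (s S x) = x.

Definition projective_relative_to (M : mackey) (Z : fgset) : Prop :=
  split_surjection (theta M Z).

Local Open Scope group_scope.

(* coset_gset R is the disjoint union of the G/H for H in R: its points are  *)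
(* the pairs of an H in R and a right coset of H.                            *)
Definition is_coset_point (R : {set {group gT}})
    (x : {group gT} * {set gT}) : bool :=
  (x.1 \in R) && (x.2 \in rcosets x.1 [set: gT]).

Definition coset_point R := {x | is_coset_point R x}.

Lemma coset_act_subproof R (x : coset_point R) (g : gT) :
  is_coset_point R ((val x).1, (val x).2 :* g).
Proof.
case: x => -[H A] /= /andP[/= HR /rcosetsP[y _ ->]].
by rewrite /is_coset_point /= HR -rcosetM mem_rcosets mulSGid ?subsetT ?inE.
Qed.

Definition coset_act R (x : coset_point R) (g : gT) : coset_point R :=
  exist (fun y => is_coset_point R y) _ (coset_act_subproof x g).

Lemma coset_act1 R : @coset_act R ^~ 1 =1 id.
Proof. by move=> [[H A] i]; apply: val_inj; rewrite /= mulg1. Qed.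

Lemma coset_actM R x : act_morph (@coset_act R) x.
Proof. by move=> g h; apply: val_inj; rewrite /= rcosetM. Qed.

Definition coset_gset (R : {set {group gT}}) : fgset :=
  FGSet (TotalAction (@coset_act1 R) (@coset_actM R)).

(* The orbit transversal contains one representative of each conjugacy class *)
(* of subgroups in C.                                                        *)
Definition projective_relative (M : mackey) (C : {set {group gT}}) : Prop :=
  projective_relative_to M
    (coset_gset (orbit_transversal 'JG [set: gT] C)).

End GSets.

Local Open Scope ring_scope.
Local Open Scope quotient_scope.

Section QuotientMap.
Variables (A B : zmodType) (I : zmodClosed A) (J : zmodClosed B).
Variable f : {additive A -> B}.

Definition quot_map (_ : forall x, x \in I -> f x \in J) (x : {quot I}) :
  {quot J} := \pi_{quot J} (f (repr x)).

Hypothesis fIJ : forall x, x \in I -> f x \in J.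

Lemma quot_map_pi x : quot_map fIJ (\pi_{quot I} x) = \pi_{quot J} (f x).
Proof.
apply/eqP; rewrite -idealrBE -raddfB; apply: fIJ.
by rewrite idealrBE reprK.
Qed.

Lemma quot_map_is_zmod_morphism : zmod_morphism (quot_map fIJ).
Proof.
move=> x y; rewrite -[x]reprK -[y]reprK -raddfB !quot_map_pi.
by rewrite !raddfB.
Qed.

HB.instance Definition _ := GRing.isZmodMorphism.Build {quot I} {quot J}
  (quot_map fIJ) quot_map_is_zmod_morphism.
End QuotientMap.

Section Kernel.
Variables (A B : zmodType) (g : {additive A -> B}).

Definition in_ker : {pred A} := fun x => g x == 0.

Lemma in_ker_zmod_closed : zmod_closed in_ker.
Proof.
split=> [|x y]; rewrite !unfold_in ?raddf0 // => /eqP gx /eqP gy.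
by rewrite raddfB gx gy subrr.
Qed.

HB.instance Definition _ := GRing.isZmodClosed.Build A in_ker in_ker_zmod_closed.

Record kernel := Ker { kval : A; kvalP : kval \in in_ker }.

HB.instance Definition _ := [isSub for kval].
HB.instance Definition _ := [Choice of kernel by <:].
HB.instance Definition _ := [SubChoice_isSubZmodule of kernel by <:].

End Kernel.

Section Homology.
Variables (A B C : zmodType) (f : {additive A -> B}) (g : {additive B -> C}).

Definition is_boundary : {pred kernel g} := fun z => `[< exists a, f a = val z >].

Lemma is_boundary_zmod_closed : zmod_closed is_boundary.
Proof.
split=> [|x y]; rewrite !unfold_in.
  by apply/asboolP; exists 0; rewrite !raddf0.
move=> /asboolP[a fa] /asboolP[b fb]; apply/asboolP.
by exists (a - b); rewrite !raddfB fa fb.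
Qed.

HB.instance Definition _ :=
  GRing.isZmodClosed.Build (kernel g) is_boundary is_boundary_zmod_closed.

Definition homology : zmodType := {quot is_boundary}.

End Homology.

Arguments is_boundary {A B C} f g z.

Section HomologyMap.
Variables (A B C A' B' C' : zmodType).
Variables (f : {additive A -> B}) (g : {additive B -> C}).
Variables (f' : {additive A' -> B'}) (g' : {additive B' -> C'}).
Variables (a : {additive A -> A'}) (b : {additive B -> B'}).
Variables (c : {additive C -> C'}).
Hypotheses (sqf : forall x, b (f x) = f' (a x)).
Hypotheses (sqg : forall x, c (g x) = g' (b x)).

Lemma ker_map_subproof (z : kernel g) : b (val z) \in in_ker g'.
Proof.
rewrite unfold_in -sqg; have := valP z.
by rewrite unfold_in => /eqP->; rewrite raddf0.
Qed.

Definition ker_map (z : kernel g) : kernel g' := Ker (ker_map_subproof z).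

Lemma ker_map_is_zmod_morphism : zmod_morphism ker_map.
Proof. by move=> x y; apply: val_inj; rewrite /= !raddfB. Qed.

HB.instance Definition _ :=
  GRing.isZmodMorphism.Build (kernel g) (kernel g') ker_map ker_map_is_zmod_morphism.

Lemma ker_map_boundary z :
  z \in is_boundary f g -> ker_map z \in is_boundary f' g'.
Proof.
rewrite !unfold_in => /asboolP[x fx]; apply/asboolP.
by exists (a x); rewrite -sqf fx.
Qed.

Definition homology_map : {additive homology f g -> homology f' g'} :=
  @quot_map _ _ _ _ ker_map ker_map_boundary.

End HomologyMap.

Lemma alternating_cancel (V : zmodType) (D : zmodClosed V) (N j : nat) (F : nat -> V) :
  (j.+1 < N)%N -> F j = F j.+1 ->
  (forall i, (i < N)%N -> i != j -> i != j.+1 -> F i \in D) ->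
  \sum_(i < N) F i *~ (-1) ^+ i \in D.
Proof.
move=> jN Fj FD.
rewrite (bigD1 (Ordinal (ltnW jN))) //= (bigD1 (Ordinal jN)) /=; last first.
  by apply/eqP => -[]; lia.
rewrite addrA Fj exprS mulN1r mulrNz subrr add0r.
apply: rpred_sum => i /andP[i1 i2].
by apply: rpredMz; apply: FD.
Qed.

Lemma alternating_square (V : zmodType) (N : nat) (F : nat -> nat -> V) :
  (forall i j, (i < j <= N)%N -> F i j = F j.-1 i) ->
  \sum_(i < N) \sum_(j < N.+1) F i j *~ (-1) ^+ (i + j)%N = 0.
Proof.
move=> FE.
have split_sum (i : 'I_N) : \sum_(j < N.+1) F i j *~ (-1) ^+ (i + j)%N =
    \sum_(j < N | (j <= i)%N) F i j *~ (-1) ^+ (i + j)%N -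
    \sum_(j < N | (i <= j)%N) F j i *~ (-1) ^+ (i + j)%N.
  have iN := ltn_ord i.
  rewrite -(big_mkord xpredT (fun j => F i j *~ (-1) ^+ (i + j)%N)).
  rewrite (@big_cat_nat _ _ _ i.+1) //=; last lia.
  congr (_ + _).
    rewrite -(big_mkord (fun j => (j <= i)%N) (fun j => F i j *~ (-1) ^+ (i + j)%N)).
    rewrite [RHS](@big_cat_nat _ _ _ i.+1) //=.
    rewrite [X in _ + X]big1_seq ?addr0; last first.
      by move=> j /andP[ji]; rewrite mem_index_iota; lia.
    rewrite big_nat_cond [RHS]big_nat_cond; apply: eq_bigl => j /=.
    by rewrite andbT !ltnS andbb.
  rewrite big_add1 /= -sumrN.
  rewrite -(big_mkord (fun j => (i <= j)%N)
              (fun j => - (F j i *~ (-1) ^+ (i + j)%N))).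
  rewrite [RHS](@big_cat_nat _ _ _ i) //=; last lia.
  rewrite [X in _ = X + _]big1_seq ?add0r; last first.
    by move=> j /andP[ji]; rewrite mem_index_iota; lia.
  rewrite big_nat_cond [RHS]big_nat_cond; apply: eq_big => [j|j] /=.
    by case: (i <= j)%N => //; rewrite andbT.
  rewrite andbT => jN; rewrite FE; last lia.
  by rewrite addnS exprS mulN1r mulrNz.
rewrite (eq_bigr _ (fun i _ => split_sum i)) sumrB.
rewrite [X in _ - X](exchange_big_dep xpredT) //=.
apply/eqP; rewrite subr_eq0; apply/eqP; apply: eq_bigr => i _.
by apply: eq_bigr => j _; rewrite addnC.
Qed.

Lemma coface_coface (n i j : nat) : (i < j <= n.+2)%N ->
  delta_comp (coface (inord j)) (coface (inord i)) =
  delta_comp (coface (inord i)) (coface (inord j.-1)) :> delta n n.+2.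
Proof.
move=> ij; apply: delta_ext => -[k ltk]; do !rewrite /= ffunE /=.
by rewrite !inordK; rewrite /bump; lia.
Qed.

Lemma codegen_coface_id n (i : nat) (j : 'I_n.+1) : (i = j :> nat) \/ (i = j.+1 :> nat) ->
  delta_comp (codegen j) (coface (inord i)) = delta_id n.
Proof.
move=> ij; apply: delta_ext => -[k ltk]; do !rewrite /= ffunE /=.
have jn := ltn_ord j.
by rewrite inordK; rewrite /bump /unbump; lia.
Qed.

Lemma codegen_coface_lt (n i : nat) (j : 'I_n.+2) : (i < j)%N ->
  delta_comp (codegen j) (coface (inord i)) =
  delta_comp (coface (inord i)) (codegen (inord j.-1)).
Proof.
move=> ij; apply: delta_ext => -[k ltk]; do !rewrite /= ffunE /=.
have jn := ltn_ord j.
by rewrite !inordK; rewrite /bump /unbump; lia.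
Qed.

Lemma codegen_coface_gt (n i : nat) (j : 'I_n.+2) : (j.+1 < i <= n.+2)%N ->
  delta_comp (codegen j) (coface (inord i)) =
  delta_comp (coface (inord i.-1)) (codegen (inord j)).
Proof.
move=> ij; apply: delta_ext => -[k ltk]; do !rewrite /= ffunE /=.
have jn := ltn_ord j.
by rewrite !inordK; rewrite /bump /unbump; lia.
Qed.

Record chain_complex := ChainComplex {
  chain :> nat -> zmodType;
  chain_d : forall n, {additive chain n.+1 -> chain n};
  chain_dd : forall n x, chain_d n (chain_d n.+1 x) = 0 }.

Definition chain_out (C : chain_complex) n : {additive C n -> C n.-1} :=
  match n with 0 => \0 | n'.+1 => chain_d C n' end.

Definition chain_homology (C : chain_complex) n : zmodType :=
  homology (chain_d C n) (chain_out C n).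

Record chain_map (C D : chain_complex) := ChainMap {
  chain_fun :> forall n, {additive C n -> D n};
  chain_mapP : forall n x,
    chain_fun n (chain_d C n x) = chain_d D n (chain_fun n.+1 x) }.

Lemma chain_map_out C D (f : chain_map C D) n x :
  f n.-1 (chain_out C n x) = chain_out D n (f n x).
Proof. by case: n x => [|n] x /=; rewrite ?raddf0 // chain_mapP. Qed.

Definition chain_homology_map C D (f : chain_map C D) n :
    {additive chain_homology C n -> chain_homology D n} :=
  homology_map (chain_mapP f (n := n)) (@chain_map_out C D f n).

Record cochain_complex := CochainComplex {
  cochain :> nat -> zmodType;
  cochain_d : forall n, {additive cochain n -> cochain n.+1};
  cochain_dd : forall n x, cochain_d n.+1 (cochain_d n x) = 0 }.

Definition cochain_in (C : cochain_complex) n : {additive C n.-1 -> C n} :=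
  match n with 0 => \0 | n'.+1 => cochain_d C n' end.

Definition cochain_homology (C : cochain_complex) n : zmodType :=
  homology (cochain_in C n) (cochain_d C n).

Record cochain_map (C D : cochain_complex) := CochainMap {
  cochain_fun :> forall n, {additive C n -> D n};
  cochain_mapP : forall n x,
    cochain_fun n.+1 (cochain_d C n x) = cochain_d D n (cochain_fun n x) }.

Lemma cochain_map_in C D (f : cochain_map C D) n x :
  f n (cochain_in C n x) = cochain_in D n (f n.-1 x).
Proof. by case: n x => [|n] x /=; rewrite ?raddf0 // cochain_mapP. Qed.

Definition cochain_homology_map C D (f : cochain_map C D) n :
    {additive cochain_homology C n -> cochain_homology D n} :=
  homology_map (@cochain_map_in C D f n) (cochain_mapP f (n := n)).

Record sab := SAb {
  sab_obj :> nat -> zmodType;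
  sab_act : forall m n, delta m n -> {additive sab_obj n -> sab_obj m};
  sab_id : forall n x, sab_act (delta_id n) x = x;
  sab_comp : forall m n p (g : delta n p) (f : delta m n) x,
    sab_act (delta_comp g f) x = sab_act f (sab_act g x) }.

Record sab_map (A B : sab) := SAbMap {
  sab_fun :> forall n, {additive A n -> B n};
  sab_mapP : forall m n (f : delta m n) x,
    sab_fun m (sab_act A f x) = sab_act B f (sab_fun n x) }.

Section NormalizedChains.
Variable A : sab.

Definition face n (i : 'I_n.+2) : {additive A n.+1 -> A n} :=
  sab_act A (coface i).
Definition degen n (i : 'I_n.+1) : {additive A n -> A n.+1} :=
  sab_act A (codegen i).

Definition is_degenerate n : {pred A n} :=
  match n return {pred A n} with
  | 0 => pred1 0
  | n'.+1 => fun x =>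
      `[< exists a : 'I_n'.+1 -> A n', x = \sum_(i < n'.+1) degen i (a i) >]
  end.

Lemma is_degenerate_zmod_closed n : zmod_closed (@is_degenerate n).
Proof.
case: n => [|n]; split=> [|x y]; rewrite !unfold_in //=.
- by move=> /eqP-> /eqP->; rewrite subrr.
- apply/asboolP; exists (fun=> 0); rewrite big1 // => i _; exact: raddf0.
move=> /asboolP[a ->] /asboolP[b ->]; apply/asboolP.
exists (fun i => a i - b i); rewrite -sumrB.
by apply: eq_bigr => i _; rewrite raddfB.
Qed.

HB.instance Definition _ n :=
  GRing.isZmodClosed.Build (A n) (@is_degenerate n) (is_degenerate_zmod_closed n).

Lemma degen_degenerate n (i : 'I_n.+1) a : degen i a \in @is_degenerate n.+1.
Proof.
apply/asboolP; exists (fun j => if j == i then a else 0).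
rewrite (bigD1 i) //= eqxx big1 ?addr0 // => j /negPf->.
exact: raddf0.
Qed.

Definition alt_face n (x : A n.+1) : A n :=
  \sum_(i < n.+2) face i x *~ (-1) ^+ i.

Lemma alt_face_is_zmod_morphism n : zmod_morphism (@alt_face n).
Proof.
move=> x y; rewrite /alt_face -sumrB; apply: eq_bigr => i _.
by rewrite raddfB /= mulrzBl.
Qed.

HB.instance Definition _ n := GRing.isZmodMorphism.Build (A n.+1) (A n)
  (@alt_face n) (@alt_face_is_zmod_morphism n).

Lemma alt_face_alt_face n (x : A n.+2) : alt_face (alt_face x) = 0.
Proof.
rewrite -[RHS](@alternating_square _ n.+2
  (fun i j => face (inord i : 'I_n.+2) (face (inord j : 'I_n.+3) x))).
  apply: eq_bigr => i _; rewrite /alt_face raddf_sum mulrz_suml.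
  apply: eq_bigr => j _; rewrite !inord_val raddfMz /= -mulrzA.
  by rewrite exprD mulrC.
by move=> i j ij; rewrite /face -!sab_comp coface_coface.
Qed.

Lemma alt_face_degenerate n (x : A n.+1) :
  x \in @is_degenerate n.+1 -> alt_face x \in @is_degenerate n.
Proof.
move=> /asboolP[a ->]; rewrite raddf_sum; apply: rpred_sum => j _.
pose F i := face (inord i : 'I_n.+2) (degen j (a j)).
have FE : alt_face (degen j (a j)) = \sum_(i < n.+2) F i *~ (-1) ^+ i.
  by apply: eq_bigr => i _; rewrite /F inord_val.
rewrite -[X in X \in _]/(alt_face (degen j (a j))) {}FE.
apply: (@alternating_cancel _ _ _ j); first by rewrite !ltnS -ltnS.
  by rewrite /F /face /degen -!sab_comp !codegen_coface_id //; [right|left].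
move=> i iN ij ij1; rewrite /F /face /degen -sab_comp.
case: n => [|n] in x a j F i iN ij ij1 *.
  by move: (ltn_ord j) ij ij1 iN; lia.
case: (ltnP i j) => [lt_ij|le_ji].
  by rewrite codegen_coface_lt // sab_comp; apply: degen_degenerate.
rewrite codegen_coface_gt; last lia.
by rewrite sab_comp; apply: degen_degenerate.
Qed.

(* The normalized chains are the chains modulo the degenerate ones, and      *)
(* dually (see ncochain) the normalized cochains are those killed by all the *)
(* codegeneracies.                                                           *)
Definition nchain n : zmodType := {quot @is_degenerate n}.

Definition nchain_d n : {additive nchain n.+1 -> nchain n} :=
  @quot_map _ _ _ _ (@alt_face n) (@alt_face_degenerate n).

Lemma nchain_dd n (x : nchain n.+2) : nchain_d n (nchain_d n.+1 x) = 0.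
Proof.
by rewrite -[x]reprK /= !quot_map_pi /= alt_face_alt_face raddf0.
Qed.

Definition normalized_chains : chain_complex := ChainComplex nchain_dd.

End NormalizedChains.

Section NormalizedChainsMap.
Variables (A B : sab) (f : sab_map A B).

Lemma sab_map_degenerate n (x : A n) :
  x \in @is_degenerate A n -> f n x \in @is_degenerate B n.
Proof.
case: n x => [|n] x; rewrite !unfold_in /=.
  by move=> /eqP->; rewrite raddf0.
move=> /asboolP[a ->]; apply/asboolP; exists (fun i => f n (a i)).
by rewrite raddf_sum; apply: eq_bigr => i _; rewrite /= sab_mapP.
Qed.

Definition nchain_map n : {additive nchain A n -> nchain B n} :=
  @quot_map _ _ _ _ (f n) (@sab_map_degenerate n).

Lemma nchain_mapP n (x : nchain A n.+1) :
  nchain_map n (nchain_d A n x) = nchain_d B n (nchain_map n.+1 x).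
Proof.
rewrite -[x]reprK /= !quot_map_pi /=; congr (\pi _).
rewrite /alt_face raddf_sum; apply: eq_bigr => i _.
by rewrite raddfMz /= sab_mapP.
Qed.

Definition normalized_chains_map :
    chain_map (normalized_chains A) (normalized_chains B) :=
  @ChainMap (normalized_chains A) (normalized_chains B) nchain_map nchain_mapP.

End NormalizedChainsMap.

Record csab := CSAb {
  csab_obj :> nat -> zmodType;
  csab_act : forall m n, delta m n -> {additive csab_obj m -> csab_obj n};
  csab_id : forall n x, csab_act (delta_id n) x = x;
  csab_comp : forall m n p (g : delta n p) (f : delta m n) x,
    csab_act (delta_comp g f) x = csab_act g (csab_act f x) }.

Record csab_map (A B : csab) := CSAbMap {
  csab_fun :> forall n, {additive A n -> B n};
  csab_mapP : forall m n (f : delta m n) x,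
    csab_fun n (csab_act A f x) = csab_act B f (csab_fun m x) }.

Section NormalizedCochains.
Variable A : csab.

Definition cface n (i : 'I_n.+2) : {additive A n -> A n.+1} :=
  csab_act A (coface i).
Definition cdegen n (i : 'I_n.+1) : {additive A n.+1 -> A n} :=
  csab_act A (codegen i).

Definition is_normalized n : {pred A n} :=
  match n return {pred A n} with
  | 0 => predT
  | n'.+1 => fun x => [forall i : 'I_n'.+1, cdegen i x == 0]
  end.

Lemma is_normalized_zmod_closed n : zmod_closed (@is_normalized n).
Proof.
case: n => [//|n]; split=> [|x y]; rewrite !unfold_in /=.
  by apply/forallP => i; rewrite raddf0.
move=> /forallP nx /forallP ny; apply/forallP => i.
by rewrite raddfB (eqP (nx i)) (eqP (ny i)) subrr.
Qed.

HB.instance Definition _ n :=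
  GRing.isZmodClosed.Build (A n) (@is_normalized n) (is_normalized_zmod_closed n).

Definition alt_cface n (x : A n) : A n.+1 :=
  \sum_(i < n.+2) cface i x *~ (-1) ^+ i.

Lemma alt_cface_is_zmod_morphism n : zmod_morphism (@alt_cface n).
Proof.
move=> x y; rewrite /alt_cface -sumrB; apply: eq_bigr => i _.
by rewrite raddfB /= mulrzBl.
Qed.

HB.instance Definition _ n := GRing.isZmodMorphism.Build (A n) (A n.+1)
  (@alt_cface n) (@alt_cface_is_zmod_morphism n).

Lemma alt_cface_alt_cface n (x : A n) : alt_cface (alt_cface x) = 0.
Proof.
rewrite -[RHS](@alternating_square _ n.+2
  (fun i j => cface (inord j : 'I_n.+3) (cface (inord i : 'I_n.+2) x))).
  rewrite exchange_big /=.
  apply: eq_bigr => j _; rewrite /alt_cface raddf_sum mulrz_suml.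
  apply: eq_bigr => i _; rewrite !inord_val raddfMz /= -mulrzA.
  by rewrite exprD.
by move=> i j ij; rewrite /cface -!csab_comp coface_coface.
Qed.

Lemma alt_cface_normalized n (x : A n) :
  x \in @is_normalized n -> alt_cface x \in @is_normalized n.+1.
Proof.
move=> nx; apply/forallP => j; rewrite raddf_sum /=.
pose F i := cdegen j (cface (inord i : 'I_n.+2) x).
suff: \sum_(i < n.+2) F i *~ (-1) ^+ i \in in_ker (idfun : A n -> A n).
  rewrite unfold_in /=; congr (_ == _); apply: eq_bigr => i _.
  by rewrite /F inord_val raddfMz.
apply: (@alternating_cancel _ _ _ j); first by rewrite !ltnS -ltnS.
  by rewrite /F /cface /cdegen -!csab_comp !codegen_coface_id //; [right|left].
move=> i iN ij ij1; rewrite /F /cface /cdegen -csab_comp unfold_in /=.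
case: n => [|n] in x nx j F i iN ij ij1 *.
  by move: (ltn_ord j) ij ij1 iN; lia.
move/forallP: nx => nx.
case: (ltnP i j) => [lt_ij|le_ji].
  by rewrite codegen_coface_lt // csab_comp (eqP (nx _)) raddf0.
rewrite codegen_coface_gt; last lia.
by rewrite csab_comp (eqP (nx _)) raddf0.
Qed.

Record ncochain n := NCochain {
  ncochain_val : A n; ncochainP : ncochain_val \in @is_normalized n }.

HB.instance Definition _ n := [isSub for @ncochain_val n].
HB.instance Definition _ n := [Choice of ncochain n by <:].
HB.instance Definition _ n := [SubChoice_isSubZmodule of ncochain n by <:].

Definition ncochain_d_fun n (x : ncochain n) : ncochain n.+1 :=
  NCochain (alt_cface_normalized (valP x)).

Lemma ncochain_d_is_zmod_morphism n : zmod_morphism (@ncochain_d_fun n).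
Proof. by move=> x y; apply: val_inj; rewrite /= !raddfB. Qed.

HB.instance Definition _ n :=
  GRing.isZmodMorphism.Build (ncochain n) (ncochain n.+1)
    (@ncochain_d_fun n) (@ncochain_d_is_zmod_morphism n).

Definition ncochain_d n : {additive ncochain n -> ncochain n.+1} :=
  @ncochain_d_fun n.

Lemma ncochain_dd n (x : ncochain n) : ncochain_d n.+1 (ncochain_d n x) = 0.
Proof. by apply: val_inj; rewrite /= alt_cface_alt_cface. Qed.

Definition normalized_cochains : cochain_complex := CochainComplex ncochain_dd.

End NormalizedCochains.

Section NormalizedCochainsMap.
Variables (A B : csab) (f : csab_map A B).

Lemma csab_map_normalized n (x : A n) :
  x \in @is_normalized A n -> f n x \in @is_normalized B n.
Proof.
case: n x => [|n] x //; rewrite !unfold_in /= => /forallP nx.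
by apply/forallP => i; rewrite /cdegen -csab_mapP (eqP (nx i)) raddf0.
Qed.

Definition ncochain_map_fun n (x : ncochain A n) : ncochain B n :=
  NCochain (csab_map_normalized (valP x)).

Lemma ncochain_map_is_zmod_morphism n : zmod_morphism (@ncochain_map_fun n).
Proof. by move=> x y; apply: val_inj; rewrite /= !raddfB. Qed.

HB.instance Definition _ n :=
  GRing.isZmodMorphism.Build (ncochain A n) (ncochain B n)
    (@ncochain_map_fun n) (@ncochain_map_is_zmod_morphism n).

Definition ncochain_map n : {additive ncochain A n -> ncochain B n} :=
  @ncochain_map_fun n.

Lemma ncochain_mapP n (x : ncochain A n) :
  ncochain_map n.+1 (ncochain_d A n x) = ncochain_d B n (ncochain_map n x).
Proof.
apply: val_inj; rewrite /= /alt_cface raddf_sum; apply: eq_bigr => i _.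
by rewrite raddfMz /= csab_mapP.
Qed.

Definition normalized_cochains_map :
    cochain_map (normalized_cochains A) (normalized_cochains B) :=
  @CochainMap (normalized_cochains A) (normalized_cochains B)
    ncochain_map ncochain_mapP.

End NormalizedCochainsMap.

Section Extension.
Variable gT : finGroupType.
Implicit Types S T U : gset gT.

Definition gstable S (A : {fset S}) : bool :=
  [forall g : gT, [forall x : A, gset_act S (val x) g \in A]].

(* Finite G-subsets of S. *)
Definition finsub S := {A : {fset S} | gstable A}.

Lemma gstableP S (A : finsub S) x g :
  x \in sval A -> gset_act S x g \in sval A.
Proof. by move=> xA; have /forallP/(_ g)/forallP/(_ [` xA]%fset) := svalP A. Qed.

Definition finsub_act S (A : finsub S) (x : sval A) (g : gT) : sval A :=
  [` gstableP g (valP x)]%fset.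

Lemma finsub_act1 S (A : finsub S) : @finsub_act S A ^~ 1%g =1 id.
Proof. by move=> x; apply: val_inj; rewrite /= total_act1. Qed.

Lemma finsub_actM S (A : finsub S) x : act_morph (@finsub_act S A) x.
Proof. by move=> g h; apply: val_inj; rewrite /= total_actM. Qed.

Definition finsub_gset S (A : finsub S) : fgset gT :=
  FGSet (TotalAction (@finsub_act1 S A) (@finsub_actM S A)).
Coercion finsub_gset : finsub >-> fgset.

Definition restr S T (f : gmap S T) (A : finsub S) (B : finsub T)
  (fAB : forall x, x \in sval A -> f x \in sval B) : gmap A B.
Proof.
exists (fun x : sval A => [` fAB _ (valP x)]%fset : sval B) => x g.
by apply: val_inj; rewrite /= gfunP.
Defined.

Definition incl S (A B : finsub S) (AB : {subset sval A <= sval B}) :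
  gmap A B := @restr S S (gid S) A B AB.

Lemma image_gstable S T (f : gmap S T) (A : finsub S) :
  gstable [fset f x | x in sval A]%fset.
Proof.
apply/forallP => g; apply/forallP => -[y /= /imfsetP[x /= xA ->]].
by rewrite -gfunP; apply/imfsetP; exists (gset_act S x g); rewrite ?gstableP.
Qed.

Definition gimage S T (f : gmap S T) (A : finsub S) : finsub T :=
  exist (fun B => gstable B) _ (image_gstable f A).

Lemma mem_image S T (f : gmap S T) (A : finsub S) x :
  x \in sval A -> f x \in sval (gimage f A).
Proof. by move=> xA; apply/imfsetP; exists x. Qed.

Definition to_image S T (f : gmap S T) (A : finsub S) : gmap A (gimage f A) :=
  restr (@mem_image S T f A).

Lemma image_sub S T (f : gmap S T) (A B : finsub S) :
  {subset sval A <= sval B} -> {subset sval (gimage f A) <= sval (gimage f B)}.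
Proof.
by move=> AB y /imfsetP[x /= xA ->]; apply/imfsetP; exists x => //; apply: AB.
Qed.

Lemma union_gstable S (A B : finsub S) : gstable (sval A `|` sval B)%fset.
Proof.
apply/forallP => g; apply/forallP => -[y /= /fsetUP[yA|yB]].
  by rewrite inE gstableP.
by rewrite inE orbC gstableP.
Qed.

Definition finsub_union S (A B : finsub S) : finsub S := 
  exist (fun C => gstable C) _ (union_gstable A B).

Lemma sub_unionl S (A B : finsub S) : {subset sval A <= sval (finsub_union A B)}.
Proof. by move=> x xA; rewrite inE xA. Qed.

Lemma sub_unionr S (A B : finsub S) : {subset sval B <= sval (finsub_union A B)}.
Proof. by move=> x xA; rewrite inE xA orbT. Qed.

Lemma gstable0 S : gstable (fset0 : {fset S}).
Proof. by apply/forallP => g; apply/forallP => -[]. Qed.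

Definition finsub0 S : finsub S := exist (fun B => gstable B) _ (gstable0 S).

Variable M : mackey gT.

Lemma mcov_incl_comp S (A B C : finsub S) (AB : {subset sval A <= sval B})
    (BC : {subset sval B <= sval C}) (AC : {subset sval A <= sval C}) x :
  mcov M (incl BC) (mcov M (incl AB) x) = mcov M (incl AC) x.
Proof.
rewrite -mcov_comp; congr (mcov M _ x).
by apply: gmap_ext => y; apply: val_inj.
Qed.

Lemma mcov_incl_id S (A : finsub S) (AA : {subset sval A <= sval A}) x :
  mcov M (incl AA) x = x.
Proof.
rewrite -[RHS]mcov_id; congr (mcov M _ x).
by apply: gmap_ext => y; apply: val_inj.
Qed.

Section Colimit.
Variable S : gset gT.

Definition germ := {A : finsub S & M A}.

Definition germ_eq (p q : germ) : bool :=
  `[< exists (C : finsub S) (pC : {subset sval (tag p) <= sval C})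
             (qC : {subset sval (tag q) <= sval C}),
        mcov M (incl pC) (tagged p) = mcov M (incl qC) (tagged q) >].

Lemma germ_eq_equiv : equiv_class_of germ_eq.
Proof.
split=> [p|p q|q p r].
- by apply/asboolP; exists (tag p), (fun x xp => xp), (fun x xp => xp).
- by apply/asboolP/asboolP => -[C [pC [qC e]]]; exists C, qC, pC.
move=> /asboolP[C [pC [qC e]]] /asboolP[D [qD [rD e']]].
apply/asboolP; pose CD := finsub_union C D.
have CCD := @sub_unionl S C D; have DCD := @sub_unionr S C D.
exists CD, (fun x xp => CCD x (pC x xp)), (fun x xp => DCD x (rD x xp)).
rewrite -(mcov_incl_comp pC CCD) e (mcov_incl_comp qC CCD (fun x xq => CCD x (qC x xq))).
rewrite -(mcov_incl_comp rD DCD) -e'.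
rewrite (mcov_incl_comp qD DCD (fun x xq => DCD x (qD x xq))).
by congr (mcov M _ _); apply: gmap_ext => y; apply: val_inj.
Qed.

Canonical germ_eq_rel := EquivRelPack germ_eq_equiv.

(* The extension of the covariant functor: the colimit of M over the finite  *)
(* G-subsets of S.                                                           *)
Definition ecov := {eq_quot germ_eq}.
HB.instance Definition _ := Choice.on ecov.

Definition germ_of (A : finsub S) (x : M A) : ecov :=
  \pi_ecov (Tagged (fun A : finsub S => M A : Type) x).

Lemma germ_ofP (A B : finsub S) (x : M A) (y : M B) :
  germ_of x = germ_of y <->
  exists (C : finsub S) (AC : {subset sval A <= sval C})
         (BC : {subset sval B <= sval C}),
    mcov M (incl AC) x = mcov M (incl BC) y.
Proof.
split=> [/eqP|e]; last by apply/eqP; rewrite piE; apply/asboolP.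
by rewrite piE => /asboolP.
Qed.

Lemma germ_of_incl (A B : finsub S) (AB : {subset sval A <= sval B}) (x : M A) :
  germ_of (mcov M (incl AB) x) = germ_of x.
Proof.
apply/germ_ofP; exists B, (fun x xB => xB), AB.
by rewrite mcov_incl_id.
Qed.

Lemma ecovP (a : ecov) : exists (A : finsub S) (x : M A), a = germ_of x.
Proof.
exists (tag (repr a)), (tagged (repr a)); rewrite -{1}[a]reprK /germ_of.
by case: (repr a).
Qed.

Lemma ecovP2 (a b : ecov) :
  exists (A : finsub S) (x y : M A), a = germ_of x /\ b = germ_of y.
Proof.
have [A [x ->]] := ecovP a; have [B [y ->]] := ecovP b.
exists (finsub_union A B), (mcov M (incl (@sub_unionl S A B)) x),
  (mcov M (incl (@sub_unionr S A B)) y).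
by rewrite !germ_of_incl.
Qed.

Definition ecov_zero : ecov := germ_of (0 : M (finsub0 S)).

Definition ecov_opp (a : ecov) : ecov := germ_of (- tagged (repr a)).

Definition ecov_add (a b : ecov) : ecov :=
  let A := tag (repr a) in let B := tag (repr b) in
  germ_of (mcov M (incl (@sub_unionl S A B)) (tagged (repr a)) +
           mcov M (incl (@sub_unionr S A B)) (tagged (repr b))).

Lemma germ_of_repr (a : ecov) : germ_of (tagged (repr a)) = a.
Proof. by rewrite -[RHS]reprK /germ_of; case: (repr a). Qed.

Lemma germ_of0 (A : finsub S) : germ_of (0 : M A) = ecov_zero.
Proof.
have sub0 : {subset sval (finsub0 S) <= sval A} by move=> x; rewrite inE.
by rewrite /ecov_zero -(germ_of_incl sub0) raddf0.
Qed.

Lemma germ_ofN (A : finsub S) (x : M A) : ecov_opp (germ_of x) = germ_of (- x).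
Proof.
rewrite /ecov_opp; set r := repr _.
have /germ_ofP[C [AC [BC e]]] : germ_of (tagged r) = germ_of x.
  exact: germ_of_repr.
by apply/germ_ofP; exists C, AC, BC; rewrite !raddfN e.
Qed.

Lemma germ_ofD (A : finsub S) (x y : M A) :
  ecov_add (germ_of x) (germ_of y) = germ_of (x + y).
Proof.
rewrite /ecov_add; set r := repr _; set s := repr _.
have /germ_ofP[C [rC [AC e]]] : germ_of (tagged r) = germ_of x.
  exact: germ_of_repr.
have /germ_ofP[D [sD [AD e']]] : germ_of (tagged s) = germ_of y.
  exact: germ_of_repr.
have CCD := @sub_unionl S C D; have DCD := @sub_unionr S C D.
have rCD z (zr : z \in sval (tag r)) := CCD z (rC z zr).
have sCD z (zs : z \in sval (tag s)) := DCD z (sD z zs).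
have ACD z (zA : z \in sval A) := CCD z (AC z zA).
have rsCD : {subset sval (finsub_union (tag r) (tag s)) <= sval (finsub_union C D)}.
  by move=> z /fsetUP[/rCD|/sCD].
apply/germ_ofP; exists (finsub_union C D), rsCD, ACD.
rewrite !raddfD /= !(mcov_incl_comp _ _ rCD) !(mcov_incl_comp _ _ sCD).
rewrite -(mcov_incl_comp rC CCD) e (mcov_incl_comp _ _ ACD).
by rewrite -(mcov_incl_comp sD DCD) e' (mcov_incl_comp _ _ ACD).
Qed.

Lemma ecov_addA : associative ecov_add.
Proof.
move=> a b c; have [A [x [y [-> ->]]]] := ecovP2 a b.
have [B [z ->]] := ecovP c.
rewrite -(germ_of_incl (@sub_unionl S A B) x).
rewrite -(germ_of_incl (@sub_unionl S A B) y).
rewrite -(germ_of_incl (@sub_unionr S A B) z).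
by rewrite !germ_ofD addrA.
Qed.

Lemma ecov_addC : commutative ecov_add.
Proof.
move=> a b; have [A [x [y [-> ->]]]] := ecovP2 a b.
by rewrite !germ_ofD addrC.
Qed.

Lemma ecov_add0 : left_id ecov_zero ecov_add.
Proof.
by move=> a; have [A [x ->]] := ecovP a; rewrite -(germ_of0 A) germ_ofD add0r.
Qed.

Lemma ecov_addN : left_inverse ecov_zero ecov_opp ecov_add.
Proof.
move=> a; have [A [x ->]] := ecovP a.
by rewrite germ_ofN germ_ofD addNr germ_of0.
Qed.

HB.instance Definition _ :=
  GRing.isZmodule.Build ecov ecov_addA ecov_addC ecov_add0 ecov_addN.

End Colimit.

Definition ecov_map S T (f : gmap S T) (a : ecov S) : ecov T :=
  germ_of (mcov M (to_image f (tag (repr a))) (tagged (repr a))).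

Lemma ecov_map_germ S T (f : gmap S T) (A : finsub S) (B : finsub T)
    (fAB : forall x, x \in sval A -> f x \in sval B) (x : M A) :
  ecov_map f (germ_of x) = germ_of (mcov M (restr fAB) x).
Proof.
rewrite /ecov_map; set r := repr _.
have /germ_ofP[C [rC [AC e]]] : germ_of (tagged r) = germ_of x.
  exact: germ_of_repr.
pose D := finsub_union B (gimage f C).
have CD z (zC : z \in sval C) : f z \in sval D.
  by apply: sub_unionr; apply: mem_image.
have rD : {subset sval (gimage f (tag r)) <= sval D}.
  by move=> z /(image_sub rC); apply: sub_unionr.
apply/germ_ofP; exists D, rD, (@sub_unionl T B (gimage f C)).
transitivity (mcov M (restr CD) (mcov M (incl rC) (tagged r))).
  rewrite -!mcov_comp; congr (mcov M _ _).
  by apply: gmap_ext => z; apply: val_inj.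
rewrite e -!mcov_comp; congr (mcov M _ _).
by apply: gmap_ext => z; apply: val_inj.
Qed.

Lemma ecov_map_is_zmod_morphism S T (f : gmap S T) :
  zmod_morphism (ecov_map f).
Proof.
move=> a b; have [A [x [y [-> ->]]]] := ecovP2 a b.
rewrite -[- germ_of y]/(ecov_opp (germ_of y)) germ_ofN.
rewrite -[germ_of x + _]/(ecov_add (germ_of x) _) germ_ofD.
rewrite !(ecov_map_germ (@mem_image S T f A)) raddfB.
rewrite -[- germ_of _]/(ecov_opp (germ_of _)) germ_ofN.
by rewrite -[germ_of _ + _]/(ecov_add (germ_of _) _) germ_ofD.
Qed.

HB.instance Definition _ S T (f : gmap S T) :=
  GRing.isZmodMorphism.Build (ecov S) (ecov T) (ecov_map f)
    (ecov_map_is_zmod_morphism f).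

Lemma ecov_map_id S (a : ecov S) : ecov_map (gid S) a = a.
Proof.
have [A [x ->]] := ecovP a.
rewrite (@ecov_map_germ S S (gid S) A A (fun z zA => zA)).
by rewrite [mcov _ _ _]mcov_incl_id.
Qed.

Lemma ecov_map_comp S T U (g : gmap T U) (f : gmap S T) a :
  ecov_map (gcomp g f) a = ecov_map g (ecov_map f a).
Proof.
have [A [x ->]] := ecovP a.
have gfA z (zA : z \in sval A) := mem_image g (mem_image f zA).
rewrite (ecov_map_germ (f := gcomp g f) gfA).
rewrite (ecov_map_germ (@mem_image S T f A)).
rewrite (ecov_map_germ (@mem_image T U g (gimage f A))).
rewrite -mcov_comp; congr (germ_of (mcov M _ _)).
by apply: gmap_ext => z; apply: val_inj.
Qed.

Section Limit.
Variable S : gset gT.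

(* The extension of the contravariant functor: the limit of M over the       *)
(* finite G-subsets of S.                                                    *)
Record econ := ECon {
  econ_fun :> forall A : finsub S, M A;
  econP : forall (A B : finsub S) (AB : {subset sval A <= sval B}),
    mcon M (incl AB) (econ_fun B) = econ_fun A }.

Lemma econ_ext (x y : econ) : (forall A, x A = y A) -> x = y.
Proof.
case: x y => [x xP] [y yP] /= xy.
have e : x = y := functional_extensionality_dep xy; subst y.
by congr ECon; apply: Prop_irrelevance.
Qed.

HB.instance Definition _ := gen_eqMixin econ.
HB.instance Definition _ := gen_choiceMixin econ.

Definition econ_zero : econ.
Proof. by exists (fun A => 0) => A B AB; rewrite raddf0. Defined.

Definition econ_opp (x : econ) : econ.
Proof. by exists (fun A => - x A) => A B AB; rewrite raddfN econP. Defined.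

Definition econ_add (x y : econ) : econ.
Proof. by exists (fun A => x A + y A) => A B AB; rewrite raddfD !econP. Defined.

Lemma econ_addA : associative econ_add.
Proof. by move=> x y z; apply: econ_ext => A; apply: addrA. Qed.

Lemma econ_addC : commutative econ_add.
Proof. by move=> x y; apply: econ_ext => A; apply: addrC. Qed.

Lemma econ_add0 : left_id econ_zero econ_add.
Proof. by move=> x; apply: econ_ext => A; apply: add0r. Qed.

Lemma econ_addN : left_inverse econ_zero econ_opp econ_add.
Proof. by move=> x; apply: econ_ext => A; apply: addNr. Qed.

HB.instance Definition _ :=
  GRing.isZmodule.Build econ econ_addA econ_addC econ_add0 econ_addN.

End Limit.

Definition econ_map S T (f : gmap S T) (y : econ T) : econ S.
Proof.
exists (fun A => mcon M (to_image f A) (y (gimage f A))) => A B AB.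
rewrite -(econP y (image_sub AB)) -!mcon_comp; congr (mcon M _ _).
by apply: gmap_ext => z; apply: val_inj.
Defined.

Lemma econ_map_is_zmod_morphism S T (f : gmap S T) :
  zmod_morphism (econ_map f).
Proof. by move=> x y; apply: econ_ext => A; rewrite /= !raddfB. Qed.

HB.instance Definition _ S T (f : gmap S T) :=
  GRing.isZmodMorphism.Build (econ T) (econ S) (econ_map f)
    (econ_map_is_zmod_morphism f).

Lemma econ_map_id S (y : econ S) : econ_map (gid S) y = y.
Proof.
apply: econ_ext => A /=.
have sub : {subset sval (gimage (gid S) A) <= sval A}.
  by move=> z /imfsetP[w /= wA ->].
rewrite -(econP y sub) -mcon_comp -[RHS]mcon_id; congr (mcon M _ _).
by apply: gmap_ext => z; apply: val_inj.
Qed.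

Lemma econ_map_comp S T U (g : gmap T U) (f : gmap S T) (y : econ U) :
  econ_map (gcomp g f) y = econ_map f (econ_map g y).
Proof.
apply: econ_ext => A /=.
have sub : {subset sval (gimage (gcomp g f) A) <=
                   sval (gimage g (gimage f A))}.
  move=> z /imfsetP[w /= wA ->].
  exact: (@mem_image _ _ g _ _ (@mem_image _ _ f _ _ wA)).
rewrite -(econP y sub) -!mcon_comp; congr (mcon M _ _).
by apply: gmap_ext => z; apply: val_inj.
Qed.

Section Bredon.
Variable X : gspace gT.

Lemma level_act_id n : level_act X (delta_id n) = gid (level X n).
Proof. by apply: gmap_ext => x; apply: sact_id. Qed.

Lemma level_act_comp m n p (g : delta n p) (f : delta m n) :
  level_act X (delta_comp g f) = gcomp (level_act X f) (level_act X g).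
Proof. by apply: gmap_ext => x; apply: sact_comp. Qed.

Definition bredon_sab : sab.
Proof.
apply: (@SAb (fun n => ecov (level X n))
             (fun m n f => ecov_map (level_act X f))).
- by move=> n x; rewrite /= level_act_id ecov_map_id.
- by move=> m n p g f x; rewrite /= level_act_comp ecov_map_comp.
Defined.

Definition bredon_csab : csab.
Proof.
apply: (@CSAb (fun n => econ (level X n))
              (fun m n f => econ_map (level_act X f))).
- by move=> n x; rewrite /= level_act_id econ_map_id.
- by move=> m n p g f x; rewrite /= level_act_comp econ_map_comp.
Defined.

Definition bredon_homology n : zmodType :=
  chain_homology (normalized_chains bredon_sab) n.

Definition bredon_cohomology n : zmodType :=
  cochain_homology (normalized_cochains bredon_csab) n.

End Bredon.

Section BredonMap.
Variables (X Y : gspace gT) (p : gspace_map X Y).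

Lemma level_map_act m n (f : delta m n) :
  gcomp (level_map p m) (level_act X f) = gcomp (level_act Y f) (level_map p n).
Proof. by apply: gmap_ext => x; apply: smapP. Qed.

Definition bredon_sab_map : sab_map (bredon_sab X) (bredon_sab Y).
Proof.
apply: (@SAbMap (bredon_sab X) (bredon_sab Y)
          (fun n => ecov_map (level_map p n))) => m n f x.
by rewrite /= -!ecov_map_comp level_map_act.
Defined.

Definition bredon_csab_map : csab_map (bredon_csab Y) (bredon_csab X).
Proof.
apply: (@CSAbMap (bredon_csab Y) (bredon_csab X)
          (fun n => econ_map (level_map p n))) => m n f x.
by rewrite /= -!econ_map_comp level_map_act.
Defined.

Definition bredon_homology_map n :
    {additive bredon_homology X n -> bredon_homology Y n} :=
  chain_homology_map (normalized_chains_map bredon_sab_map) n.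

Definition bredon_cohomology_map n :
    {additive bredon_cohomology Y n -> bredon_cohomology X n} :=
  cochain_homology_map (normalized_cochains_map bredon_csab_map) n.

End BredonMap.

End Extension.

(* Main.v *)
Require Import Defs.
From HB Require Import structures.
From mathcomp Require Import fingroup action.
From mathcomp Require Import all_boot all_order all_algebra.
From mathcomp Require Import boolp functions finmap zify.
From mathcomp Require Import freeg.
From Stdlib Require Import Relation_Operators.

Set Implicit Arguments.
Unset Strict Implicit.
Unset Printing Implicit Defensive.

Import GRing.Theory.
Import Quotient.
Local Open Scope ring_scope.

(** Let Z be the disjoint union of the orbits G/H, with H running through
    representatives of the conjugacy classes of F.  Every isotropy group of Z x X
    lies in F, and p is a weak equivalence on the fixed points of every such group;
    so Z x Y -> Z x X, with Y the approximation, is a weak equivalence on the fixed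
    points of all subgroups.  Such a map should induce isomorphisms on the homology
    of M_Z, hence on that of M, which is a retract of M_Z.  The proof makes this
    precise with chains only.

    Weak equivalences are tested against Kan complexes.  Simplicial abelian groups
    are Kan (kan_sset_of_sab), and homotopy classes of maps into Eilenberg-MacLane
    complexes are cohomology classes (homotopic_cohomologous and
    cohomologous_homotopic).  So a weak equivalence induces isomorphisms on
    cohomology with all coefficients, and the mapping cone of its normalized
    chains is acyclic (cone_acyclic): take as coefficients the chains of the cone
    modulo boundaries.

    In each degree the simplices of the cone of p, multiplied by Z, form a G-set;
    its chains are a free functor on the orbit category, and by the above they are
    acyclic on the fixed points of each isotropy group.  So they have an
    equivariant contraction (cone_contraction), found by choosing a filling for one
    simplex in each orbit.  The components of the contraction are an inverse r of p
    up to chain homotopies h and k (deformation).  They are not maps of G-sets but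
    linear families: they take a simplex s over z to a linear combination of
    simplices that are fixed by the isotropy group of (z, s).

    A Mackey functor has values on linear families.  On one orbit such a family is
    a linear combination of G-maps, and M of a finite G-set is the direct sum of
    its values on the orbits (mackey_generated and mackey_restr_inj); this gives
    fam_cov and fam_con.  A section sigma of theta turns them into operators on the
    extensions of M to all G-sets (rel_cov and rel_con), which are compatible with
    G-maps but not with the composition of linear families.  This is enough: in
    each of the identities between r, h and k one of the factors composed is a
    face or p, so that the identities carry over to the Bredon chains and cochains
    (homology_bijective and cohomology_bijective). *)

(** * Free abelian groups *)

Notation free T := {freeg T / int}.

Definition single (T : choiceType) (t : T) : free T := Freeg [:: (1, t)].

(** Cochains with values in B are functions on the basis; lin evaluates them on
    chains, and also extends to chains the maps defined on the basis. *)
Definition lin (T : choiceType) (B : zmodType) (c : T -> B) (D : free T) : B :=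
  fglift (c : T -> zmodule B) D.

Lemma lin_is_zmod_morphism (T : choiceType) (B : zmodType) (c : T ->
  B) : zmod_morphism (@lin T B c).
Proof. exact: (@lift_is_additive int T (zmodule B) c). Qed.

HB.instance Definition _ (T : choiceType) (B : zmodType) (c : T -> B) :=
  GRing.isZmodMorphism.Build (free T) B (@lin T B c) (@lin_is_zmod_morphism T B c).

Lemma lin_single (T : choiceType) (B : zmodType) (c : T -> B) t :
  lin c (single t) = c t.
Proof. by rewrite /lin liftU; apply: mulr1z. Qed.

(** Stability under differences is what is at hand when P says that two morphisms
    agree. *)
Lemma free_ind (T : choiceType) (P : free T -> Prop) :
  P 0 -> (forall x y, P x -> P y -> P (x - y)) -> (forall t, P (single t)) ->
  forall x, P x.
Proof.
move=> P0 PB P1; have PN x : P x -> P (- x) by move=> Px; rewrite -sub0r; apply: PB.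
have PD x y : P x -> P y -> P (x + y).
  by move=> Px Py; rewrite -[y]opprK; apply: PB => //; apply: PN.
have Pn x n : P x -> P (x *+ n).
  by move=> Px; elim: n => [|n IHn]; rewrite ?mulr0n // mulrS; apply: PD.
apply: freeg_ind_dom0 => // k t D _ _; apply: PD; rewrite -[k]intz -freegU_mulz.
by case: k => n; [|apply: PN]; apply: Pn; apply: P1.
Qed.

Lemma lin_eq (T : choiceType) (B : zmodType) (f g : {additive free T -> B}) :
  (forall t, f (single t) = g (single t)) -> f =1 g.
Proof.
move=> fg; apply: free_ind => [|x y ex ey|//]; first by rewrite !raddf0.
by rewrite !raddfB ex ey.
Qed.

Lemma raddf_lin (T : choiceType) (B C : zmodType) (g : {additive B -> C})
  (c : T -> B) D : g (lin c D) = lin (g \o c) D.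
Proof. by move: D; apply: (lin_eq (f := g \o lin c)) => t /=;
  rewrite !lin_single. Qed.

Lemma lin_lin (S T : choiceType) (B : zmodType) (c : T -> B) (phi : S -> free T) D :
  lin c (lin phi D) = lin (fun s => lin c (phi s)) D.
Proof. exact: raddf_lin. Qed.

Lemma lin_id (T : choiceType) (D : free T) : lin (@single T) D = D.
Proof. by move: D; apply: (lin_eq (f := lin (@single T)) (g := idfun)) => t;
  exact: lin_single. Qed.

Lemma eq_lin (T : choiceType) (B : zmodType) (c1 c2 : T -> B) :
  c1 =1 c2 -> lin c1 =1 lin c2.
Proof. by move=> e; apply: (lin_eq (f := lin c1) (g := lin c2)) => t /=;
  rewrite !lin_single. Qed.

Lemma linD (T : choiceType) (B : zmodType) (c1 c2 : T -> B) D :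
  lin (fun t => c1 t + c2 t) D = lin c1 D + lin c2 D.
Proof.
by move: D; apply: (lin_eq (f := lin (fun t => c1 t + c2 t)) (g :=
  lin c1 \+ lin c2)) => t /=; rewrite !lin_single.
Qed.

Lemma linB (T : choiceType) (B : zmodType) (c1 c2 : T -> B) D :
  lin (fun t => c1 t - c2 t) D = lin c1 D - lin c2 D.
Proof.
by move: D; apply: (lin_eq (f := lin (fun t => c1 t - c2 t)) (g :=
  lin c1 \- lin c2)) => t /=; rewrite !lin_single.
Qed.

Lemma lin0 (T : choiceType) (B : zmodType) D : lin (fun _ : T => 0 : B) D = 0.
Proof. by move: D; apply: (lin_eq (f := lin (fun=> 0)) (g := \0)) => t /=;
  rewrite !lin_single. Qed.

(** The chains supported in P are the image of a projection.  In this form, closure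
    under linear operations and the extensionality of lin need no induction. *)
Section Support.
Variables (T : choiceType) (P : pred T).

Definition keep (t : T) : free T := if P t then single t else 0.

Definition supp : {pred free T} := fun D => lin keep D == D.

Lemma supp_zmod_closed : zmod_closed supp.
Proof.
split=> [|x y]; rewrite !unfold_in ?raddf0 // => /eqP ex /eqP ey.
by rewrite raddfB /= ex ey.
Qed.

HB.instance Definition _ := GRing.isZmodClosed.Build (free T) supp supp_zmod_closed.

Lemma supp_single t : P t -> single t \in supp.
Proof. by move=> Pt; rewrite unfold_in lin_single /keep Pt. Qed.

Lemma eq_lin_supp (B : zmodType) (c1 c2 : T -> B) D :
  D \in supp -> (forall t, P t -> c1 t = c2 t) -> lin c1 D = lin c2 D.
Proof.
rewrite unfold_in => /eqP <- e; rewrite !lin_lin; apply: eq_lin => t.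
by rewrite /keep; case: ifP => Pt; rewrite ?raddf0 // !lin_single e.
Qed.

Lemma rpred_lin (B : zmodType) (I : zmodClosed B) (c : T -> B) D :
  D \in supp -> (forall t, P t -> c t \in I) -> lin c D \in I.
Proof.
rewrite unfold_in => /eqP <- cI; rewrite lin_lin.
move: D; apply: free_ind => [|x y ex ey|t].
- by rewrite raddf0 rpred0.
- by rewrite raddfB /= rpredB.
rewrite lin_single /keep; case: ifP => Pt; last by rewrite raddf0 rpred0.
by rewrite lin_single cI.
Qed.

End Support.

Lemma supp_predT (T : choiceType) (D : free T) : D \in supp xpredT.
Proof. by rewrite unfold_in -[X in _ == X]lin_id. Qed.

(** * Simplicial abelian groups are Kan complexes *)

Definition sset_of_sab (A : sab) : sset :=
  @SSet (fun n => A n : choiceType) (fun m n f => sab_act A f)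
    (@sab_id A) (@sab_comp A).

Section Faces.
Variable A : sab.

Definition nface n i (x : A n.+1) : A n := face A (inord i) x.
Definition ndegen n i (x : A n) : A n.+1 := degen A (inord i) x.

Lemma nface_is_zmod_morphism n i : zmod_morphism (@nface n i).
Proof. by move=> u v; rewrite /nface raddfB. Qed.

HB.instance Definition _ n i :=
  GRing.isZmodMorphism.Build (A n.+1) (A n) (@nface n i)
    (@nface_is_zmod_morphism n i).

Lemma ndegen_is_zmod_morphism n i : zmod_morphism (@ndegen n i).
Proof. by move=> u v; rewrite /ndegen raddfB. Qed.

HB.instance Definition _ n i :=
  GRing.isZmodMorphism.Build (A n) (A n.+1) (@ndegen n i)
    (@ndegen_is_zmod_morphism n i).

Lemma nface_nface n i j (x : A n.+2) : (i < j <= n.+2)%N ->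
  nface i (nface j x) = nface j.-1 (nface i x).
Proof. by move=> ij; rewrite /nface /face -!sab_comp coface_coface. Qed.

Lemma nface_ndegen_id n i j (x : A n) :
  (j <= n)%N -> i = j \/ i = j.+1 -> nface i (ndegen j x) = x.
Proof.
move=> jn ij; rewrite /nface /face /ndegen /degen -sab_comp.
by rewrite codegen_coface_id ?sab_id // inordK.
Qed.

Lemma nface_ndegen_lt n i j (x : A n.+1) : (i < j <= n.+1)%N ->
  nface i (ndegen j x) = ndegen j.-1 (nface i x).
Proof.
move=> /andP[ij jn]; rewrite /nface /face /ndegen /degen -!sab_comp.
by rewrite codegen_coface_lt inordK.
Qed.

Lemma nface_ndegen_gt n i j (x : A n.+1) : (j.+1 < i <= n.+2)%N ->
  nface i (ndegen j x) = ndegen j (nface i.-1 x).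
Proof.
move=> ij; rewrite /nface /face /ndegen /degen -!sab_comp.
have jn : (j < n.+2)%N by lia.
by rewrite codegen_coface_gt inordK.
Qed.

Section Moore.
Variables (m k : nat) (y : nat -> A m.+1).
Hypothesis km : (k <= m.+2)%N.
Hypothesis compat : forall i j, (i < j <= m.+2)%N -> i != k -> j != k ->
  nface i (y j) = nface j.-1 (y i).

(** Moore's filling of horns.  Adding the degeneracy of the defect y b - d_b w
    corrects the face b, and keeps the face i when it was already right, provided
    the degeneracy is chosen on the side of b away from i.  The faces below k are
    corrected upwards, then those above k downwards. *)
Let correct (w : A m.+2) b c := w + ndegen c (y b - nface b w).

Let correct_ok w b c : (c <= m.+1)%N -> b = c \/ b = c.+1 ->
  nface b (correct w b c) = y b.
Proof.
move=> cm bc; by rewrite /correct raddfD /= nface_ndegen_id // addrC subrK.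
Qed.

Let correct_keep w b c i : (c <= m.+1)%N -> (b <= m.+2)%N -> (i <= m.+2)%N ->
  b != k -> i != k -> b = c \/ b = c.+1 -> (i < c)%N || (c.+1 < i)%N ->
  nface i w = y i -> nface i (correct w b c) = y i.
Proof.
move=> cm bm im bk ik bc ic oki; rewrite /correct raddfD /= oki -[RHS]addr0;
  congr (_ + _).
case/orP: ic => ic.
  rewrite nface_ndegen_lt; last lia.
  rewrite [nface i (_ - _)]raddfB /= nface_nface; last lia.
  by rewrite compat ?oki ?subrr ?raddf0 //; lia.
rewrite nface_ndegen_gt; last lia.
rewrite [nface i.-1 (_ - _)]raddfB /= -(@nface_nface _ b i); last lia.
by rewrite -compat ?oki ?subrr ?raddf0 //; lia.
Qed.

Let fill_low a : (a <= k)%N -> exists w, forall i, (i < a)%N -> nface i w = y i.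
Proof.
elim: a => [|a IHa] ak; first by exists 0.
have [w okw] := IHa (ltnW ak); exists (correct w a a) => i.
rewrite ltnS leq_eqVlt => /predU1P[->|ia]; first by apply: correct_ok; [lia|left].
by apply: correct_keep; rewrite ?okw //; lia.
Qed.

Let fill_high a : (a <= m.+2 - k)%N ->
  exists w, forall i, (i <= m.+2)%N -> (i < k)%N || (m.+2 - a < i)%N ->
    nface i w = y i.
Proof.
elim: a => [|a IHa] ak.
  by have [w okw] := fill_low (leqnn k); exists w => i im ?; apply: okw; lia.
have [|w okw] := IHa _; first lia.
exists (correct w (m.+2 - a) (m.+2 - a).-1) => i im ia.
have [->|ne] := eqVneq i (m.+2 - a)%N.
  by apply: correct_ok; lia.
by apply: correct_keep; try apply: okw; lia.
Qed.

Lemma moore_fill : exists w, forall i, (i <= m.+2)%N -> i != k -> nface i w = y i.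
Proof.
have [w okw] := fill_high (leqnn _); exists w => i im ik; apply: okw; lia.
Qed.

End Moore.
End Faces.

Lemma in_horn_coface m (k i : 'I_m.+2) : i != k -> in_horn k (coface i).
Proof.
move=> ik; apply/existsP; exists i; rewrite ik; apply/forallP => j.
by rewrite /= ffunE eq_sym neq_lift.
Qed.

Definition horn_face m (k i : 'I_m.+2) (ik : i != k) : horn k m :=
  exist _ (coface i) (in_horn_coface ik).

Lemma in_horn_factor m (k : 'I_m.+2) p (s : delta p m.+1) : in_horn k s ->
  exists2 i : 'I_m.+2, i != k & exists t, s = delta_comp (coface i) t.
Proof.
case/existsP=> i /andP[ik /forallP si]; exists i => //.
exists (delta_comp (codegen (inord (minn i m))) s); apply: delta_ext => j.
move: (si j); rewrite -val_eqE; do !rewrite /= ffunE /=.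
have := ltn_ord i; have := ltn_ord (val s j).
rewrite inordK; last by rewrite ltnS geq_minr.
by rewrite /bump /unbump /=; lia.
Qed.

Lemma kan_sset_of_sab (A : sab) : kan (sset_of_sab A).
Proof.
move=> [//|m] k _ h.
pose y i : A m := if insub (coface (inord i)) is Some s then h m s else 0.
have yE i (s : horn k m) : (i <= m.+1)%N -> val s = coface (inord i) -> y i = h m s.
  move=> im es; rewrite /y; case: insubP => [u _ eu|]; last first.
    by rewrite -es (valP s).
  by congr (h m _); apply: val_inj; rewrite /= eu -es.
suff [w okw] : exists w, forall i, (i <= m.+1)%N -> i != k -> nface i w = y i.
  exists (@SMap (simplex m.+1) (sset_of_sab A) (fun p f => sab_act A f w)
            (fun p q f x => sab_comp _ _ _)) => p s /=.
  have [i ik [t st]] := in_horn_factor (valP s).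
  pose si := horn_face ik.
  have -> : s = sact t si by apply: val_inj; rewrite /= st.
  rewrite [RHS]smapP /= sab_comp; congr (sab_act A t _).
  rewrite -(yE i) ?inord_val //; last by rewrite -ltnS.
  by rewrite -okw ?/nface ?inord_val // -ltnS.
case: m k h y yE => [|m] k h y yE.
  exists (ndegen 0 (y (1 - k)%N)) => i i1 ik; rewrite nface_ndegen_id //; last lia.
  by congr y; have := ltn_ord k; lia.
apply: moore_fill => [|i j ij ik jk]; first by rewrite -ltnS.
have ik' : inord i != k by rewrite -val_eqE /= inordK //; lia.
have jk' : inord j != k by rewrite -val_eqE /= inordK //; lia.
rewrite (yE i (horn_face ik')) //; last lia.
rewrite (yE j (horn_face jk')) //; last lia.
rewrite /nface /face -![sab_act A _ _]/(@sact (sset_of_sab A) _ _ _ _) -!smapP.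
by congr (h m _); apply: val_inj; rewrite /= coface_coface.
Qed.

(** * Normalized cochains and Eilenberg-MacLane complexes *)

Definition degenerate (X : sset) n : X n -> bool :=
  match n with
  | 0 => fun=> false
  | m.+1 => fun x => `[< exists i y, x = sact (@codegen m i) y >]
  end.

Lemma degenerate_codegen (X : sset) n i (y : X n) : degenerate (sact (codegen i) y).
Proof. by apply/asboolP; exists i, y. Qed.

(** Reading a function on X n as an element of a cosimplicial abelian group makes
    the normalized cochain complex of X an instance of the one that defines Bredon
    cohomology. *)
Section Cochains.
Variable B : zmodType.

Definition fun_act (X : sset) m n (f : delta m n) (c : X m -> B) : X n -> B :=
  fun x => c (sact f x).

Lemma fun_act_is_zmod_morphism (X : sset) m n (f : delta m n) :
  zmod_morphism (@fun_act X m n f).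
Proof. by []. Qed.

HB.instance Definition _ (X : sset) m n (f : delta m n) :=
  GRing.isZmodMorphism.Build (X m -> B) (X n -> B) (@fun_act X m n f)
    (@fun_act_is_zmod_morphism X m n f).

Definition fun_csab (X : sset) : csab.
Proof.
apply: (@CSAb (fun n => (X n -> B)) (fun m n f => @fun_act X m n f)).
- by move=> n c; apply/funext => x; rewrite /= /fun_act sact_id.
- by move=> m n p g f c; apply/funext => x; rewrite /= /fun_act sact_comp.
Defined.

Definition fun_pull (X Y : sset) (f : smap X Y) n (c : Y n -> B) : X n -> B :=
  fun x => c (f n x).

Lemma fun_pull_is_zmod_morphism (X Y : sset) (f : smap X Y) n :
  zmod_morphism (@fun_pull X Y f n).
Proof. by []. Qed.

HB.instance Definition _ (X Y : sset) (f : smap X Y) n :=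
  GRing.isZmodMorphism.Build (Y n -> B) (X n -> B) (@fun_pull X Y f n)
    (@fun_pull_is_zmod_morphism X Y f n).

Definition fun_csab_map (X Y : sset) (f : smap X Y) :
  csab_map (fun_csab Y) (fun_csab X).
Proof.
apply: (@CSAbMap (fun_csab Y) (fun_csab X) (fun n => @fun_pull X Y f n)).
by move=> m n a c; apply/funext => x; rewrite /= /fun_act /fun_pull smapP.
Defined.

Lemma normalizedP (X : sset) n (c : X n -> B) :
  reflect (forall x, degenerate x -> c x = 0) (c \in @is_normalized (fun_csab X) n).
Proof.
case: n c => [|n] c; first by apply: ReflectT.
rewrite unfold_in /=; apply: (iffP forallP) => [nc x /asboolP[i [y ->]]|nc i].
  by have /eqP/(congr1 (fun h => h y)) := nc i.
by apply/eqP/funext => y; apply/nc/degenerate_codegen.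
Qed.

Definition ncochains (X : sset) : cochain_complex :=
  normalized_cochains (fun_csab X).

Definition mk_ncochain (X : sset) n (c : X n -> B)
    (nc : forall x, degenerate x -> c x = 0) : ncochains X n :=
  @NCochain (fun_csab X) n c (introT (normalizedP c) nc).

Definition cfun (X : sset) n (c : ncochains X n) : X n -> B :=
  @ncochain_val (fun_csab X) n c.

Lemma cfun_degenerate (X : sset) n (c : ncochains X n) x : degenerate x ->
  cfun c x = 0.
Proof. by move: x; apply/normalizedP/(valP c). Qed.

Lemma cfun_is_zmod_morphism (X : sset) n : zmod_morphism (@cfun X n).
Proof. by []. Qed.

HB.instance Definition _ (X : sset) n :=
  GRing.isZmodMorphism.Build (ncochains X n) (X n -> B) (@cfun X n)
    (@cfun_is_zmod_morphism X n).

Lemma ncochain_ext (X : sset) n (c c' : ncochains X n) : cfun c =1 cfun c' ->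
  c = c'.
Proof. by move=> /funext e; apply: val_inj. Qed.

Definition delta_fun (X : sset) n (c : X n -> B) : X n.+1 -> B :=
  fun x => \sum_(i < n.+2) c (sact (coface i) x) *~ (-1) ^+ i.

Lemma fct_mulrz (T : Type) (f : T -> B) (k : int) t : (f *~ k) t = f t *~ k.
Proof.
have fn n : (f *+ n) t = f t *+ n.
  by elim: n => [|n IHn]; rewrite ?mulr0n // !mulrS -IHn.
by case: k => n; rewrite /intmul -fn.
Qed.

Lemma cfun_d (X : sset) n (c : ncochains X n) : cfun (cochain_d _ n c) =
  delta_fun (cfun c).
Proof.
apply/funext => x; rewrite /cfun /= /alt_cface fct_sumE.
by apply: eq_bigr => i _; rewrite fct_mulrz.
Qed.

Definition pull (X Y : sset) (f : smap X Y) : cochain_map (ncochains Y)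
  (ncochains X) :=
  normalized_cochains_map (fun_csab_map f).

Definition cocycle n (X : sset) : zmodType := kernel (cochain_d (ncochains X) n).

Definition zfun n (X : sset) (z : cocycle n X) : X n -> B := cfun (val z).

Lemma zfun_d n (X : sset) (z : cocycle n X) x : delta_fun (zfun z) x = 0.
Proof. by rewrite -cfun_d; have /eqP-> := valP z. Qed.

Lemma zfun_degenerate n (X : sset) (z : cocycle n X) x : degenerate x ->
  zfun z x = 0.
Proof. exact: cfun_degenerate. Qed.

Lemma cocycle_ext n (X : sset) (z z' : cocycle n X) : zfun z =1 zfun z' -> z = z'.
Proof. by move=> e; apply/val_inj/ncochain_ext. Qed.

Lemma cocycle_of n (X : sset) (c : X n -> B) :
  (forall x, degenerate x -> c x = 0) -> (forall x, delta_fun c x = 0) ->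
  exists z : cocycle n X, zfun z = c.
Proof.
move=> nc dc; suff zP : mk_ncochain nc \in in_ker (cochain_d (ncochains X) n).
  by exists (Ker zP).
by rewrite unfold_in; apply/eqP/ncochain_ext => x; rewrite cfun_d dc.
Qed.

Definition zpull n (X Y : sset) (f : smap X Y) : {additive cocycle n Y ->
  cocycle n X} :=
  ker_map (cochain_mapP (pull f) (n := n)).

Lemma zfun_pull n (X Y : sset) (f : smap X Y) (z : cocycle n Y) x :
  zfun (zpull n f z) x = zfun z (f n x).
Proof. by []. Qed.

End Cochains.

Definition simplex_at (X : sset) m (x : X m) : smap (simplex m) X.
Proof. by exists (fun p (s : simplex m p) => sact s x) => p q f s;
  apply: sact_comp. Defined.

Lemma smap_ext X Y (f g : smap X Y) : (forall n x, f n x = g n x) -> f = g.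
Proof.
case: f g => f fP [g gP] /= e.
have {}e : f = g by apply: functional_extensionality_dep => n; apply/funext/e.
by subst g; congr SMap; apply: Prop_irrelevance.
Qed.

Section EilenbergMacLane.
Variables (B : zmodType) (n : nat).

(** An Eilenberg-MacLane complex K(B, n): its m-simplices are the normalized
    n-cocycles of the standard m-simplex, so that it represents cocycles. *)
Definition em_sab : sab.
Proof.
apply: (@SAb (fun m => cocycle B n (simplex m))
  (fun m p f => zpull B n (simplex_at (f : simplex p m)))).
- move=> m z; apply: cocycle_ext => x; rewrite zfun_pull /=.
  by congr (zfun z _); apply: delta_ext => i; do !rewrite /= ffunE.
- move=> m p q g f z; apply: cocycle_ext => x; rewrite !zfun_pull /=.
  by rewrite delta_compA.
Defined.

Definition em := sset_of_sab em_sab.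

Definition em_map (X : sset) (z : cocycle B n X) : smap X em.
Proof.
exists (fun m x => zpull B n (simplex_at x) z : em m) => m p f x.
by apply: cocycle_ext => s; rewrite [RHS]zfun_pull !zfun_pull /= sact_comp.
Defined.

Lemma zfun_em_map X (z : cocycle B n X) m x s :
  zfun (em_map z m x : cocycle B n (simplex m)) s = zfun z (sact s x).
Proof. by []. Qed.

Lemma em_map_pull X Y (f : smap X Y) (z : cocycle B n Y) :
  smap_comp (em_map z) f = em_map (zpull B n f z).
Proof.
apply: smap_ext => m x; apply: cocycle_ext => s.
rewrite -[LHS]/(zfun z (sact s (f m x))) -[RHS]/(zfun z (f n (sact s x))).
by rewrite smapP.
Qed.

Lemma em_map_inj X : injective (@em_map X).
Proof.
move=> z z' /(congr1 (fun h : smap X em => h n)) e; apply: cocycle_ext => x.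
have := zfun_em_map z x (delta_id n); rewrite sact_id => <-.
by rewrite e zfun_em_map sact_id.
Qed.

End EilenbergMacLane.

(** The cocycle evaluates the image of each n-simplex, a cocycle of the standard
    n-simplex, on its nondegenerate n-simplex. *)
Lemma em_map_surj (B : zmodType) n X (h : smap X (em B n)) : exists z, h = em_map z.
Proof.
have hE m p (f : delta m p) x s :
    zfun (h m (sact f x) : cocycle B n (simplex m)) s =
    zfun (h p x : cocycle B n (simplex p)) (delta_comp f s).
  by rewrite (smapP h f x).
have [||z zE] := @cocycle_of B n X (fun x => zfun (h n x : cocycle B n (simplex
  n)) (delta_id n)).
- case: n h hE => // m h hE x /asboolP[i [y ->]]; rewrite hE zfun_degenerate //.
  suff -> : delta_comp (codegen i) (delta_id m.+1) =
            sact (codegen i) (delta_id m : simplex m m).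
    exact: degenerate_codegen.
  by apply: delta_ext => j; do !rewrite /= ffunE.
- move=> x; rewrite /delta_fun.
  rewrite -[RHS](zfun_d (h n.+1 x : cocycle B n (simplex n.+1)) (delta_id n.+1)).
  apply: eq_bigr => i _; rewrite hE; congr (zfun _ _ *~ _).
  by apply: delta_ext => j; do !rewrite /= ffunE.
exists z; apply: smap_ext => m x; apply: cocycle_ext => s.
by rewrite zfun_em_map zE hE delta_comp1.
Qed.


(** * Homotopic maps and cohomologous cocycles *)

(** The combinatorics of the prism operator: G i j is the value of a cochain on
    the j-th face of the i-th simplex of the prism, and F i j its value on the i-th
    simplex of the prism over the j-th face.  Neighbouring simplices of the prism
    share the faces e i, so that only the two ends and the sides survive. *)
Lemma prism_sum (V : zmodType) n (G F : nat -> nat -> V) (e : nat -> V) :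
  (forall i, (i <= n)%N -> G i i = e i) ->
  (forall i, (i <= n)%N -> G i i.+1 = e i.+1) ->
  (forall i j, (j < i <= n)%N -> G i j = F i.-1 j) ->
  (forall i j, (i.+1 < j <= n.+1)%N -> G i j = F i j.-1) ->
  \sum_(i < n.+1) \sum_(j < n.+2) G i j *~ (-1) ^+ (i + j)%N =
  e 0%N - e n.+1 - \sum_(i < n) \sum_(j < n.+1) F i j *~ (-1) ^+ (i + j)%N.
Proof.
move=> Gd Gd1 Gl Gg.
pose L i := \sum_(0 <= j < i) F i.-1 j *~ (-1) ^+ (i + j)%N.
pose H i := \sum_(i.+1 <= j < n.+1) F i j *~ (-1) ^+ (i + j)%N.
have row i : (i < n.+1)%N ->
    \sum_(j < n.+2) G i j *~ (-1) ^+ (i + j)%N = L i + (e i - e i.+1) - H i.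
  move=> ltin; rewrite -(big_mkord xpredT (fun j => G i j *~ (-1) ^+ (i + j)%N)).
  rewrite (@big_cat_nat _ _ _ i) //=; last lia.
  rewrite [X in _ + X]big_ltn; last lia.
  rewrite [X in _ + (_ + X)]big_ltn; last lia.
  rewrite Gd // Gd1 // addnS exprS -signr_odd oddD addbb mulr1z mulN1r mulrNz
    mulr1z.
  rewrite -!addrA; congr (_ + (_ + (_ + _))).
    by apply: eq_big_nat => j ji; rewrite Gl //; lia.
  rewrite /H big_add1 -sumrN; apply: eq_big_nat => j ji.
  by rewrite Gg; [rewrite addnS exprS mulN1r mulrNz|lia].
rewrite (eq_bigr (fun i : 'I_n.+1 => L i + (e i - e i.+1) - H i)); last first.
  by move=> i _; apply: row.
rewrite sumrB big_split /=.
have -> : \sum_(i < n.+1) (e i - e i.+1) = e 0%N - e n.+1.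
  rewrite -opprB -(telescope_sumr e (leq0n _)) -sumrN big_mkord.
  by apply: eq_bigr => i _; rewrite opprB.
rewrite big_ord_recl [L _]big_geq // add0r big_ord_recr /= [H n]big_geq // addr0.
rewrite addrAC addrC; congr (_ + _).
rewrite -sumrB -sumrN; apply: eq_bigr => i _.
rewrite -(big_mkord xpredT (fun j => F i j *~ (-1) ^+ (i + j)%N)).
have ltin := ltn_ord i.
rewrite [in RHS](@big_cat_nat _ _ _ i.+1) //=; last lia.
rewrite opprD /L /H; congr (_ + _); rewrite -sumrN; apply: eq_bigr => j _.
by rewrite /bump /= addSn exprS mulN1r mulrNz.
Qed.

Lemma step_mono n i :
  {homo (fun k : 'I_n.+1 => inord (i <= k)%N : 'I_2) : j k / (j <= k)%N}.
Proof.
have ltb (b : bool) : (b < 2)%N by case: b.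
by move=> j k jk; rewrite !inordK //; case: (leqP i j) => // /leq_trans/(_ jk)->.
Qed.

Definition step n i : delta n 1 := mk_delta (@step_mono n i).

Lemma stepE n i k : val (step n i) k = (i <= k)%N :> nat.
Proof. by rewrite mk_deltaE inordK //; case: (leqP i k). Qed.

Lemma step_coface n i (j : 'I_n.+2) :
  delta_comp (step n.+1 i) (coface j) = step n (i - (j < i))%N.
Proof.
apply: delta_ext => k; rewrite stepE mk_deltaE [LHS]stepE /= ffunE /= /bump.
by congr nat_of_bool; lia.
Qed.

Lemma step_codegen n i (j : 'I_n.+1) :
  delta_comp (step n i) (codegen j) = step n.+1 (i + (j < i))%N.
Proof.
apply: delta_ext => k; rewrite stepE mk_deltaE [LHS]stepE /= ffunE /= /unbump.
by congr nat_of_bool; have := ltn_ord k; lia.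
Qed.

Lemma step0 n : step n 0 = vertex1 ord_max n.
Proof. by apply: delta_ext => k; rewrite stepE mk_deltaE. Qed.

Lemma step_last n : step n n.+1 = vertex1 ord0 n.
Proof. by apply: delta_ext => k; rewrite stepE mk_deltaE leqNgt ltn_ord. Qed.

Definition cyl_end (X : sset) (e : 'I_2) : smap X (sprod X (simplex 1)).
Proof.
exists (fun n x => (x, vertex1 e n) : sprod X (simplex 1) n) => m n f x.
by congr pair; apply: delta_ext => i; do !rewrite /= ffunE.
Defined.

Section Cohomologous.
Variable B : zmodType.

(** In degree 0 the only coboundary is 0, as cochain_in is then the zero map. *)
Definition cohomologous n X (z z' : cocycle B n X) :=
  exists b, cochain_in (ncochains B X) n b = val z' - val z.

Lemma cohomologous_refl n X (z : cocycle B n X) : cohomologous z z.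
Proof. by exists 0; rewrite raddf0 subrr. Qed.

Lemma cohomologous_sym n X (z z' : cocycle B n X) :
  cohomologous z z' -> cohomologous z' z.
Proof. by case=> b e; exists (- b); rewrite raddfN e opprB. Qed.

Lemma cohomologous_trans n X (z z' z'' : cocycle B n X) :
  cohomologous z z' -> cohomologous z' z'' -> cohomologous z z''.
Proof. by case=> b e [b' e']; exists (b' + b); rewrite raddfD /= e e' subrKA. Qed.

Lemma codegen_codegen n i k : (i <= k <= n)%N ->
  delta_comp (codegen (inord k)) (codegen (inord i)) =
  delta_comp (codegen (inord i)) (codegen (inord k.+1)) :> delta n.+2 n.
Proof.
move=> ik; apply: delta_ext => -[a lta]; do !rewrite /= ffunE /=.
by rewrite !inordK; rewrite /unbump; lia.
Qed.

Definition prism X m (c : sprod X (simplex 1) m.+1 -> B) (x : X m) : B :=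
  \sum_(i < m.+1) c (sact (codegen i) x, step m.+1 i.+1) *~ (-1) ^+ i.

(** The step at i.+1 is degenerate along every edge but the one on which it jumps,
    so each simplex of the prism over a degenerate simplex is degenerate. *)
Lemma prism_normalized X m (z : cocycle B m.+1 (sprod X (simplex 1))) x :
  degenerate x -> prism (zfun z) x = 0.
Proof.
case: m z x => // m z x /asboolP[k [y ->]]; rewrite /prism big1 // => i _.
suff degi : degenerate ((sact (codegen i) (sact (codegen k) y), step m.+2 i.+1) :
    sprod X (simplex 1) m.+2) by rewrite zfun_degenerate ?mul0rz.
case: (leqP i k) => ik.
  apply/asboolP; exists (inord k.+1), (sact (codegen (inord i)) y, step m.+1 i.+1).
  have km : (k.+1 < m.+2)%N by have := ltn_ord k.
  rewrite /= -!sact_comp -codegen_codegen ?inord_val; last by rewrite ik -ltnS.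
  rewrite step_codegen; congr (_, step _ _); rewrite inordK //; lia.
apply/asboolP; exists (inord k), (sact (codegen (inord i.-1)) y, step m.+1 i).
have im := ltn_ord i.
rewrite /= -!sact_comp (@codegen_codegen m k i.-1); last lia.
rewrite step_codegen (ltn_predK ik) !inord_val; congr (_, step _ _).
by rewrite inordK; lia.
Qed.

(** A homotopy is a cocycle on the cylinder, and the prism operator bounds the
    difference of its restrictions to the two ends. *)
Lemma elem_homotopy_cohomologous n X (z z' : cocycle B n X) :
  elem_homotopy (em_map z) (em_map z') -> cohomologous z z'.
Proof.
case=> h []; have [c ->] := em_map_surj h => h0 h1.
have z0 : z = zpull B n (cyl_end X ord0) c.
  by apply: em_map_inj; rewrite -em_map_pull; apply: smap_ext => m x; rewrite -h0.
have z1 : z' = zpull B n (cyl_end X ord_max) c.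
  by apply: em_map_inj; rewrite -em_map_pull; apply: smap_ext => m x; rewrite -h1.
subst z z'; clear h0 h1 h; case: n c => [|m] c.
  exists 0; rewrite raddf0; apply/ncochain_ext => x.
  rewrite raddfB /= -[RHS]/(zfun c (x, vertex1 ord_max 0) - zfun c (x,
    vertex1 ord0 0)).
  rewrite -step0 -step_last.
  transitivity (0 : B) => //.
  rewrite -[LHS](zfun_d c (sact (codegen ord0) x, step 1 1)) /delta_fun.
  rewrite big_ord_recl big_ord1 /= -!sact_comp !step_coface.
  have -> : coface (fintype.lift ord0 ord0) = coface (inord 1) :> delta 0 1.
    by congr coface; apply: val_inj; rewrite /= inordK.
  have -> : coface ord0 = coface (inord 0) :> delta 0 1.
    by congr coface; apply: val_inj; rewrite /= inordK.
  rewrite !codegen_coface_id ?sact_id; [|by right|by left].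
  by rewrite mulr1z mulrN1z /= subnn subn0.
exists (mk_ncochain (prism_normalized c)).
apply/ncochain_ext => x; rewrite -[LHS]/(cfun (cochain_d (ncochains B X) m _)
  x) cfun_d.
rewrite raddfB /=.
rewrite -[RHS]/(zfun c (x, vertex1 ord_max m.+1) - zfun c (x, vertex1 ord0 m.+1)).
rewrite -step0 -step_last.
pose G i j := zfun c (sact (coface (inord j))
  ((sact (codegen (inord i)) x, step m.+2 i.+1) : sprod X (simplex 1) m.+2)).
pose F i j := zfun c (sact (codegen (inord i)) (sact (coface (inord j)) x),
  step m.+1 i.+1).
have := @prism_sum _ m.+1 G F (fun i => zfun c (x, step m.+1 i)) _ _ _ _.
rewrite big1 => [|i _]; last first.
  rewrite (eq_bigr (fun j : 'I_m.+3 => zfun c (sact (coface j)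
    ((sact (codegen (inord i)) x, step m.+2 i.+1) : sprod X (simplex 1) m.+2))
    *~ (-1) ^+ j *~ (-1) ^+ i)) => [|j _].
    by rewrite -mulrz_suml [X in X *~ _]zfun_d mul0rz.
  by rewrite /G inord_val -mulrzA exprD mulrC.
move=> E; apply/esym/eqP; rewrite -subr_eq0; apply/eqP.
rewrite [RHS]E => [|i im|i im|i j ij|i j ij].
- congr (_ - _); rewrite exchange_big; apply: eq_bigr => j _.
  rewrite /cfun /= /prism mulrz_suml; apply: eq_bigr => i _.
  by rewrite /F !inord_val -mulrzA exprD.
- rewrite /G /= -sact_comp codegen_coface_id ?inordK //; last by left.
  by rewrite sact_id step_coface inordK ?ltnS ?leqnn ?subn1 //; lia.
- rewrite /G /= -sact_comp codegen_coface_id ?inordK //; last by right.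
  by rewrite sact_id step_coface inordK ?ltnS ?ltnn ?subn0 //; lia.
- rewrite /G /F /= -!sact_comp codegen_coface_lt ?inordK; [|lia..].
  rewrite step_coface inordK; last lia.
  by congr (zfun c (_, step _ _)); lia.
rewrite /G /F /= -!sact_comp codegen_coface_gt ?inordK; [|lia..].
rewrite step_coface inordK; last lia.
by congr (zfun c (_, step _ _)); lia.
Qed.

(** The intermediate maps of a chain of homotopies come from cocycles as well. *)
Lemma homotopic_cohomologous n X (z z' : cocycle B n X) :
  homotopic (em_map z) (em_map z') -> cohomologous z z'.
Proof.
suff gen (f g : smap X (em B n)) : homotopic f g ->
    forall z z', f = em_map z -> g = em_map z' -> cohomologous z z'.
  by move=> zz'; apply: gen zz' _ _ _ _.
elim=> {f g} [f g fg|f|f g _ IH|f g h _ IH1 _ IH2] {z z'} z z'.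
- by move=> ef eg; apply: elem_homotopy_cohomologous; rewrite -ef -eg.
- by move=> -> /em_map_inj->; apply: cohomologous_refl.
- by move=> ef eg; apply/cohomologous_sym/IH.
move=> ef eh; have [c ec] := em_map_surj g.
exact: cohomologous_trans (IH1 _ _ ef ec) (IH2 _ _ ec eh).
Qed.

(** A cochain b that bounds the difference extends by zero from one end of the
    cylinder, and its coboundary deforms one cocycle into the other. *)
Lemma cohomologous_homotopic n X (z z' : cocycle B n X) :
  cohomologous z z' -> homotopic (em_map z) (em_map z').
Proof.
case: n z z' => [|m] z z' [b eb].
  suff -> : z = z' by apply: rst_refl.
  by apply/val_inj/esym/eqP; rewrite -subr_eq0 -eb.
apply: rst_step.
pose bx (x : sprod X (simplex 1) m) := if x.2 == vertex1 ord_max m then cfun b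
  x.1 else 0.
have bx_deg x : degenerate x -> bx x = 0.
  move=> dx; rewrite /bx; case: eqP => // _; apply: cfun_degenerate.
  by case: (m) x dx => // k x /asboolP[i [y ->]]; apply: degenerate_codegen.
pose pr : smap (sprod X (simplex 1)) X := @SMap (sprod X (simplex 1)) X
  (fun n x => x.1) (fun m n f x => erefl).
pose c := val (zpull B _ pr z) + cochain_d (ncochains B _) m (mk_ncochain bx_deg).
have cP : c \in in_ker (cochain_d (ncochains B (sprod X (simplex 1))) m.+1).
  rewrite unfold_in; apply/eqP; rewrite raddfD.
  rewrite [X in _ + X](cochain_dd (c := ncochains B _)) addr0.
  exact: (eqP (valP (zpull B _ pr z))).
have zc y : zfun (Ker cP) y = zfun z y.1 + delta_fun bx y.
  rewrite -[LHS]/(cfun (val (zpull B _ pr z) + cochain_d _ m (mk_ncochain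
    bx_deg)) y).
  by rewrite raddfD -[delta_fun bx](cfun_d (mk_ncochain bx_deg)).
exists (em_map (Ker cP)).
suff ends (e : 'I_2) : zpull B _ (cyl_end X e) (Ker cP) = if e == ord0 then z
  else z'.
  split=> k x.
    by rewrite -[LHS]/(smap_comp (em_map (Ker cP)) (cyl_end X ord0) k x) em_map_pull ends.
  by rewrite -[LHS]/(smap_comp (em_map (Ker cP)) (cyl_end X ord_max) k x)
    em_map_pull ends.
apply: cocycle_ext => x; rewrite zfun_pull zc /=.
have vE i : delta_comp (vertex1 e m.+1) (coface i) = vertex1 e m.
  by apply: delta_ext => k; do !rewrite /= ffunE.
rewrite /delta_fun; under eq_bigr => i _ do rewrite /= vE /bx /=.
have -> : (vertex1 e m == vertex1 ord_max m) = (e != ord0).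
  apply/eqP/idP => [/(congr1 (fun v : delta m 1 => val v ord0))|].
    by rewrite !mk_deltaE => ->.
  move=> e0; suff -> : e = ord_max by [].
  by apply: val_inj; case: e {vE} e0 => -[|[|]].
case: (e == ord0) => /=.
  by rewrite big1 ?addr0 // => i _; rewrite mul0rz.
rewrite -[\sum_(i < _) _]/(delta_fun (cfun b) x) -cfun_d.
rewrite [cochain_d _ _ _]eb -[cfun _ x]/(zfun z' x - zfun z x).
by rewrite addrC subrK.
Qed.

Section WeakEquiv.
Variables (X Y : sset) (f : smap X Y).
Hypothesis fwe : weak_equiv f.

(** Injectivity of the map that f induces on cohomology. *)
Lemma weak_equiv_coboundary n (z : cocycle B n Y) b :
  cochain_in (ncochains B X) n b = val (zpull B n f z) ->
  exists b', cochain_in (ncochains B Y) n b' = val z.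
Proof.
move=> eb; have [inj _] := fwe (@kan_sset_of_sab (em_sab B n)).
have /homotopic_cohomologous[b' eb'] : homotopic (em_map (0 : cocycle B n Y))
  (em_map z).
  apply: inj; rewrite !em_map_pull; apply: cohomologous_homotopic; exists b.
  by rewrite eb raddf0 subr0.
by exists b'; rewrite eb' subr0.
Qed.

(** Surjectivity of the map that f induces on cohomology. *)
Lemma weak_equiv_cocycle n (z : cocycle B n X) :
  exists z', cohomologous z (zpull B n f z').
Proof.
have [_ surj] := fwe (@kan_sset_of_sab (em_sab B n)).
have [u] := surj (em_map z); have [z' ->] := em_map_surj u.
by rewrite em_map_pull => /homotopic_cohomologous/cohomologous_sym; exists z'.
Qed.

End WeakEquiv.

End Cohomologous.

(** * The mapping cone *)

(** The coboundary shifted by one degree, zero in degree 0: the form that it takes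
    on the second summand of the cone. *)
Definition out_fun (B : zmodType) (X : sset) n : (X n.-1 -> B) -> X n -> B :=
  match n with
  | 0 => fun _ _ => 0
  | m.+1 => @delta_fun B X m
  end.

Lemma cochain_inE (B : zmodType) (X : sset) n (b : ncochains B X n.-1) :
  cfun (cochain_in (ncochains B X) n b) = out_fun (cfun b).
Proof. by case: n b => [|n] b //=; rewrite -[LHS]/(cfun (cochain_d _ n b))
  cfun_d. Qed.

Lemma raddf_delta_fun (B C : zmodType) (g : {additive B -> C}) (X : sset) n
  (c : X n -> B) x : g (delta_fun c x) = delta_fun (g \o c) x.
Proof. by rewrite raddf_sum; apply: eq_bigr => i _; rewrite raddfMz. Qed.

Lemma raddf_out_fun (B C : zmodType) (g : {additive B -> C}) (X : sset) n
  (c : X n.-1 -> B) x : g (out_fun c x) = out_fun (g \o c) x.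
Proof. by case: n c x => [|n] c x /=; rewrite ?raddf0 ?raddf_delta_fun. Qed.

Section Cone.
Variables (X Y : sset) (f : smap Y X).

Definition cone n : choiceType := (X n + Y n.-1)%type.

(** The term Y n.-1 is Y shifted by one degree.  The copy of Y 0 that it puts in
    degree 0 is discarded by declaring it degenerate. *)
Definition cone_degenerate n (t : cone n) : bool :=
  match t with inl x => degenerate x | inr y => (n == 0%N) || degenerate y end.

Section Tests.
Variable B : zmodType.

Definition normalized n (c : cone n -> B) := forall t, cone_degenerate t -> c t = 0.

(** The coboundary of the cochain c of the cone.  As raddf_cone_d shows, the boundary
    is the case where c is the inclusion of the basis in the free group. *)
Definition cone_d n (c : cone n -> B) (t : cone n.+1) : B :=
  match t with
  | inl x => delta_fun (c \o inl) x
  | inr y => c (inl (f n y)) - out_fun (c \o inr) y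
  end.

Lemma cone_split n (c : cone n -> B) : normalized c ->
  exists (a : ncochains B X n) (b : ncochains B Y n.-1),
  [/\ c \o inl = cfun a, c \o inr = cfun b & n = 0%N -> b = 0].
Proof.
move=> nc.
have na x : degenerate x -> (c \o inl) x = 0 by move=> dx; apply: nc.
have nb y : degenerate y -> (c \o inr) y = 0.
  by move=> dy; apply: nc; rewrite /= dy orbT.
exists (mk_ncochain na), (mk_ncochain nb); split=> // n0.
by apply: ncochain_ext => y; apply: nc; apply/orP; left; apply/eqP.
Qed.

Lemma cone_d_split n (c : cone n -> B) a b : c \o inl = cfun a ->
  c \o inr = cfun b ->
  cone_d c \o inl = cfun (cochain_d (ncochains B X) n a) /\
  cone_d c \o inr = cfun (pull B f n a - cochain_in (ncochains B Y) n b).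
Proof.
move=> ca cb; split; apply/funext => t; first by rewrite cfun_d -ca.
rewrite -[LHS]/((c \o inl) (f n t) - out_fun (c \o inr) t).
by rewrite ca cb -cochain_inE.
Qed.

Lemma cone_d_normalized n (c : cone n -> B) : normalized c -> normalized (cone_d c).
Proof.
move=> /cone_split[a [b [ca cb _]]]; have [da db] := cone_d_split ca cb.
case=> t /= dt; first by rewrite -[LHS]/((cone_d c \o inl) t) da cfun_degenerate.
by rewrite -[LHS]/((cone_d c \o inr) t) db cfun_degenerate.
Qed.

Lemma cone_dd n (c : cone n -> B) t : normalized c -> cone_d (cone_d c) t = 0.
Proof.
move=> nc; have [a [b [ca cb b0]]] := cone_split nc.
have [da db] := cone_d_split ca cb; have [dda ddb] := cone_d_split da db.
case: t => t; first by rewrite -[LHS]/((cone_d (cone_d c) \o inl) t) dda cochain_dd.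
rewrite -[LHS]/((cone_d (cone_d c) \o inr) t) ddb.
rewrite [X in cfun X](_ : _ = 0) // (cochain_mapP (pull B f)) raddfB opprB
  addrCA subrr addr0.
clear ca cb da db dda ddb nc; case: n c a b b0 t => [|n] c a b b0 t.
  by rewrite /= raddf0.
by rewrite -[LHS]/(cochain_d _ _ (cochain_d (ncochains B Y) n b)) cochain_dd.
Qed.

End Tests.

Lemma raddf_cone_d (B C : zmodType) (g : {additive B -> C}) n (c : cone n -> B) t :
  g (cone_d c t) = cone_d (g \o c) t.
Proof.
by case: t => t /=; rewrite ?raddfB /= ?raddf_out_fun ?raddf_delta_fun.
Qed.

(** The normalized chains are represented by the combinations of nondegenerate
    simplices: nd is the projection on them along the degenerate ones.  It is also
    the universal normalized cochain, and cbd is its coboundary. *)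
Definition nd n (t : cone n) : free (cone n) :=
  if cone_degenerate t then 0 else single t.

Lemma nd_normalized n : normalized (@nd n).
Proof. by move=> t dt; rewrite /nd dt. Qed.

Lemma lin_nd (B : zmodType) n (c : cone n -> B) t : normalized c ->
  lin c (nd t) = c t.
Proof.
rewrite /nd => nc; case: ifP => dt; last by rewrite lin_single.
by rewrite raddf0 nc.
Qed.

Definition cbd n (t : cone n.+1) : free (cone n) := cone_d (@nd n) t.

Lemma cbd_normalized n : normalized (@cbd n).
Proof. exact/cone_d_normalized/nd_normalized. Qed.

Lemma lin_cbd (B : zmodType) n (c : cone n -> B) t : normalized c ->
  lin c (cbd t) = cone_d c t.
Proof.
move=> nc; rewrite raddf_cone_d; congr (cone_d _ t).
by apply/funext => u /=; rewrite lin_nd.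
Qed.

Lemma cbd_cbd n (t : cone n.+2) : lin (@cbd n) (cbd t) = 0.
Proof. by rewrite lin_cbd; [apply/cone_dd/nd_normalized|apply: cbd_normalized]. Qed.

Lemma nd_cbd n (t : cone n.+1) : lin (@nd n) (cbd t) = cbd t.
Proof. by rewrite lin_cbd //; apply: nd_normalized. Qed.

Definition is_cycle n : free (cone n) -> Prop :=
  match n with 0 => fun=> True | m.+1 => fun l => lin (@cbd m) l = 0 end.

Section Classes.
Variable n : nat.

Definition is_cone_boundary : {pred free (cone n)} :=
  fun l => `[< exists l', lin (@cbd n) l' = lin (@nd n) l >].

Lemma is_cone_boundary_zmod_closed : zmod_closed is_cone_boundary.
Proof.
split=> [|x y]; rewrite !unfold_in.
  by apply/asboolP; exists 0; rewrite !raddf0.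
move=> /asboolP[a xa] /asboolP[b yb]; apply/asboolP.
by exists (a - b); rewrite !raddfB /= xa yb.
Qed.

HB.instance Definition _ :=
  GRing.isZmodClosed.Build (free (cone n)) is_cone_boundary
    is_cone_boundary_zmod_closed.

Definition cone_classes : zmodType := {quot is_cone_boundary}.

Definition cone_class : {additive free (cone n) -> cone_classes} :=
  \pi_{quot is_cone_boundary}%qT.

Lemma cone_class_eq0 l : cone_class l = 0 <-> exists l',
  lin (@cbd n) l' = lin (@nd n) l.
Proof.
have -> : (cone_class l = 0) <-> l \in is_cone_boundary.
  by rewrite -(raddf0 cone_class) -{2}[l]subr0 idealrBE; split=> [->|/eqP].
by rewrite unfold_in; split=> [/asboolP|e]; last apply/asboolP.
Qed.

End Classes.

Hypothesis fwe : weak_equiv f.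

(** The long exact sequence of the cone: q restricts to a cocycle on X whose
    pullback to Y is a coboundary.  So it is a coboundary on X, and then q on Y is
    a cocycle up to a coboundary, which is corrected by a cocycle v of X. *)
Lemma cone_cocycle_coboundary (B : zmodType) n (q : cone n -> B) :
  normalized q -> (forall t, cone_d q t = 0) ->
  match n return (cone n -> B) -> Prop with
  | 0 => fun q => q = 0
  | m.+1 => fun q => exists2 e : cone m -> B, normalized e & q = cone_d e
  end q.
Proof.
move=> nq dq; have [a [b [qa qb b0]]] := cone_split nq.
have [da db] := cone_d_split qa qb.
have a_cocycle : cochain_d (ncochains B X) n a = 0.
  by apply: ncochain_ext => x; rewrite -da /= -[LHS]/(cone_d q (inl x)) dq.
have pa : pull B f n a = cochain_in (ncochains B Y) n b.
  apply/eqP; rewrite -subr_eq0; apply/eqP/ncochain_ext => y.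
  by rewrite -db -[LHS]/(cone_d q (inr y)) dq.
have zP : a \in in_ker (cochain_d (ncochains B X) n) by rewrite unfold_in a_cocycle.
have [w wa] := weak_equiv_coboundary fwe (z := Ker zP) (esym pa).
rewrite /= in wa; clear zP da db.
case: n q nq dq a b qa qb b0 a_cocycle pa w wa.
  move=> q nq dq a b qa qb b0 _ _ w /= wa; apply/funext => -[x|y].
    by rewrite -[LHS]/((q \o inl) x) qa -wa.
  by rewrite -[LHS]/((q \o inr) y) qb b0.
move=> m q nq dq a b qa qb _ a_cocycle pa w /= wa.
have uP : b - pull B f m w \in in_ker (cochain_d (ncochains B Y) m).
  rewrite unfold_in raddfB /= -[X in _ - X](cochain_mapP (pull B f)).
  by rewrite -[X in X - _]pa -wa subrr.
have [v [e ev]] := weak_equiv_cocycle fwe (Ker uP).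
have oe y : out_fun (cfun (if m == 0%N then 0 else e)) y = out_fun (cfun e) y.
  by case: (m) e y {ev} => [|k].
pose c (t : cone m) := match t with
  | inl x => cfun (w + val v) x
  | inr y => cfun (if m == 0%N then 0 else e) y
  end.
exists c.
  (* In degree 0 the component e is in the discarded part of the cone. *)
  move=> [x|y] dt; first exact: (cfun_degenerate (w + val v)).
  by move: dt; rewrite /c /cone_degenerate; case: eqP => // _ /cfun_degenerate->.
apply/funext => -[x|y].
  rewrite -[LHS]/((q \o inl) x) qa -wa.
  rewrite -[RHS]/(delta_fun (cfun (w + val v)) x) -(cfun_d (w + val v :
    ncochains B X m)).
  have dv : cochain_d (ncochains B X) m (val v) = 0 := eqP (valP v).
  by rewrite raddfD dv addr0.
rewrite -[RHS]/(cfun (w + val v) (f m y) -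
  out_fun (cfun (if m == 0%N then 0 else e)) y).
rewrite oe -cochain_inE ev -[LHS]/((q \o inr) y) qb /=.
have alg (p r u : B) : r = p + u - (u - (r - p)).
  by rewrite opprB addrACA subrr addr0 addrC subrK.
exact: (alg (cfun w (f m y)) (cfun b y) (cfun (val v) (f m y))).
Qed.

(** The class of a chain modulo boundaries is a cocycle, hence a coboundary, and so
    it vanishes on cycles. *)
Lemma cone_acyclic n (l : free (cone n)) :
  is_cycle l -> exists l', lin (@cbd n) l' = lin (@nd n) l.
Proof.
move=> cl; apply/cone_class_eq0.
pose q t := cone_class n (single t : free (cone n)).
have <- : lin q l = cone_class n l by rewrite -[X in _ = _ X]lin_id raddf_lin.
have nq : normalized q.
  move=> t dt; apply/cone_class_eq0; exists 0.
  by rewrite raddf0 lin_single nd_normalized.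
have dq t : cone_d q t = 0.
  rewrite -[q]/(cone_class n \o @single _) -raddf_cone_d; apply/cone_class_eq0.
  exists (single t); rewrite lin_single raddf_cone_d; congr (cone_d _ t).
  by apply/funext => u /=; rewrite lin_single.
have := cone_cocycle_coboundary nq dq.
case: n l cl q {nq dq} => [|n] l cl q /=; first by move->; rewrite lin0.
by case=> e ne ->; rewrite -(eq_lin (fun t => lin_cbd t ne)) -lin_lin cl raddf0.
Qed.

End Cone.

(** * Equivariant chains *)

Section GSetConstructions.
Variable gT : finGroupType.
Implicit Types S T : gset gT.

Definition coprod_act S T (x : S + T) (g : gT) : (S + T)%type :=
  match x with inl s => inl (gset_act S s g) | inr t => inr (gset_act T t g) end.

Lemma coprod_act1 S T : @coprod_act S T ^~ 1%g =1 id.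
Proof. by case=> x /=; rewrite total_act1. Qed.

Lemma coprod_actM S T x : act_morph (@coprod_act S T) x.
Proof. by case: x => x g h /=; rewrite total_actM. Qed.

Definition coprod_gset S T : gset gT :=
  @GSet gT (S + T)%type (TotalAction (@coprod_act1 S T) (@coprod_actM S T)).

Definition pair_act S T (x : S * T) (g : gT) : (S * T)%type :=
  (gset_act S x.1 g, gset_act T x.2 g).

Lemma pair_act1 S T : @pair_act S T ^~ 1%g =1 id.
Proof. by case=> x y; rewrite /pair_act !total_act1. Qed.

Lemma pair_actM S T x : act_morph (@pair_act S T) x.
Proof. by move=> g h; rewrite /pair_act !total_actM. Qed.

Definition pair_gset S T : gset gT :=
  @GSet gT (S * T)%type (TotalAction (@pair_act1 S T) (@pair_actM S T)).

Lemma isotropyP S (x : S) g : reflect (gset_act S x g = x) (g \in isotropy_group x).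
Proof. by rewrite inE; apply: eqP. Qed.

Lemma is_fixedP S (K : {group gT}) (x : S) :
  reflect {in K, forall g, gset_act S x g = x} (is_fixed K x).
Proof.
apply: (iffP forall_inP) => fx g gK; [exact/eqP/fx|exact/eqP/fx].
Qed.

Lemma fixed_isotropy S (K : {group gT}) (x : S) : is_fixed K x = (K \subset
  isotropy_group x).
Proof.
apply/is_fixedP/subsetP => fx g gK; first by apply/isotropyP/fx.
by apply/isotropyP/fx.
Qed.

Lemma fixed_act S (K : {group gT}) (x : S) g :
  is_fixed K x -> is_fixed (K :^ g)%G (gset_act S x g).
Proof.
move=> /is_fixedP fx; apply/is_fixedP => _ /imsetP[k kK ->].
by rewrite -total_actM conjgE mulKVg total_actM fx.
Qed.

Lemma isotropy_act S (x : S) g : isotropy_group (gset_act S x g) =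
  (isotropy_group x :^ g)%G.
Proof.
apply/val_inj/setP => h; rewrite /= mem_conjg; apply/isotropyP/isotropyP => e.
  by rewrite conjgE invgK !total_actM e -total_actM mulgV total_act1.
rewrite -[in RHS]e -!total_actM conjgE invgK; congr (gset_act S x _).
by rewrite !mulgA mulgKV.
Qed.

(** An equivariant function is determined by its values on one point of each orbit,
    and these can be any values that the isotropy groups of the points fix. *)
Lemma equivariant_choice S (V : Type) (act : V -> gT -> V) (P : S -> V -> Prop) :
  (forall v g h, act v (g * h)%g = act (act v g) h) ->
  (forall x v g, P x v -> P (gset_act S x g) (act v g)) ->
  (forall x, exists v, P x v /\ {in isotropy_group x, forall g, act v g = v}) ->
  exists phi : S -> V,
    (forall x g, phi (gset_act S x g) = act (phi x) g) /\ (forall x, P x (phi x)).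
Proof.
move=> actM Pact ex.
pose orb x : pred S := fun y => [exists g, y == gset_act S x g].
have orbxx x : orb x x by apply/existsP; exists 1%g; rewrite total_act1.
have orb_act x g : orb (gset_act S x g) =1 orb x.
  move=> y; apply/existsP/existsP => -[h /eqP->].
    by exists (g * h)%g; rewrite total_actM.
  by exists (g^-1 * h)%g; rewrite -total_actM mulKVg.
pose rep x := choose (orb x) x.
have rep_act x g : rep (gset_act S x g) = rep x.
  rewrite /rep (eq_choose (orb_act x g)); apply: choose_id => //.
  by apply/existsP; exists g.
have /boolp.choice[tr trP] x : exists g, x = gset_act S (rep x) g.
  have /existsP[g /eqP eg] := chooseP (orbxx x).
  by exists g^-1%g; rewrite /rep eg -total_actM mulgV total_act1.
have [v vP] := boolp.choice ex.
exists (fun x => act (v (rep x)) (tr x)); split=> [x g|x]; last first.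
  by rewrite {1}[x]trP; apply/Pact/(vP _).1.
pose a := (tr (gset_act S x g) * (tr x * g)^-1)%g.
have aG : a \in isotropy_group (rep x).
  apply/isotropyP; rewrite total_actM -(rep_act x g) -trP.
  by rewrite {1}[x]trP -!total_actM mulgA mulgV total_act1 rep_act.
have -> : tr (gset_act S x g) = (a * (tr x * g))%g by rewrite mulgKV.
by rewrite rep_act (actM _ a) (vP _).2 // actM.
Qed.

Section FreeAction.
Variable S : gset gT.

Definition free_act (l : free S) (g : gT) : free S :=
  lin (fun t => single (gset_act S t g)) l.

Lemma free_actM l g h : free_act l (g * h)%g = free_act (free_act l g) h.
Proof.
by rewrite /free_act lin_lin; apply: eq_lin => t; rewrite lin_single total_actM.
Qed.

Lemma lin_free_act (B : zmodType) (c : S -> B) l g :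
  lin c (free_act l g) = lin (fun t => c (gset_act S t g)) l.
Proof. by rewrite /free_act lin_lin; apply: eq_lin => t; rewrite lin_single. Qed.

Definition fixed_supp (K : {group gT}) := supp (is_fixed (S := S) K).

Lemma fixed_suppS (K L : {group gT}) l :
  K \subset L -> l \in fixed_supp L -> l \in fixed_supp K.
Proof.
move=> KL lL; rewrite -[l]lin_id; apply: rpred_lin lL _ => t.
by rewrite fixed_isotropy => Lt; apply: supp_single;
  rewrite fixed_isotropy (subset_trans KL).
Qed.

Lemma fixed_supp_act (K : {group gT}) l g :
  l \in fixed_supp K -> free_act l g \in fixed_supp (K :^ g)%G.
Proof. by move=> lK; apply: rpred_lin lK _ => t ft;
  apply/supp_single/fixed_act. Qed.

Lemma free_act_fixed (K : {group gT}) l g : l \in fixed_supp K -> g \in K ->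
  free_act l g = l.
Proof.
move=> lK gK; rewrite -[RHS]lin_id; apply: eq_lin_supp lK _ => t /is_fixedP-> //.
Qed.

End FreeAction.

End GSetConstructions.

(** * Equivariant contraction of the cone *)

Lemma dependent_sequence (T : nat -> Type) (P : forall n, T n -> Prop)
    (R : forall n, T n -> T n.+1 -> Prop) :
  (exists x, P 0%N x) -> (forall n x, P n x -> exists2 y, P n.+1 y & R n x y) ->
  exists s : forall n, T n, (forall n, P n (s n)) /\ forall n, R n (s n) (s n.+1).
Proof.
move=> /cid[x0 Px0] step.
pose next n (x : {x | P n x}) := cid2 (step n (sval x) (svalP x)).
pose s := fix s n : {x | P n x} := match n with
  | 0 => exist _ x0 Px0
  | m.+1 => exist _ (s2val (next m (s m))) (s2valP (next m (s m)))
  end.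
by exists (fun n => sval (s n)); split=> n; [apply: svalP|apply: (s2valP' (next
  n (s n)))].
Qed.

Section EquivariantCone.
Variables (gT : finGroupType) (X Y : gspace gT) (p : gspace_map Y X).

Definition cone_gset n : gset gT := coprod_gset (level X n) (level Y n.-1).

Lemma degenerate_act (W : gspace gT) n (x : level W n) g :
  degenerate (gset_act (level W n) x g) = degenerate x.
Proof.
have deg_act h (y : level W n) : degenerate y ->
  degenerate (gset_act (level W n) y h).
  case: n y {x} => // n y /asboolP[i [w ->]].
  by apply/asboolP; exists i, (gset_act (level W n) w h); rewrite /= gsp_actP.
apply/idP/idP; last exact: deg_act.
by move/(deg_act g^-1%g); rewrite -total_actM mulgV total_act1.
Qed.

Lemma cone_degenerate_act n (t : cone_gset n) g :
  cone_degenerate (gset_act (cone_gset n) t g : cone X Y n) = cone_degenerate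
    (t : cone X Y n).
Proof. by case: t => t /=; rewrite degenerate_act. Qed.

Lemma delta_fun_act (W : gspace gT) (B : zmodType) n (c : level W n ->
  B) (x : level W n.+1) g :
  delta_fun c (gset_act (level W n.+1) x g) =
  delta_fun (fun y => c (gset_act (level W n) y g)) x.
Proof. by apply: eq_bigr => i _; rewrite /= gsp_actP. Qed.

Lemma out_fun_act (W : gspace gT) (B : zmodType) n (c : level W n.-1 ->
  B) (x : level W n) g :
  out_fun c (gset_act (level W n) x g) =
  out_fun (fun y => c (gset_act (level W n.-1) y g)) x.
Proof. by case: n c x => [|n] c x //; apply: delta_fun_act. Qed.

Lemma cone_d_act (B : zmodType) n (c : cone X Y n -> B) (t : cone_gset n.+1) g :
  cone_d p c (gset_act (cone_gset n.+1) t g) =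
  cone_d p (fun u => c (gset_act (cone_gset n) u g)) t.
Proof.
case: t => t; first exact: (delta_fun_act (c \o inl)).
rewrite -[LHS]/(c (inl (p n (gset_act (level Y n) t g))) -
  out_fun (c \o inr) (gset_act (level Y n) t g)).
by rewrite out_fun_act /= gsp_smapP.
Qed.

Lemma nd_act n (t : cone_gset n) g :
  @nd X Y n (gset_act (cone_gset n) t g) = free_act (S :=
    cone_gset n) (@nd X Y n t) g.
Proof.
rewrite /nd cone_degenerate_act; case: ifP => _; first by rewrite /free_act raddf0.
by rewrite /free_act lin_single.
Qed.

Lemma cbd_act n (t : cone_gset n.+1) g :
  @cbd X Y p n (gset_act (cone_gset n.+1) t g) =
  free_act (S := cone_gset n) (@cbd X Y p n t) g.
Proof.
rewrite /cbd cone_d_act /free_act raddf_cone_d; congr (cone_d _ _ t).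
by apply/funext => u; rewrite nd_act.
Qed.

Lemma nd_supp n (K : {group gT}) (t : cone_gset n) :
  is_fixed K t -> @nd X Y n t \in fixed_supp (S := cone_gset n) K.
Proof. by move=> ft; rewrite /nd; case: ifP => _;
  [apply: rpred0|apply: supp_single]. Qed.

Lemma delta_fun_mem (W : gspace gT) (B : zmodType) (I : zmodClosed B) n (K :
  {group gT})
    (c : level W n -> B) (x : level W n.+1) :
  is_fixed K x -> (forall y, is_fixed K y -> c y \in I) -> delta_fun c x \in I.
Proof.
move=> fx cI; apply: rpred_sum => i _; apply/rpredMz/cI.
exact: (is_fixed_map (level_act W (coface i)) fx).
Qed.

Lemma out_fun_mem (W : gspace gT) (B : zmodType) (I : zmodClosed B) n (K :
  {group gT})
    (c : level W n.-1 -> B) (x : level W n) :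
  is_fixed K x -> (forall y, is_fixed K y -> c y \in I) -> out_fun c x \in I.
Proof.
by case: n c x => [|n] c x fx cI /=; [apply: rpred0|apply: delta_fun_mem fx cI].
Qed.

Lemma cbd_supp n (K : {group gT}) (t : cone_gset n.+1) :
  is_fixed K t -> @cbd X Y p n t \in fixed_supp (S := cone_gset n) K.
Proof.
case: t => t ft; first by apply: delta_fun_mem ft _ => y fy; apply: nd_supp.
apply: rpredB; first by apply: nd_supp; apply: (is_fixed_map (level_map p n) ft).
by apply: out_fun_mem ft _ => y fy; apply: nd_supp.
Qed.

Section FixedCone.
Variable K : {group gT}.
Let XK := fixed K X.
Let YK := fixed K Y.
Let pK : smap YK XK := fixed_map K p.

Definition cone_incl n (t : cone XK YK n) : cone X Y n :=
  match t with inl x => inl (val x) | inr y => inr (val y) end.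

Definition cone_retr n (t : cone X Y n) : free (cone XK YK n) :=
  match t with
  | inl x => if insub x is Some u then single (inl u : cone XK YK n) else 0
  | inr y => if insub y is Some u then single (inr u : cone XK YK n) else 0
  end.

Lemma degenerate_fixed (W : gspace gT) n (x : fixed K W n) :
  degenerate (val x) = degenerate x.
Proof.
case: n x => // n x; apply/asboolP/asboolP => -[i [y e]]; last first.
  by exists i, (val y); rewrite e.
have ey : y = sact (coface (inord i)) (val x).
  by rewrite e -sact_comp codegen_coface_id ?sact_id //; left.
exists i, (sact (coface (inord i)) x); apply: val_inj.
by rewrite e ey.
Qed.

Lemma cone_d_incl (B : zmodType) n (c : cone X Y n -> B) t :
  cone_d p c (cone_incl t) = cone_d pK (fun u => c (cone_incl u)) t.
Proof.
case: t => t //=; congr (_ - _).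
by case: n c t => [|n] c t.
Qed.

Lemma nd_incl n (t : cone XK YK n) :
  @nd X Y n (cone_incl t) = lin (fun u => single (cone_incl u)) (@nd XK YK n t).
Proof.
have e : cone_degenerate (cone_incl t : cone X Y n) = cone_degenerate (t : cone
  XK YK n).
  by case: t => t /=; rewrite degenerate_fixed.
by rewrite /nd e; case: ifP => _; rewrite ?raddf0 ?lin_single.
Qed.

Lemma cbd_incl n (t : cone XK YK n.+1) :
  @cbd X Y p n (cone_incl t) = lin (fun u => single (cone_incl u)) (@cbd XK YK
    pK n t).
Proof.
rewrite /cbd cone_d_incl raddf_cone_d; congr (cone_d _ _ t).
by apply/funext => u; rewrite nd_incl.
Qed.

Lemma cone_incl_fixed n (t : cone XK YK n) : is_fixed (S :=
  cone_gset n) K (cone_incl t).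
Proof. by case: t => t; apply: (valP t). Qed.

Lemma cone_inclK n (t : cone XK YK n) : cone_retr (cone_incl t) = single t.
Proof. by case: t => t /=; rewrite valK. Qed.

Lemma cone_retrK n (l : free (cone X Y n)) : l \in fixed_supp (S :=
  cone_gset n) K ->
  lin (fun u => single (cone_incl u)) (lin (@cone_retr n) l) = l.
Proof.
move=> lK; rewrite lin_lin -[RHS]lin_id; apply: eq_lin_supp lK _ => -[x|y] ft /=.
  by rewrite insubT lin_single.
by rewrite insubT lin_single.
Qed.

Let incl n (l : free (cone XK YK n)) : free (cone X Y n) :=
  lin (fun u => single (cone_incl u)) l.

Let nd_lin_incl n l : lin (@nd X Y n) (incl l) = incl (lin (@nd XK YK n) l).
Proof. by rewrite /incl !lin_lin; apply: eq_lin => t;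
  rewrite lin_single nd_incl. Qed.

Let cbd_lin_incl n l : lin (@cbd X Y p n) (incl l) = incl (lin (@cbd XK YK pK n) l).
Proof. by rewrite /incl !lin_lin; apply: eq_lin => t;
  rewrite lin_single cbd_incl. Qed.

Let incl_inj n : injective (@incl n).
Proof.
apply: (can_inj (g := lin (@cone_retr n))) => u.
by rewrite /incl lin_lin -[RHS]lin_id; apply: eq_lin => t;
  rewrite lin_single cone_inclK.
Qed.

Hypothesis pKwe : weak_equiv pK.

(** The fixed points of the cone are the cone of the fixed points, and a chain
    supported on them comes from it. *)
Lemma fixed_cone_acyclic n (l : free (cone X Y n)) :
  l \in fixed_supp (S := cone_gset n) K -> is_cycle p l ->
  exists2 l', l' \in fixed_supp (S := cone_gset n.+1) K & lin (@cbd X Y p n) l'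
    = lin (@nd X Y n) l.
Proof.
move=> lK cl.
have clK : is_cycle pK (lin (@cone_retr n) l).
  case: n l lK cl => [//|n] l lK /= cl.
  by apply: incl_inj; rewrite -cbd_lin_incl [incl _]cone_retrK // cl /incl raddf0.
have [l' el'] := cone_acyclic pKwe clK.
exists (incl l').
  by apply: rpred_lin (supp_predT l') _ => t _; apply/supp_single/cone_incl_fixed.
by rewrite cbd_lin_incl el' -nd_lin_incl [incl _]cone_retrK.
Qed.

End FixedCone.
End EquivariantCone.

Section Contraction.
Variables (gT : finGroupType) (Z : fgset gT).

(** A linear family is a morphism over Z from the chains on Z x S to the chains on
    Z x T, both taken as functors on the orbit category: K goes to the chains on the
    points fixed by K.  It suffices to know it on each point (z, s), and its value
    there is supported on what the isotropy group of (z, s) fixes. *)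
Definition linear_family (S T : gset gT) (phi : Z -> S -> free T) : Prop :=
  (forall z s g, phi (fgset_act Z z g) (gset_act S s g) = free_act (phi z s) g) /\
  (forall (K : {group gT}) (z : gset_of_fgset Z) s,
     is_fixed K z -> is_fixed K s -> phi z s \in fixed_supp (S := T) K).

Variables (X Y : gspace gT) (p : gspace_map Y X).
Hypothesis pwe : forall (K : {group gT}) (z : gset_of_fgset Z),
  is_fixed K z -> weak_equiv (fixed_map K p).

Notation cone := (cone X Y).
Notation cone_gset := (cone_gset X Y).
Notation nd := (@nd X Y _).
Notation cbd := (@cbd X Y p _).

(** Each cycle t - R z t is filled on the fixed points of the isotropy group of
    (z, t), and equivariantly so by equivariant_choice; degenerate simplices are
    filled by 0. *)
Lemma equivariant_filling n (R : Z -> cone n -> free (cone n)) :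
  linear_family (S := cone_gset n) (T := cone_gset n) R ->
  (forall z t, cone_degenerate t -> R z t = 0) ->
  (forall z t, is_cycle p (single t - R z t)) ->
  exists H : Z -> cone n -> free (cone n.+1),
  [/\ linear_family (S := cone_gset n) (T := cone_gset n.+1) H,
      forall z t, cone_degenerate t -> H z t = 0
    & forall z t, lin cbd (H z t) = nd t - lin nd (R z t)].
Proof.
move=> [Ract Rsupp] Rdeg Rcyc.
pose W := pair_gset Z (cone_gset n).
pose P (w : W) (v : free (cone n.+1)) :=
  [/\ v \in fixed_supp (S := cone_gset n.+1) (isotropy_group w),
      cone_degenerate w.2 -> v = 0 & lin cbd v = nd w.2 - lin nd (R w.1 w.2)].
have fixW (K : {group gT}) (w : W) :
    is_fixed K w = is_fixed (S := Z) K w.1 && is_fixed (S := cone_gset n) K w.2.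
  apply/is_fixedP/andP => [fw|[/is_fixedP fz /is_fixedP ft] g gK].
    by split; apply/is_fixedP => g /fw e; rewrite -[in RHS]e.
  by case: w fz ft => z t /= fz ft; congr (_, _); [apply: fz|apply: ft].
have [|[z t]|H [Hact HP]] := @equivariant_choice _ W _
    (@free_act _ (cone_gset n.+1)) P (@free_actM _ (cone_gset n.+1)).
- move=> [z t] v g [vs vd ve]; split.
  + by rewrite isotropy_act; apply: fixed_supp_act.
  + by rewrite cone_degenerate_act => /vd->; apply: raddf0.
  rewrite (lin_free_act (S := cone_gset n.+1)) /= nd_act Ract (lin_free_act (S
    := cone_gset n)).
  rewrite (eq_lin (fun t => cbd_act p t g)) -[in LHS](raddf_lin (lin _)) ve.
  rewrite (eq_lin (fun t => nd_act t g)) -[in RHS](raddf_lin (lin _)) /free_act.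
  by rewrite raddfB.
- have fw : is_fixed (isotropy_group ((z, t) : W)) ((z,
  t) : W) by rewrite fixed_isotropy.
  have := fw; rewrite fixW => /andP[/= fz ft].
  have [dt|dt] := boolP (cone_degenerate t).
    exists 0; split; last by move=> g _; apply: raddf0.
    by split; rewrite ?rpred0 //= Rdeg // !raddf0 nd_normalized // addr0.
  have ls : single t - R z t \in fixed_supp (S :=
    cone_gset n) (isotropy_group ((z, t) : W)).
    by apply: rpredB; [apply: supp_single|apply: Rsupp].
  have [v vs ve] := fixed_cone_acyclic (pwe fz) ls (Rcyc z t).
  exists v; split; last by move=> g gG; apply: free_act_fixed vs gG.
  by split=> //=; [rewrite (negPf dt)|rewrite ve raddfB /= lin_single].
exists (fun z t => H (z, t)); split=> [|z t dt|z t].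
- split=> [z t g|K z t fz ft]; first exact: (Hact (z, t)).
  have [vs _ _] := HP (z, t); apply: fixed_suppS vs.
  by rewrite -fixed_isotropy fixW fz.
- by have [_ ->] := HP (z, t).
by have [_ _] := HP (z, t).
Qed.

(** An acyclic complex of free modules that is bounded below has a contraction:
    t - H (d t) is a cycle when H contracts the lower degrees, and H t is chosen to
    fill it.  The third clause of good, that H fills all cycles of its degree, is
    what the next step needs. *)
Lemma cone_contraction : exists H : forall n, Z -> cone n -> free (cone n.+1),
  [/\ forall n, linear_family (S := cone_gset n) (T := cone_gset n.+1) (H n),
      forall n z t, cone_degenerate t -> H n z t = 0,
      forall z t, lin cbd (H 0%N z t) = nd t
    & forall n z t, lin cbd (H n.+1 z t) = nd t - lin nd (lin (H n z) (cbd t))].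
Proof.
pose good n (H : Z -> cone n -> free (cone n.+1)) :=
  [/\ linear_family (S := cone_gset n) (T := cone_gset n.+1) H,
      forall z t, cone_degenerate t -> H z t = 0,
      forall (K : {group gT}) z l, is_fixed (S := Z) K z ->
        l \in fixed_supp (S := cone_gset n) K -> is_cycle p l ->
        lin cbd (lin (H z) l) = lin nd l
    & match n return (Z -> cone n -> free (cone n.+1)) -> Prop with
      | 0 => fun H => forall z t, lin cbd (H z t) = nd t
      | _.+1 => fun=> True
      end H].
pose next n (H : Z -> cone n -> free (cone n.+1)) (H' : Z -> cone n.+1 ->
  free (cone n.+2)) :=
  forall z t, lin cbd (H' z t) = nd t - lin nd (lin (H z) (cbd t)).
have [||H [Hgood Hnext]] := @dependent_sequence _ good next.
- have [|//|//|H [HF Hd HE]] := @equivariant_filling 0 (fun _ _ => 0).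
    by split=> [z s g|K z s _ _]; rewrite ?rpred0 // /free_act raddf0.
  have HE0 z t : lin cbd (H z t) = nd t by rewrite HE raddf0 subr0.
  by exists H; split=> // K z l _ _ _; rewrite lin_lin; apply: eq_lin.
- move=> n H [[Hact Hsupp] Hd HC _].
  pose R z (t : cone n.+1) := lin (H z) (cbd t).
  have cycle_cbd (t : cone n.+1) : is_cycle p (cbd t).
    by case: (n) t => [//|k] t; apply: (cbd_cbd p t).
  have RC z t : lin cbd (R z t) = cbd t.
    rewrite /R (HC 1%G) ?nd_cbd //.
      by apply/is_fixedP => g /set1P->; rewrite total_act1.
    by apply: cbd_supp; apply/is_fixedP => g /set1P->; rewrite total_act1.
  have [|||H' [HF' Hd' HE']] := @equivariant_filling n.+1 R.
  - split=> [z t g|K z t fz ft].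
      rewrite /R cbd_act (lin_free_act (S := cone_gset n)).
      rewrite /free_act lin_lin; apply: eq_lin => u; exact: Hact.
    apply: rpred_lin (cbd_supp p ft) _ => u fu; exact: Hsupp.
  - by move=> z t dt; rewrite /R cbd_normalized // raddf0.
  - by move=> z t; rewrite /= raddfB /= lin_single RC subrr.
  exists H' => //; split=> // K z l fz lK cl.
  rewrite lin_lin (eq_lin (HE' z)) linB -lin_lin.
  rewrite (_ : lin (R z) l = 0) ?raddf0 ?addr0 //.
  by rewrite -[LHS](lin_lin (H z)) cl raddf0.
exists H; split=> [n|n z t|z t|n z t].
- by have [] := Hgood n.
- by have [_ Hd _ _] := Hgood n; apply: Hd.
- by have [_ _ _ H0] := Hgood 0%N; apply: H0.
exact: Hnext.
Qed.

End Contraction.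

Section Deformation.
Variables (gT : finGroupType) (Z : fgset gT) (X Y : gspace gT) (p : gspace_map Y X).

Definition proj_inl n (t : cone X Y n) : free (X n) :=
  match t with inl x => single x | inr _ => 0 end.

Definition proj_inr n (t : cone X Y n) : free (Y n.-1) :=
  match t with inl _ => 0 | inr y => single y end.

Lemma proj_inl_family (S : gset gT) n (phi : Z -> S -> free (cone X Y n)) :
  linear_family (T := cone_gset X Y n) phi ->
  linear_family (T := level X n) (fun z s => lin (@proj_inl n) (phi z s)).
Proof.
move=> [phiA phiS]; split=> [z s g|K z s fz fs].
  rewrite phiA (lin_free_act (S := cone_gset X Y n)) /free_act lin_lin.
  by apply: eq_lin => -[x|y] /=; rewrite ?lin_single ?raddf0.
apply: rpred_lin (phiS K z s fz fs) _ => -[x|y] fx /=; last exact: rpred0.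
exact: (supp_single (P := is_fixed (S := level X n) K)).
Qed.

Lemma proj_inr_family (S : gset gT) n (phi : Z -> S -> free (cone X Y n)) :
  linear_family (T := cone_gset X Y n) phi ->
  linear_family (T := level Y n.-1) (fun z s => lin (@proj_inr n) (phi z s)).
Proof.
move=> [phiA phiS]; split=> [z s g|K z s fz fs].
  rewrite phiA (lin_free_act (S := cone_gset X Y n)) /free_act lin_lin.
  by apply: eq_lin => -[x|y] /=; rewrite ?lin_single ?raddf0.
apply: rpred_lin (phiS K z s fz fs) _ => -[x|y] fx /=; first exact: rpred0.
exact: (supp_single (P := is_fixed (S := level Y n.-1) K)).
Qed.

Lemma inl_family (S1 S2 T : gset gT) (phi : Z -> S1 + S2 -> free T) :
  linear_family (S := coprod_gset S1 S2) phi ->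
  linear_family (S := S1) (fun z s => phi z (inl s)).
Proof.
move=> [phiA phiS]; split=> [z s g|K z s fz fs].
  exact: (phiA z (inl s) g).
exact: (phiS K z (inl s) fz fs).
Qed.

Lemma inr_family (S1 S2 T : gset gT) (phi : Z -> S1 + S2 -> free T) :
  linear_family (S := coprod_gset S1 S2) phi ->
  linear_family (S := S2) (fun z s => phi z (inr s)).
Proof.
move=> [phiA phiS]; split=> [z s g|K z s fz fs].
  exact: (phiA z (inr s) g).
exact: (phiS K z (inr s) fz fs).
Qed.

Hypothesis pwe : forall (K : {group gT}) (z : gset_of_fgset Z),
  is_fixed K z -> weak_equiv (fixed_map K p).

(** The components of a contraction of the cone: a homotopy inverse r of p over Z,
    and the homotopies between p r and r p and the identity.  The homotopies are
    indexed by the degree of their target, so that degree 0 needs no exception.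
    The identities between normalized chains are stated as equalities between the
    values of all normalized cochains. *)
Lemma deformation : exists (r : forall n, Z -> X n -> free (Y n))
    (h : forall n, Z -> X n.-1 -> free (X n)) (k : forall n, Z -> Y n.-1 -> free (Y n)),
  [/\ forall n, [/\ linear_family (S := level X n) (T := level Y n) (r n),
        linear_family (S := level X n.-1) (T := level X n) (h n) &
        linear_family (S := level Y n.-1) (T := level Y n) (k n)],
      forall n z, [/\ forall x, degenerate x -> r n z x = 0,
        forall x, degenerate x -> h n z x = 0 &
        forall y, degenerate y -> k n z y = 0],
      forall (B : zmodType) n (b : Y n -> B), (forall y, degenerate y -> b y = 0) ->
        forall z x, lin (delta_fun b) (r n.+1 z x) = delta_fun (fun u => lin b (r n z u)) x,
      forall (B : zmodType) n (a : X n -> B), (forall x, degenerate x -> a x = 0) ->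
        forall z x, lin (delta_fun a) (h n.+1 z x) + lin (fun y => a (p n y)) (r n z x) +
          out_fun (fun u => lin a (h n z u)) x = a x
    & forall (B : zmodType) n (b : Y n -> B), (forall y, degenerate y -> b y = 0) ->
        forall z y, lin b (r n z (p n y)) =
          b y + lin (delta_fun b) (k n.+1 z y) + out_fun (fun u => lin b (k n z u)) y].
Proof.
have [H [HF Hd H0 HS]] := cone_contraction pwe.
have test0 (B : zmodType) (c : cone X Y 0 -> B) z t : normalized c ->
    lin (cone_d p c) (H 0%N z t) = c t.
  move=> nc; rewrite -(eq_lin (fun u => lin_cbd p u nc)) -lin_lin H0.
  exact: lin_nd.
have testS (B : zmodType) n (c : cone X Y n.+1 -> B) z t : normalized c ->
    lin (cone_d p c) (H n.+1 z t) + cone_d p (fun u => lin c (H n z u)) t = c t.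
  move=> nc; rewrite -(eq_lin (fun u => lin_cbd p u nc)) -lin_lin HS raddfB /=
    lin_nd //.
  have nH : normalized (fun u => lin c (H n z u)) by move=> u du;
    rewrite Hd ?raddf0.
  rewrite -(lin_cbd p t nH) [X in _ - X]lin_lin (eq_lin (fun u => lin_nd u nc))
    lin_lin.
  by rewrite subrK.
pose inX (B : zmodType) n (a : X n -> B) (t : cone X Y n) :=
  match t with inl x => a x | inr _ => 0 end.
have inX_lin (B : zmodType) n (a : X n -> B) l : lin (inX B n a) l = lin a (lin
  (@proj_inl n) l).
  by rewrite lin_lin; apply: eq_lin => -[x|y] /=; rewrite ?lin_single ?raddf0.
have inX_norm (B : zmodType) n (a : X n -> B) : (forall x, degenerate x ->
  a x = 0) ->
    normalized (inX B n a) by move=> na [x|y] //=; apply: na.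
have inX_d (B : zmodType) n (a : X n -> B) (l : free (cone X Y n.+1)) :
    lin (cone_d p (inX B n a)) l =
    lin (delta_fun a) (lin (@proj_inl n.+1) l) + lin (fun y => a (p n y)) (lin
      (@proj_inr n.+1) l).
  rewrite !lin_lin -linD; apply: eq_lin => -[x|y] /=.
    by rewrite lin_single raddf0 addr0.
  rewrite raddf0 lin_single add0r (_ : out_fun _ y = 0) ?subr0 //.
  by case: (n) a y => // m a' y'; rewrite /= /delta_fun big1 // => i _;
    rewrite mul0rz.
pose inY (B : zmodType) n (b : Y n -> B) (t : cone X Y n.+1) :=
  match t with inl _ => 0 | inr y => b y end.
have inY_lin (B : zmodType) n (b : Y n -> B) l :
    lin (inY B n b) l = lin b (lin (@proj_inr n.+1) l).
  by rewrite lin_lin; apply: eq_lin => -[x|y] /=; rewrite ?lin_single ?raddf0.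
have inY_norm (B : zmodType) n (b : Y n -> B) : (forall x, degenerate x ->
  b x = 0) ->
    normalized (inY B n b) by move=> nb [x|y] //=; apply: nb.
have inY_d (B : zmodType) n (b : Y n -> B) (l : free (cone X Y n.+2)) :
    lin (cone_d p (inY B n b)) l = - lin (delta_fun b) (lin (@proj_inr n.+2) l).
  rewrite lin_lin -[RHS]add0r -[X in X - _](lin0 _ l) -linB;
    apply: eq_lin => -[x|y].
    rewrite /= raddf0 subr0 /delta_fun big1 // => i _; exact: mul0rz.
  by rewrite /= lin_single.
exists (fun n z x => lin (@proj_inr n.+1) (H n z (inl x))).
exists (fun n => match n return Z -> X n.-1 -> free (X n) with
  | 0 => fun _ _ => 0
  | m.+1 => fun z x => lin (@proj_inl m.+1) (H m z (inl x))
  end).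
exists (fun n z y => lin (@proj_inr n.+1) (H n z (inr y))); split.
- move=> n; split.
  + exact: (proj_inr_family (n := n.+1) (@inl_family (level X n) (level Y n.-1)
    _ _ (HF n))).
  + case: n => [|n]; last exact: (proj_inl_family (n :=
    n.+1) (@inl_family (level X n) (level Y n.-1) _ _ (HF n))).
    by split=> [z s g|K z s _ _]; rewrite ?rpred0 // /free_act raddf0.
  + exact: (proj_inr_family (n := n.+1) (@inr_family (level X n) (level Y n.-1)
    _ _ (HF n))).
- move=> n z; split=> [x dx|x dx|y dy]; first by rewrite Hd ?raddf0.
    by case: n x dx => // n x dx; rewrite Hd ?raddf0.
  by rewrite Hd ?raddf0 //= dy orbT.
- move=> B n b nb z x; have := testS B n (inY B n b) z (inl x) (inY_norm B n b nb).
  rewrite inY_d /= => /eqP; rewrite addrC subr_eq0 => /eqP <-.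
  by apply: eq_bigr => i _; rewrite /= inY_lin.
- move=> B [|n] a na z x.
    by rewrite addr0 -inX_d test0 //; apply: inX_norm.
  rewrite -inX_d -[RHS](testS B n (inX B n.+1 a) z (inl x) (inX_norm B n.+1 a na)).
  by congr (_ + _); apply: eq_bigr => i _; rewrite /= inX_lin.
move=> B n b nb z y.
have := testS B n (inY B n b) z (inr y) (inY_norm B n b nb).
rewrite inY_d /= inY_lin.
have -> : out_fun ((fun u => lin (inY B n b) (H n z u)) \o inr) y =
    out_fun (fun u => lin b (lin (@proj_inr n.+1) (H n z (inr u)))) y.
  by case: (n) b y {nb} => // m b y; apply: eq_bigr => i _; rewrite /= inY_lin.
by move=> <-; rewrite [X in X + out_fun _ _]addrAC addNr add0r subrK.
Qed.

End Deformation.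

(** * Homotopy equivalences induce bijections on homology *)

Lemma additive_bijective (A B : zmodType) (f : {additive A -> B}) :
  (forall x, f x = 0 -> x = 0) -> (forall y, exists x, f x = y) -> bijective f.
Proof.
move=> f0 /boolp.choice[g gK]; have f_inj : injective f by apply: raddf_inj.
by exists g => // x; apply: f_inj; rewrite gK.
Qed.

Section HomologyClasses.
Variables (A B C : zmodType) (f : {additive A -> B}) (g : {additive B -> C}).

Definition hclass : {additive kernel g -> homology f g} :=
  \pi_{quot is_boundary f g}%qT.

Lemma hclassP (x : homology f g) : exists z, x = hclass z.
Proof. by exists (repr x); rewrite /hclass /= reprK. Qed.

Lemma hclass_eq0 z : hclass z = 0 <-> exists a, f a = val z.
Proof.
have -> : (hclass z = 0) <-> z \in is_boundary f g.
  by rewrite -(raddf0 hclass) -{2}[z]subr0 idealrBE; split=> [->|/eqP].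
by rewrite unfold_in; split=> [/asboolP|e]; last apply/asboolP.
Qed.

Lemma hclass_eq z z' : (exists a, f a = val z - val z') -> hclass z = hclass z'.
Proof. by move=> e; apply/eqP; rewrite -subr_eq0 -raddfB; apply/eqP/hclass_eq0. Qed.

End HomologyClasses.

Section ChainEquivalence.
Variables (C D : chain_complex) (f : chain_map C D).
Variables (r : forall n, D n -> C n) (h : forall n, D n.-1 ->
  D n) (k : forall n, C n.-1 -> C n).
Arguments r : clear implicits.
Arguments h : clear implicits.
Arguments k : clear implicits.
Hypothesis h0 : forall n, h n 0 = 0.
Hypothesis k0 : forall n, k n 0 = 0.
Hypothesis r0 : forall n, r n 0 = 0.
Hypothesis rd : forall n x, chain_d C n (r n.+1 x) = r n (chain_d D n x).
Hypothesis fr : forall n x, chain_d D n (h n.+1 x) + f n (r n x) + h n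
  (chain_out D n x) = x.
Hypothesis rf : forall n y, r n (f n y) = y + chain_d C n (k n.+1 y) + k n
  (chain_out C n y).

Lemma chain_equiv_bijective n : bijective (chain_homology_map f n).
Proof.
have r_out m x : chain_out C m (r m x) = r m.-1 (chain_out D m x).
  by case: m x => [|m] x /=; rewrite ?r0 ?rd.
have mapE (z : kernel (chain_out C n)) : exists2 z', val z' = f n (val z) &
    chain_homology_map f n (hclass (chain_d C n) _ z) = hclass (chain_d D n) _ z'.
  exists (ker_map (@chain_map_out _ _ f n) z) => //.
  exact: quot_map_pi.
apply: additive_bijective => [x|y].
  have [z ->] := hclassP x; have [z' ez' ->] := mapE z.
  move=> /hclass_eq0[a]; rewrite ez' => ea; apply/hclass_eq0.
  exists (r n.+1 a - k n.+1 (val z)); rewrite raddfB /= rd ea rf.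
  by rewrite (eqP (valP z)) k0 addr0 addrK.
have [z ->] := hclassP y.
have zP : r n (val z) \in in_ker (chain_out C n).
  by rewrite unfold_in r_out (eqP (valP z)) r0.
exists (hclass _ _ (Ker zP)); have [z' ez' ->] := mapE (Ker zP).
apply: hclass_eq; exists (- h n.+1 (val z)); rewrite raddfN /= ez'.
by rewrite -[X in _ - X](fr (val z)) (eqP (valP z)) h0 addr0 opprD addrCA subrr
  addr0.
Qed.

End ChainEquivalence.

Section CochainEquivalence.
Variables (C D : cochain_complex) (f : cochain_map D C).
Variables (r : forall n, C n -> D n) (h : forall n, D n ->
  D n.-1) (k : forall n, C n -> C n.-1).
Arguments r : clear implicits.
Arguments h : clear implicits.
Arguments k : clear implicits.
Hypothesis h0 : forall n, h n 0 = 0.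
Hypothesis k0 : forall n, k n 0 = 0.
Hypothesis r0 : forall n, r n 0 = 0.
Hypothesis rd : forall n x, cochain_d D n (r n x) = r n.+1 (cochain_d C n x).
Hypothesis fr : forall n x,
  h n.+1 (cochain_d D n x) + r n (f n x) + cochain_in D n (h n x) = x.
Hypothesis rf : forall n y,
  f n (r n y) = y + k n.+1 (cochain_d C n y) + cochain_in C n (k n y).

Lemma cochain_equiv_bijective n : bijective (cochain_homology_map f n).
Proof.
have r_in m x : cochain_in D m (r m.-1 x) = r m (cochain_in C m x).
  by case: m x => [|m] x /=; rewrite ?r0 ?rd.
have mapE (z : kernel (cochain_d D n)) : exists2 z', val z' = f n (val z) &
    cochain_homology_map f n (hclass (cochain_in D n) _ z) = hclass (cochain_in C n) _ z'.
  exists (ker_map (cochain_mapP f (n := n)) z) => //.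
  exact: quot_map_pi.
apply: additive_bijective => [x|y].
  have [z ->] := hclassP x; have [z' ez' ->] := mapE z.
  move=> /hclass_eq0[a]; rewrite ez' => ea; apply/hclass_eq0.
  exists (r n.-1 a + h n (val z)); rewrite raddfD /= r_in ea -[RHS]fr.
  by rewrite (eqP (valP z)) h0 add0r.
have [z ->] := hclassP y.
have zP : r n (val z) \in in_ker (cochain_d D n).
  by rewrite unfold_in rd (eqP (valP z)) r0.
exists (hclass _ _ (Ker zP)); have [z' ez' ->] := mapE (Ker zP).
apply: hclass_eq; exists (k n (val z)); rewrite ez' /= rf.
by rewrite (eqP (valP z)) k0 addr0 addrC addKr.
Qed.

End CochainEquivalence.

(** * Linear families act on the values of a Mackey functor *)

Section FiniteValues.
Variables (gT : finGroupType) (M : mackey gT).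
Implicit Types (S T : gset gT) (U V W : fgset gT).

Definition sub_val S (A : finsub S) : gmap A S :=
  @GMap gT A S val (fun _ _ => erefl).

Lemma full_stable W : gstable (S := W) [fset x in fcar W]%fset.
Proof. by apply/forallP => g; apply/forallP => x; rewrite !inE. Qed.

Definition full W : finsub W := exist (fun A => gstable A) _ (full_stable W).

Lemma mem_full W x : x \in sval (full W).
Proof. by rewrite !inE. Qed.

Definition to_full W : gmap W (full W).
Proof.
exists (fun x => [` mem_full x]%fset : full W) => x g; exact: val_inj.
Defined.

(** The extensions of M to all G-sets agree with M on finite G-sets; of_value and
    to_value are the comparison maps. *)
Definition of_value W (x : M W) : ecov M W := germ_of (mcov M (to_full W) x).

Lemma of_value_is_zmod_morphism W : zmod_morphism (@of_value W).
Proof.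
move=> x y; rewrite /of_value raddfB /= -[RHS]/(ecov_add _ (ecov_opp _)).
by rewrite germ_ofN germ_ofD.
Qed.

HB.instance Definition _ W :=
  GRing.isZmodMorphism.Build (M W) (ecov M W) (@of_value W)
    (@of_value_is_zmod_morphism W).

Lemma of_value_map V W (f : gmap V W) x : ecov_map f (of_value x) = of_value
  (mcov M f x).
Proof.
rewrite /of_value (@ecov_map_germ _ M V W f (full V) (full W) (fun z _ =>
  mem_full (f z))).
by rewrite -!mcov_comp; congr (germ_of (mcov M _ _)); apply: gmap_ext => z;
  apply: val_inj.
Qed.

Lemma of_value_sub S (A : finsub S) (x : M A) : ecov_map (sub_val A) (of_value
  x) = germ_of x.
Proof.
rewrite /of_value.
rewrite (@ecov_map_germ _ M A S (sub_val A) (full A) A (fun z _ => valP z)).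
rewrite -mcov_comp -[in RHS](mcov_id x); congr (germ_of (mcov M _ _)).
by apply: gmap_ext => z; apply: val_inj.
Qed.

Definition to_value W (y : econ M W) : M W := mcon M (to_full W) (y (full W)).

Lemma to_value_is_zmod_morphism W : zmod_morphism (@to_value W).
Proof. by move=> x y; rewrite /to_value /= raddfB. Qed.

HB.instance Definition _ W :=
  GRing.isZmodMorphism.Build (econ M W) (M W) (@to_value W)
    (@to_value_is_zmod_morphism W).

Lemma to_value_map V W (f : gmap V W) (y : econ M W) :
  mcon M f (to_value y) = to_value (econ_map f y).
Proof.
rewrite /to_value /=.
have sub : {subset sval (gimage f (full V)) <= sval (full W)} by move=> z _;
  apply: mem_full.
rewrite -(econP y sub) -!mcon_comp; congr (mcon M _ _).
by apply: gmap_ext => z; apply: val_inj.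
Qed.

Lemma to_value_sub S (A : finsub S) (y : econ M S) : to_value (econ_map
  (sub_val A) y) = y A.
Proof.
rewrite /to_value /=.
have sub : {subset sval (gimage (sub_val A) (full A)) <= sval A}.
  by move=> z /imfsetP[w /= _ ->]; apply: valP.
rewrite -(econP y sub) -!mcon_comp -[RHS]mcon_id; congr (mcon M _ _).
by apply: gmap_ext => z; apply: val_inj.
Qed.

(** ** Orbit decomposition *)

Lemma mackey_empty W : (fcar W -> False) -> forall x : M W, x = 0.
Proof.
move=> W0 x; have /bij_inj inj := mcov_sum M W W.
have e : ginl W W = ginr W W by apply: gmap_ext => w; case: (W0 w).
suff [//] : (x, 0 : M W) = (0, x) by [].
by apply: inj; rewrite /= e !raddf0 addr0 add0r.
Qed.

Lemma mackey_inj U W (i : gmap U W) : injective i -> forall x,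
  mcon M i (mcov M i x) = x.
Proof.
move=> i_inj x; rewrite -(@mackey_pullback _ M U U U W (gid U) (gid U)).
  by rewrite mcon_id mcov_id.
split=> [//|u v /i_inj uv]; exists u; split=> [|w []] //=.
Qed.

Lemma mackey_disjoint U V W (i : gmap U W) (j : gmap V W) :
  (forall u v, i u <> j v) -> forall x, mcon M i (mcov M j x) = 0.
Proof.
move=> ij x; pose E := finsub0 U.
have noE : fcar E -> False by case.
pose f := @GMap gT E V (fun e => False_rect (fcar V) (noE e))
  (fun e _ => False_ind _ (noE e)).
rewrite -(@mackey_pullback _ M E U V W (sub_val E) f).
  by rewrite [mcon M f x](mackey_empty noE) raddf0.
by split=> [e|u v /ij //]; case: (noE e).
Qed.

(** Additivity of M for a disjoint union that is given inside of W. *)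
Lemma mackey_complement U V W (i : gmap U W) (j : gmap V W) :
  injective i -> injective j -> (forall u v, i u <> j v) ->
  (forall w, (exists u, w = i u) \/ (exists v, w = j v)) ->
  forall x : M W, exists a b, x = mcov M i a + mcov M j b.
Proof.
move=> i_inj j_inj ij surj x.
pose c (s : gsum U V) : W := match s with inl u => i u | inr v => j v end.
have [c' c'K] : exists c' : W -> gsum U V, forall w, c (c' w) = w.
  suff /boolp.choice[c' ?] : forall w, exists s, c s = w by exists c'.
  by move=> w; case: (surj w) => -[u ->]; [exists (inl u)|exists (inr u)].
have c_inj : injective c.
  move=> [u|v] [u'|v'] //= e; first by rewrite (i_inj _ _ e).
  - by case: (ij _ _ e).
  - by case: (ij u' v).
  - by rewrite (j_inj _ _ e).
have cact s g : c (gset_act (gsum U V) s g) = gset_act W (c s) g.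
  by case: s => s /=; rewrite gfunP.
pose cm : gmap (gsum U V) W := GMap cact.
have c'act w g : c' (gset_act W w g) = gset_act (gsum U V) (c' w) g.
  by apply: c_inj; rewrite c'K cact c'K.
pose cm' : gmap W (gsum U V) := GMap c'act.
have [s _ sK] := mcov_sum M U V.
exists (s (mcov M cm' x)).1, (s (mcov M cm' x)).2.
rewrite -[LHS]mcov_id -[gid W](_ : gcomp cm cm' = _); last exact: gmap_ext.
rewrite mcov_comp -{1}[mcov M cm' x]sK raddfD /= -!mcov_comp.
by congr (_ + _); congr (mcov M _ _); apply: gmap_ext.
Qed.

Definition orbit_fset W (r : W) : {fset W} := [fset gset_act W r g | g in gT]%fset.

Lemma orbit_stable W (r : W) : gstable (S := W) (orbit_fset r).
Proof.
apply/forallP => g; apply/forallP => -[y /= /imfsetP[h /= _ ->]].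
by apply/imfsetP; exists (h * g)%g; rewrite //= total_actM.
Qed.

Definition orb W (r : W) : finsub W := exist (fun A => gstable A) _
  (orbit_stable r).

Lemma orbP W (r s : W) : reflect (exists g, s = gset_act W r g) (s \in sval
  (orb r)).
Proof.
by apply: (iffP (imfsetP _ _ _ _)) => [[g _ ->]|[g ->]]; exists g.
Qed.

Lemma orb_refl W (r : W) : r \in sval (orb r).
Proof. by apply/orbP; exists 1%g; rewrite total_act1. Qed.

Definition base W (r : W) : orb r := [` orb_refl r]%fset.

Lemma orb_trans W (r : W) (o : orb r) : exists g, o = gset_act (orb r) (base r) g.
Proof.
by have /orbP[g e] := valP o; exists g; apply: val_inj.
Qed.

Lemma orb_ext W (r : W) T (f g : gmap (orb r) T) : f (base r) = g (base r) -> f = g.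
Proof.
by move=> e; apply: gmap_ext => o; have [a ->] := orb_trans o; rewrite !gfunP e.
Qed.

Lemma sub_val_inj S (A : finsub S) : injective (sub_val A).
Proof. exact: val_inj. Qed.

(** M W is generated by its values on the orbits: split off one orbit at a time, by
    induction on the number of points. *)
Lemma mackey_generated W (Q : M W -> Prop) :
  Q 0 -> (forall x y, Q x -> Q y -> Q (x + y)) ->
  (forall (r : W) (x : M (orb r)), Q (mcov M (sub_val (orb r)) x)) -> forall x, Q x.
Proof.
move=> Q0 QD Qorb.
suff sub n (A : finsub W) : (#|` sval A| < n)%N -> forall x : M A,
  Q (mcov M (sub_val A) x).
  move=> x; rewrite -[x]mcov_id.
  rewrite -[gid W](_ : gcomp (sub_val (full W)) (to_full W) = _);
    last exact: gmap_ext.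
  by rewrite mcov_comp; apply: sub.
elim: n A => // n IHn A An x.
have [A0|[a aA]] := fset_0Vmem (sval A).
  have nA : fcar A -> False by case=> a; rewrite A0.
  by rewrite (mackey_empty nA x) raddf0.
have Bst : gstable (S := W) (sval A `\` sval (orb a))%fset.
  apply/forallP => g; apply/forallP => -[y /= /fsetDP[yA ya]].
  apply/fsetDP; split; first exact: (gstableP g yA).
  apply: contra ya => /(@gstableP _ _ (orb a) _ g^-1%g).
  by rewrite -total_actM mulgV total_act1.
pose B : finsub W := exist (fun C => gstable C) _ Bst.
have OA : {subset sval (orb a) <= sval A} by move=> _ /orbP[g ->]; apply: gstableP.
have BA : {subset sval B <= sval A} by move=> y /fsetDP[].
have [| | | |u [v ->]] := @mackey_complement (orb a) B A (Defs.incl OA)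
  (Defs.incl BA) _ _ _ _ x.
- by move=> y y' /(congr1 val) /= e; apply: val_inj.
- by move=> y y' /(congr1 val) /= e; apply: val_inj.
- move=> u v /(congr1 val) /= e; have /fsetDP[_ /negP[]] := valP v.
  by have <- : val u = val v := e; apply: valP.
- move=> w; have [wO|wO] := boolP (val w \in sval (orb a)).
    by left; exists [` wO]%fset; apply: val_inj.
  have wB : val w \in sval B by apply/fsetDP; split; first exact: valP.
  by right; exists [` wB]%fset; apply: val_inj.
rewrite raddfD /= -!mcov_comp; apply: QD.
  by rewrite (_ : gcomp _ _ = sub_val (orb a)); [apply: Qorb|apply: gmap_ext].
rewrite (_ : gcomp _ _ = sub_val B); last exact: gmap_ext.
apply: IHn; apply: leq_trans (_ : #|` sval A| <= n)%N; last by rewrite -ltnS.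
apply: fproper_ltn_card; rewrite fproperE; apply/andP; split; first exact/fsubsetP.
by apply/negP => /fsubsetP/(_ a aA)/fsetDP[_]; rewrite orb_refl.
Qed.

End FiniteValues.

Section PointValues.
Variables (gT : finGroupType) (M : mackey gT).
Implicit Types (S T : gset gT) (U V W : fgset gT).

Lemma orb_fixed W (r : W) T (f : gmap (orb r) T) : is_fixed (isotropy_group r)
  (f (base r)).
Proof.
apply/is_fixedP => g /isotropyP gr; rewrite -gfunP; congr (f _).
exact: val_inj.
Qed.

Lemma orb_map_exists W (r : W) T (t : T) :
  is_fixed (isotropy_group r) t -> exists f : gmap (orb r) T, f (base r) = t.
Proof.
move=> ft; have /boolp.choice[tr trP] (o : orb r) : exists g,
  val o = gset_act W r g.
  by have /orbP := valP o.
have trE g h : gset_act W r g = gset_act W r h -> gset_act T t g = gset_act T t h.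
  move=> e; have gh : (g * h^-1)%g \in isotropy_group r.
    by apply/isotropyP; rewrite total_actM e -total_actM mulgV total_act1.
  by rewrite -[in LHS](mulgKV h g) total_actM (is_fixedP _ _ ft _ gh).
have fact (o : orb r) g : gset_act T t (tr (gset_act (orb r) o g)) =
    gset_act T (gset_act T t (tr o)) g.
  by rewrite -total_actM; apply: trE; rewrite -trP total_actM -trP.
exists (GMap fact) => /=; rewrite -[RHS](total_act1 (gset_act T)); apply: trE.
by rewrite -trP total_act1.
Qed.

Definition orb_map W (r : W) T (t : T) (ft : is_fixed (isotropy_group r) t) :
  gmap (orb r) T := sval (cid (orb_map_exists ft)).

Lemma orb_map_base W (r : W) T (t : T) (ft : is_fixed (isotropy_group r) t) :
  orb_map ft (base r) = t.
Proof. exact: (svalP (cid (orb_map_exists ft))). Qed.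

(** There is a G-map from the orbit of r that takes r to t exactly when t is fixed
    by the isotropy group of r.  With the value 0 for the other points, point_cov is
    a function of all t, which lin extends to chains; and likewise point_con. *)
Definition point_cov W (r : W) T (x : M (orb r)) (t : T) : ecov M T :=
  match @idP (is_fixed (isotropy_group r) t) with
  | ReflectT ft => ecov_map (orb_map ft) (of_value x)
  | ReflectF _ => 0
  end.

Lemma point_covE W (r : W) T (x : M (orb r)) (f : gmap (orb r) T) :
  point_cov x (f (base r)) = ecov_map f (of_value x).
Proof.
rewrite /point_cov; case: {-}_ / idP => [ft|[]]; last exact: orb_fixed.
by congr (ecov_map _ _); apply: orb_ext; rewrite orb_map_base.
Qed.

Lemma point_cov_is_zmod_morphism W (r : W) T (t : T) :
  zmod_morphism (fun x : M (orb r) => point_cov x t).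
Proof. by move=> x y; rewrite /point_cov; case: {-}_ / idP => [ft|_];
  rewrite ?raddfB ?subr0. Qed.

Lemma point_cov_map W (r : W) S T (q : gmap S T) (x : M (orb r)) (t : S) :
  is_fixed (isotropy_group r) t -> ecov_map q (point_cov x t) = point_cov x (q t).
Proof.
move=> /orb_map_exists[f <-]; rewrite point_covE -ecov_map_comp.
by rewrite -(point_covE x (gcomp q f)).
Qed.

Lemma point_cov_comp V W (s : V) (r : W) T (f : gmap (orb s) (orb r)) g
    (x : M (orb s)) (t : T) :
  f (base s) = gset_act (orb r) (base r) g -> is_fixed (isotropy_group r) t ->
  point_cov (mcov M f x) t = point_cov x (gset_act T t g).
Proof.
move=> fs /orb_map_exists[F <-]; rewrite point_covE -gfunP -fs.
by rewrite (point_covE x (gcomp F f)) ecov_map_comp of_value_map.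
Qed.

Definition point_con W (r : W) T (y : econ M T) (t : T) : M (orb r) :=
  match @idP (is_fixed (isotropy_group r) t) with
  | ReflectT ft => to_value (econ_map (orb_map ft) y)
  | ReflectF _ => 0
  end.

Lemma point_conE W (r : W) T (y : econ M T) (f : gmap (orb r) T) :
  point_con r y (f (base r)) = to_value (econ_map f y).
Proof.
rewrite /point_con; case: {-}_ / idP => [ft|[]]; last exact: orb_fixed.
by congr (to_value (econ_map _ _)); apply: orb_ext; rewrite orb_map_base.
Qed.

Lemma point_con_is_zmod_morphism W (r : W) T (t : T) :
  zmod_morphism (fun y : econ M T => point_con r y t).
Proof. by move=> x y; rewrite /point_con; case: {-}_ / idP => [ft|_];
  rewrite ?raddfB ?subr0. Qed.

Lemma point_con_map W (r : W) S T (q : gmap S T) (y : econ M T) (t : S) :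
  is_fixed (isotropy_group r) t -> point_con r (econ_map q y) t = point_con r y
    (q t).
Proof.
move=> /orb_map_exists[f <-]; rewrite point_conE -econ_map_comp.
by rewrite -(point_conE y (gcomp q f)).
Qed.

Lemma point_con_comp V W (s : V) (r : W) T (f : gmap (orb s) (orb r)) g
    (y : econ M T) (t : T) :
  f (base s) = gset_act (orb r) (base r) g -> is_fixed (isotropy_group r) t ->
  mcon M f (point_con r y t) = point_con s y (gset_act T t g).
Proof.
move=> fs /orb_map_exists[F <-]; rewrite point_conE -gfunP -fs.
by rewrite (point_conE y (gcomp F f)) econ_map_comp to_value_map.
Qed.

Definition orb_rep W (r : W) : W := choose [pred u | u \in sval (orb r)] r.

Lemma orb_repP W (r : W) : orb_rep r \in sval (orb r).
Proof. exact: (@chooseP _ [pred u | u \in sval (orb r)] r (orb_refl r)). Qed.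

Lemma orb_sym W (r s : W) : s \in sval (orb r) -> r \in sval (orb s).
Proof.
by move=> /orbP[g ->]; apply/orbP; exists g^-1%g;
  rewrite -total_actM mulgV total_act1.
Qed.

Lemma orb_sub W (r s u : W) : s \in sval (orb r) -> u \in sval (orb s) ->
  u \in sval (orb r).
Proof.
by move=> /orbP[g ->] /orbP[h ->]; apply/orbP; exists (g * h)%g; rewrite total_actM.
Qed.

Lemma orb_rep_eq W (r s : W) : s \in sval (orb r) -> orb_rep s = orb_rep r.
Proof.
move=> sr; rewrite /orb_rep; have e : [pred u | u \in sval (orb s)] =1 [pred u
  | u \in sval (orb r)].
  by move=> u; apply/idP/idP => /= us; [apply: orb_sub us|apply: orb_sub
    (orb_sym sr) us].
by rewrite (eq_choose e); apply: choose_id => //=; apply: orb_refl.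
Qed.

Lemma orb_rep_disjoint W (r s : W) : orb_rep r <> orb_rep s ->
  forall u v, sub_val (orb r) u <> sub_val (orb s) v.
Proof.
move=> ne u v /= uv; apply: ne.
by rewrite -(orb_rep_eq (valP u)) -(orb_rep_eq (valP v)); congr orb_rep.
Qed.

Lemma orb_to_rep W (s : W) : exists (j : gmap (orb s) (orb (orb_rep s))) g,
  [/\ j (base s) = gset_act (orb (orb_rep s)) (base (orb_rep s)) g,
      s = gset_act W (orb_rep s) g &
      sub_val (orb s) = gcomp (sub_val (orb (orb_rep s))) j].
Proof.
have rs := orb_sym (orb_repP s).
have sub : forall y, y \in sval (orb s) -> gid W y \in sval (orb (orb_rep s)).
  by move=> y; apply: orb_sub.
have /orbP[g sg] := rs.
by exists (restr sub), g; split=> //; [apply: val_inj|apply: gmap_ext].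
Qed.

Section Family.
Variable T : gset gT.

Definition family W (phi : W -> free T) : Prop :=
  (forall w g, phi (gset_act W w g) = free_act (phi w) g) /\
  (forall w, phi w \in fixed_supp (isotropy_group w)).

(** On the orbit of r, a family phi is the linear combination of the G-maps that
    take r to the points of phi r; fam_cov and fam_con are the sums over the orbits
    of the corresponding combinations of maps induced by M. *)
Definition fam_cov W (phi : W -> free T) (x : M W) : ecov M T :=
  \sum_(r : fcar W | orb_rep r == r) lin (point_cov (mcon M (sub_val (orb r))
    x)) (phi r).

Lemma fam_cov_is_zmod_morphism W (phi : W -> free T) : zmod_morphism (fam_cov phi).
Proof.
move=> x y; rewrite /fam_cov -sumrB; apply: eq_bigr => r _; rewrite -linB.
by apply: eq_lin => t; rewrite raddfB point_cov_is_zmod_morphism.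
Qed.

HB.instance Definition _ W (phi : W -> free T) :=
  GRing.isZmodMorphism.Build (M W) (ecov M T) (fam_cov phi)
    (fam_cov_is_zmod_morphism phi).

Lemma fam_cov_orb W (phi : W -> free T) (s : W) (x : M (orb s)) : family phi ->
  fam_cov phi (mcov M (sub_val (orb s)) x) = lin (point_cov x) (phi s).
Proof.
move=> [phiA phiS].
have rep_rep : orb_rep (orb_rep s) = orb_rep s by apply/orb_rep_eq/orb_repP.
have [j [g [jg sg ej]]] := orb_to_rep s.
have phis : phi s = free_act (phi (orb_rep s)) g by rewrite -phiA -sg.
rewrite /fam_cov (bigD1 (orb_rep s)) ?rep_rep //= big1 ?addr0; last first.
  move=> r /andP[/eqP er ne]; rewrite mackey_disjoint.
    rewrite -[RHS](lin0 _ (phi r)); apply: eq_lin => t.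
    by have := point_cov_is_zmod_morphism t (0 : M (orb r)) 0; rewrite !subrr.
  by apply: orb_rep_disjoint; rewrite er; apply/eqP.
rewrite {1}ej mcov_comp mackey_inj; last exact: sub_val_inj.
rewrite phis lin_free_act; apply: eq_lin_supp (phiS _) _ => t ft.
exact: point_cov_comp.
Qed.

Lemma family_comp V W (f : gmap V W) (phi : W -> free T) :
  family phi -> family (fun v => phi (f v)).
Proof.
move=> phiF; split=> [v g|v]; first by rewrite gfunP phiF.1.
apply: fixed_suppS (phiF.2 _); rewrite -fixed_isotropy.
by apply: is_fixed_map; rewrite fixed_isotropy.
Qed.

(** Both sides are determined by their values on the orbits of V, where
    point_cov_comp compares the maps from the orbits of v and of f v. *)
Lemma fam_cov_nat V W (f : gmap V W) (phi : W -> free T) x : family phi ->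
  fam_cov phi (mcov M f x) = fam_cov (fun v => phi (f v)) x.
Proof.
move=> phiF; have phifF := family_comp f phiF;
  elim/mackey_generated: x => [|x y ex ey|s x]; first by rewrite !raddf0.
  by rewrite !raddfD /= ex ey.
rewrite (fam_cov_orb x phifF).
have sub : forall y, y \in sval (orb s) -> f y \in sval (orb (f s)).
  by move=> _ /orbP[g ->]; apply/orbP; exists g; rewrite gfunP.
rewrite -mcov_comp.
rewrite (_ : gcomp f _ = gcomp (sub_val (orb (f s))) (restr sub));
  last exact: gmap_ext.
rewrite mcov_comp fam_cov_orb //; apply: eq_lin_supp (phiF.2 _) _ => t ft.
rewrite (point_cov_comp (g := 1%g)) ?total_act1 //.
exact: val_inj.
Qed.

Definition fam_con W (phi : W -> free T) (y : econ M T) : M W :=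
  \sum_(r : fcar W | orb_rep r == r) mcov M (sub_val (orb r)) (lin (point_con r
    y) (phi r)).

Lemma fam_con_is_zmod_morphism W (phi : W -> free T) : zmod_morphism (fam_con phi).
Proof.
move=> x y; rewrite /fam_con -sumrB; apply: eq_bigr => r _; rewrite -raddfB -linB.
by congr (mcov M _ _); apply: eq_lin => t; rewrite point_con_is_zmod_morphism.
Qed.

HB.instance Definition _ W (phi : W -> free T) :=
  GRing.isZmodMorphism.Build (econ M T) (M W) (fam_con phi)
    (fam_con_is_zmod_morphism phi).

Lemma fam_con_orb W (phi : W -> free T) (s : W) (y : econ M T) : family phi ->
  mcon M (sub_val (orb s)) (fam_con phi y) = lin (point_con s y) (phi s).
Proof.
move=> [phiA phiS].
have rep_rep : orb_rep (orb_rep s) = orb_rep s by apply/orb_rep_eq/orb_repP.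
have [j [g [jg sg ej]]] := orb_to_rep s.
have phis : phi s = free_act (phi (orb_rep s)) g by rewrite -phiA -sg.
rewrite /fam_con raddf_sum (bigD1 (orb_rep s)) ?rep_rep //= big1 ?addr0; last first.
  move=> r /andP[/eqP er ne]; apply: mackey_disjoint => u v uv.
  by apply: (@orb_rep_disjoint _ r s) (esym uv); rewrite er; apply/eqP.
rewrite {1}ej mcon_comp mackey_inj; last exact: sub_val_inj.
rewrite raddf_lin phis lin_free_act; apply: eq_lin_supp (phiS _) _ => t ft.
exact: point_con_comp.
Qed.

(** The values on the orbits are direct summands of M W, and the projections on them
    are the restrictions. *)
Lemma mackey_restr_inj W (x y : M W) :
  (forall r, mcon M (sub_val (orb r)) x = mcon M (sub_val (orb r)) y) -> x = y.
Proof.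
have dec (z : M W) :
    z = \sum_(r : fcar W | orb_rep r == r)
      mcov M (sub_val (orb r)) (mcon M (sub_val (orb r)) z).
  elim/mackey_generated: z => [|u v eu ev|s u].
  - by rewrite big1 // => r _; rewrite !raddf0.
  - by rewrite {1}eu {1}ev -big_split; apply: eq_bigr => r _; rewrite !raddfD.
  have [j [g [_ _ ej]]] := orb_to_rep s.
  have rep_rep : orb_rep (orb_rep s) = orb_rep s by apply/orb_rep_eq/orb_repP.
  rewrite (bigD1 (orb_rep s)) ?rep_rep //= big1 ?addr0 => [|r /andP[/eqP er ne]].
    by rewrite {2}ej mcov_comp mackey_inj -?mcov_comp -?ej //; apply: sub_val_inj.
  rewrite mackey_disjoint ?raddf0 //.
  by apply: orb_rep_disjoint; rewrite er; apply/eqP.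
by move=> xy; rewrite [x]dec [y]dec; apply: eq_bigr => r _; rewrite xy.
Qed.

Lemma fam_con_nat V W (f : gmap V W) (phi : W -> free T) y : family phi ->
  mcon M f (fam_con phi y) = fam_con (fun v => phi (f v)) y.
Proof.
move=> phiF; apply: mackey_restr_inj => s.
rewrite (fam_con_orb _ _ (family_comp f phiF)).
have sub : forall y, y \in sval (orb s) -> f y \in sval (orb (f s)).
  by move=> _ /orbP[g ->]; apply/orbP; exists g; rewrite gfunP.
rewrite -mcon_comp.
rewrite (_ : gcomp f _ = gcomp (sub_val (orb (f s))) (restr sub));
  last exact: gmap_ext.
rewrite mcon_comp fam_con_orb // raddf_lin; apply: eq_lin_supp (phiF.2 _) _ => t ft.
rewrite [LHS](point_con_comp (g := 1%g)) ?total_act1 //.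
exact: val_inj.
Qed.

End Family.

End PointValues.

Section Relative.
Variables (gT : finGroupType) (M : mackey gT) (Z : fgset gT).
Variable sigma : mackey_hom M (mshift M Z).
Hypothesis theta_sigma : forall S x, theta M Z S (sigma S x) = x.
Implicit Types S T : gset gT.

Definition on_prod S T (A : finsub S) (phi : Z -> S ->
  free T) (w : gprod Z A) : free T :=
  phi w.1 (val w.2).

Lemma family_on_prod S T (A : finsub S) (phi : Z -> S -> free T) :
  linear_family phi -> family (on_prod (A := A) phi).
Proof.
move=> [phiA phiS]; split=> [w g|w]; first exact: phiA.
by apply: phiS; apply/is_fixedP => g /isotropyP e; rewrite -[in RHS]e.
Qed.

Lemma single_family S : linear_family (fun (_ : Z) (s : S) => single s).
Proof.
split=> [z s g|K z s _ fs]; first by rewrite /free_act lin_single.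
exact: supp_single.
Qed.

Lemma linear_family_comp S S' T (f : gmap S S') (phi : Z -> S' -> free T) :
  linear_family phi -> linear_family (fun z s => phi z (f s)).
Proof.
move=> [phiA phiS]; split=> [z s g|K z s fz fs]; first by rewrite gfunP phiA.
by apply: phiS => //; apply: is_fixed_map.
Qed.

(** A linear family acts on M_Z, and this action is made into one on M by lifting
    along sigma.  The projection from M_Z to M is already built in fam_cov, whose
    values phi w are points of T, not of Z x T. *)
Definition rel_cov S T (phi : Z -> S -> free T) (a : ecov M S) : ecov M T :=
  fam_cov (on_prod phi) (sigma _ (tagged (repr a)) : M (gprod Z (tag (repr a)))).

Lemma rel_cov_germ_map S S' T (phi : Z -> S' ->
  free T) (f : gmap S S') (A : finsub S)
    (B : finsub S') (fAB : forall x, x \in sval A -> f x \in sval B) (x : M A) :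
  linear_family phi ->
  fam_cov (on_prod phi) (sigma B (mcov M (restr fAB) x) : M (gprod Z B)) =
  fam_cov (on_prod (fun z s => phi z (f s))) (sigma A x : M (gprod Z A)).
Proof.
move=> phiF; rewrite (mhom_cov sigma).
by rewrite [LHS](fam_cov_nat (gprod_map Z (restr fAB)) _ (family_on_prod _ phiF)).
Qed.

Lemma rel_covE S T (phi : Z -> S -> free T) (A : finsub S) (x : M A) :
  linear_family phi ->
  rel_cov phi (germ_of x) = fam_cov (on_prod phi) (sigma A x : M (gprod Z A)).
Proof.
move=> phiF; rewrite /rel_cov; set a := repr _.
have /germ_ofP[C [aC [AC e]]] : germ_of (tagged a) = germ_of x by apply:
  germ_of_repr.
rewrite -(@rel_cov_germ_map _ _ _ _ (gid S) _ _ aC _ phiF).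
by rewrite -(@rel_cov_germ_map _ _ _ _ (gid S) _ _ AC x phiF) -/(Defs.incl aC) e.
Qed.

Lemma rel_cov_sum S T (B : zmodType) (u : {additive ecov M T -> B}) (phi : Z ->
  S -> free T)
    (A : finsub S) (x : M A) : linear_family phi ->
  u (rel_cov phi (germ_of x)) =
  \sum_(w : gprod Z A | orb_rep w == w)
    lin (fun t => u (point_cov (mcon M (sub_val (orb w)) (sigma A x : M (gprod Z A))) t))
        (on_prod phi w).
Proof.
move=> phiF; rewrite rel_covE // raddf_sum; apply: eq_bigr => w _.
by rewrite raddf_lin.
Qed.

Lemma rel_cov_is_zmod_morphism S T (phi : Z -> S -> free T) : linear_family phi ->
  zmod_morphism (rel_cov phi).
Proof.
move=> phiF a b; have [A [x [y [-> ->]]]] := ecovP2 a b.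
rewrite -[- germ_of y]/(ecov_opp (germ_of y)) germ_ofN.
by rewrite -[germ_of x + _]/(ecov_add (germ_of x) _) germ_ofD !rel_covE // !raddfB.
Qed.

Definition rel_cov_hom S T (phi : Z -> S -> free T) (phiF : linear_family phi) :
  ecov M S -> ecov M T := rel_cov phi.

HB.instance Definition _ S T (phi : Z -> S -> free T) (phiF : linear_family phi) :=
  GRing.isZmodMorphism.Build (ecov M S) (ecov M T) (rel_cov_hom phiF)
    (rel_cov_is_zmod_morphism phiF).

Lemma rel_cov_map S S' T (phi : Z -> S' -> free T) (f : gmap S S') a :
  linear_family phi ->
  rel_cov phi (ecov_map f a) = rel_cov (fun z s => phi z (f s)) a.
Proof.
move=> phiF; have [A [x ->]] := ecovP a.
rewrite (ecov_map_germ (@Defs.mem_image _ S S' f A)) !rel_covE //;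
  last exact: linear_family_comp.
exact: rel_cov_germ_map.
Qed.

Lemma rel_cov_single S a : rel_cov (fun _ (s : S) => single s) a = a.
Proof.
have [A [x ->]] := ecovP a; rewrite rel_covE; last exact: single_family.
have tx : mcov M (gproj2 Z A) (sigma A x) = x by apply: theta_sigma.
have -> : germ_of x = ecov_map (gcomp (sub_val A) (gproj2 Z A)) (of_value
  (sigma A x : M (gprod Z A))).
  by rewrite ecov_map_comp of_value_map tx of_value_sub.
have famS := family_on_prod A (single_family S).
elim/mackey_generated: (sigma A x : M (gprod Z A)) => [|y z ey ez|s y].
- by rewrite !raddf0.
- by rewrite !raddfD /= ey ez.
rewrite fam_cov_orb // lin_single -of_value_map -ecov_map_comp.
exact: (point_covE y (gcomp (gcomp (sub_val A) (gproj2 Z A)) (sub_val (orb s)))).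
Qed.

(** M_Z is self-adjoint, so the section sigma of theta yields a retraction of the
    map from M to M_Z given by restriction along the projections.  The diagonal is
    the unit of the adjunction. *)
Definition diag (A : fgset gT) : gmap (gprod Z A) (gprod Z (gprod Z A)).
Proof. by exists (fun w => (w.1, w) : gprod Z (gprod Z A)). Defined.

Definition retr (A : fgset gT) (y : M (gprod Z A)) : M A :=
  mcov M (gproj2 Z A) (mcon M (diag A) (sigma (gprod Z A) y)).

Lemma retr_is_zmod_morphism A : zmod_morphism (@retr A).
Proof. by move=> x y; rewrite /retr !raddfB. Qed.

HB.instance Definition _ A :=
  GRing.isZmodMorphism.Build (M (gprod Z A)) (M A) (@retr A)
    (@retr_is_zmod_morphism A).

Lemma retr_proj A (x : M A) : retr (mcon M (gproj2 Z A) x) = x.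
Proof.
rewrite /retr (mhom_con sigma) /=.
rewrite -(@mcon_comp _ M _ _ _ (gprod_map Z (gproj2 Z A)) (diag A)).
rewrite (_ : gcomp _ _ = gid (gprod Z A)); last by apply: gmap_ext => -[].
by rewrite mcon_id; apply: theta_sigma.
Qed.

Lemma retr_con (A A' : fgset gT) (f : gmap A A') y :
  mcon M f (retr y) = retr (mcon M (gprod_map Z f) y).
Proof.
rewrite /retr -(mhom_con (theta M Z) f) /= (mhom_con sigma) /=.
by rewrite -!mcon_comp; congr (mcov M _ (mcon M _ _)); apply: gmap_ext.
Qed.

Section RelCon.
Variables (S T : gset gT) (phi : Z -> S -> free T).
Hypothesis phiF : linear_family phi.

Definition rel_con_fun (y : econ M T) (A : finsub S) : M A :=
  retr (fam_con (on_prod (A := A) phi) y).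

Lemma rel_con_funP (y : econ M T) (A B : finsub S) (AB : {subset sval A <= sval
  B}) :
  mcon M (Defs.incl AB) (rel_con_fun y B) = rel_con_fun y A.
Proof. by rewrite /rel_con_fun retr_con fam_con_nat //; apply: family_on_prod. Qed.

Definition rel_con (y : econ M T) : econ M S := ECon (rel_con_funP y).

Lemma rel_con_is_zmod_morphism : zmod_morphism rel_con.
Proof. by move=> x y; apply: econ_ext => A; rewrite /= /rel_con_fun !raddfB. Qed.

HB.instance Definition _ := GRing.isZmodMorphism.Build (econ M T) (econ M S)
  rel_con rel_con_is_zmod_morphism.

End RelCon.

Lemma rel_con_map S S' T (phi : Z -> S' -> free T) (phiF : linear_family phi)
    (f : gmap S S') y :
  econ_map f (rel_con phiF y) = rel_con (linear_family_comp f phiF) y.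
Proof.
apply: econ_ext => A; rewrite /= /rel_con_fun retr_con fam_con_nat //.
exact: family_on_prod.
Qed.

Lemma rel_con_sum S T (phi : Z -> S -> free T) (phiF : linear_family phi) y A :
  rel_con phiF y A = retr (\sum_(w : gprod Z A | orb_rep w == w)
    mcov M (sub_val (orb w)) (lin (point_con w y) (on_prod phi w))).
Proof. by []. Qed.

Lemma rel_con_single S y : rel_con (single_family S) y = y.
Proof.
apply: econ_ext => A; rewrite /= /rel_con_fun -[RHS]retr_proj; congr (retr _).
apply: mackey_restr_inj => s; rewrite fam_con_orb;
  last exact/family_on_prod/single_family.
rewrite lin_single -[y A]to_value_sub !to_value_map -!econ_map_comp.
exact: (point_conE y (gcomp (sub_val A) (gcomp (gproj2 Z A) (sub_val (orb s))))).
Qed.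

End Relative.

(** * The comparison map on Bredon homology and cohomology *)

Lemma fixed_of_codegen gT (W : gspace gT) n (K : {group gT}) i (t : level W n) :
  is_fixed K (sact (codegen i) t : level W n.+1) = is_fixed K t.
Proof.
apply/idP/idP => ft; last exact: (is_fixed_map (level_act W (codegen i)) ft).
have := is_fixed_map (level_act W (coface (inord i))) ft.
by rewrite /= -sact_comp codegen_coface_id ?sact_id //; left.
Qed.

Section Bredon.
Variables (gT : finGroupType) (M : mackey gT).
Implicit Types (W : gspace gT) (V : fgset gT).

Definition nclass W n : {additive ecov M (level W n) ->
  nchain (bredon_sab M W) n} :=
  \pi_{quot @is_degenerate (bredon_sab M W) n}%qT.

Lemma nclassP W n (c : nchain (bredon_sab M W) n) : exists a, c = nclass W n a.
Proof. by exists (repr c); rewrite /nclass /= reprK. Qed.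

Lemma nclass_degen W n i (a : ecov M (level W n)) :
  nclass W n.+1 (ecov_map (level_act W (codegen i)) a) = 0.
Proof.
rewrite -[RHS](raddf0 (nclass W n.+1)); apply/eqP.
rewrite -idealrBE subr0; exact: (@degen_degenerate (bredon_sab M W)).
Qed.

Lemma point_cov_degenerate W n V (r : V) (x : M (orb r)) (t : level W n) :
  degenerate t -> nclass W n (point_cov x t) = 0.
Proof.
case: n t => // n t /asboolP[i [u ->]].
have [fu|fu] := boolP (is_fixed (isotropy_group r) (u : level W n)).
  by rewrite -(point_cov_map (level_act W (codegen i))) // nclass_degen.
rewrite /point_cov; case: {-}_ / idP => [ft|_]; last by rewrite raddf0.
by move: fu; rewrite -(fixed_of_codegen _ i) ft.
Qed.

Lemma nclass_alt_face W n (a : ecov M (level W n.+1)) :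
  chain_d (normalized_chains (bredon_sab M W)) n (nclass W n.+1 a) =
  nclass W n (@alt_face (bredon_sab M W) n a).
Proof. exact: quot_map_pi. Qed.

Lemma nclass_map U W (q : gspace_map U W) n (a : ecov M (level U n)) :
  normalized_chains_map (bredon_sab_map M q) n (nclass U n a) =
  nclass W n (ecov_map (level_map q n) a).
Proof. exact: quot_map_pi. Qed.

Lemma nclass_d W n (a : ecov M (level W n.+1)) :
  chain_d (normalized_chains (bredon_sab M W)) n (nclass W n.+1 a) =
  \sum_(i < n.+2) nclass W n (ecov_map (level_act W (coface i)) a) *~ (-1) ^+ i.
Proof.
rewrite nclass_alt_face raddf_sum; apply: eq_bigr => i _.
by rewrite raddfMz.
Qed.

Lemma point_cov_d W n V (r : V) (x : M (orb r)) (t : level W n.+1) :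
  is_fixed (isotropy_group r) t ->
  chain_d (normalized_chains (bredon_sab M W)) n (nclass W n.+1 (point_cov x t)) =
  delta_fun (fun u => nclass W n (point_cov x (u : level W n))) t.
Proof. by move=> ft; rewrite nclass_d; apply: eq_bigr => i _;
  rewrite point_cov_map. Qed.

Lemma point_con_degenerate W n V (r : V) (y : econ M (level W n)) (t : level W n) :
  y \in @is_normalized (bredon_csab M W) n -> degenerate t -> point_con r y t = 0.
Proof.
case: n y t => // n y t /forallP ny /asboolP[i [u ->]].
have [fu|fu] := boolP (is_fixed (isotropy_group r) (u : level W n)).
  rewrite -(point_con_map (level_act W (codegen i))) // [econ_map _ y](eqP (ny i)).
  by have := point_con_is_zmod_morphism r (u : level W n) (0 : econ M (level W
    n)) 0; rewrite !subrr.
rewrite /point_con; case: {-}_ / idP => [ft|//].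
by move: fu; rewrite -(fixed_of_codegen _ i) ft.
Qed.

Lemma point_con_d W n V (r : V) (y : econ M (level W n)) (t : level W n.+1) :
  is_fixed (isotropy_group r) t ->
  point_con r (@alt_cface (bredon_csab M W) n y) t = delta_fun (point_con r y) t.
Proof.
move=> ft; pose ev := @point_con _ M V r (level W n.+1) ^~ t.
have evB : zmod_morphism ev by apply: point_con_is_zmod_morphism.
pose add_ev : {additive econ M (level W n.+1) -> M (orb r)} :=
  HB.pack ev (GRing.isZmodMorphism.Build _ _ ev evB).
rewrite -[LHS]/(add_ev _) raddf_sum; apply: eq_bigr => i _.
by rewrite raddfMz /= /ev point_con_map.
Qed.

End Bredon.

Section Comparison.
Variables (gT : finGroupType) (M : mackey gT) (Z : fgset gT).
Variable sigma : mackey_hom M (mshift M Z).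
Hypothesis theta_sigma : forall S x, theta M Z S (sigma S x) = x.

Section ChainOperator.
Variables (V W : gspace gT) (m n : nat) (phi : Z -> level V m -> free (level W n)).
Hypothesis phiF : linear_family phi.
Hypothesis phi_deg : forall z s, degenerate s -> phi z s = 0.

Definition op_chain (c : nchain (bredon_sab M V) m) : nchain (bredon_sab M W) n :=
  nclass M W n (rel_cov_hom sigma phiF (repr c)).

Lemma rel_cov_degenerate a : a \in @is_degenerate (bredon_sab M V) m ->
  rel_cov_hom sigma phiF a = 0.
Proof.
case: m phi phiF phi_deg a => [|k] psi psiF psi_deg a.
  by rewrite unfold_in => /eqP->; apply: raddf0.
rewrite unfold_in => /asboolP[b ->]; rewrite raddf_sum big1 // => i _.
rewrite [LHS]rel_cov_map //; have [A [x ->]] := ecovP (b i).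
rewrite [LHS](rel_cov_sum sigma idfun); last exact: linear_family_comp.
rewrite big1 // => w _; rewrite /on_prod psi_deg ?raddf0 //.
exact: degenerate_codegen.
Qed.

Lemma op_chainE a : op_chain (nclass M V m a) = nclass M W n (rel_cov_hom sigma
  phiF a).
Proof.
apply/eqP; rewrite /op_chain -subr_eq0 -!raddfB /= rel_cov_degenerate ?raddf0 //.
by rewrite idealrBE reprK.
Qed.

Lemma op_chain0 : op_chain 0 = 0.
Proof. by rewrite -(raddf0 (nclass M V m)) op_chainE !raddf0. Qed.

End ChainOperator.

Section Sums.
Variables (V : gspace gT) (m : nat) (A : finsub (level V m)) (x : M A).

Let value (w : gprod Z A) : M (orb w) :=
  mcon M (sub_val (orb w)) (sigma A x : M (gprod Z A)).

(** Operators on Bredon chains are sums over the orbits of Z x A of values of this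
    normalized cochain, so that the identities of deformation apply to each
    summand. *)
Definition probe (W : gspace gT) n (w : gprod Z A) (t : level W n) :
  nchain (bredon_sab M W) n := nclass M W n (point_cov (value w) t).

Lemma probe_degenerate (W : gspace gT) n w (t : level W n) : degenerate t ->
  probe w t = 0.
Proof. exact: point_cov_degenerate. Qed.

Lemma germ_sum : nclass M V m (germ_of x) = \sum_(w : gprod Z A | orb_rep w ==
  w) probe w (val w.2).
Proof.
rewrite -[germ_of x](rel_cov_single theta_sigma) rel_cov_sum;
  last exact: single_family.
by apply: eq_bigr => w _; rewrite /on_prod lin_single.
Qed.

Section Operator.
Variables (W : gspace gT).

Lemma op_sum n (phi : Z -> level V m -> free (level W n)) (phiF : linear_family phi)
    (phi_deg : forall z s, degenerate s -> phi z s = 0) :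
  op_chain phiF (nclass M V m (germ_of x)) =
  \sum_(w : gprod Z A | orb_rep w == w) lin (@probe W n w) (phi w.1 (val w.2)).
Proof. by rewrite op_chainE // [LHS](rel_cov_sum sigma (nclass M W n)). Qed.

Lemma d_op_sum n (phi : Z -> level V m -> free (level W n.+1)) (phiF :
  linear_family phi)
    (phi_deg : forall z s, degenerate s -> phi z s = 0) :
  chain_d (normalized_chains (bredon_sab M W)) n (op_chain phiF (nclass M V m
    (germ_of x))) =
  \sum_(w : gprod Z A | orb_rep w == w) lin (delta_fun (@probe W n w)) (phi w.1
    (val w.2)).
Proof.
rewrite op_sum // raddf_sum; apply: eq_bigr => w _; rewrite raddf_lin.
apply: eq_lin_supp ((family_on_prod A phiF).2 w) _ => t ft.
exact: point_cov_d.
Qed.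

Lemma map_op_sum (U : gspace gT) (q : gspace_map W U) n
    (phi : Z -> level V m -> free (level W n)) (phiF : linear_family phi)
    (phi_deg : forall z s, degenerate s -> phi z s = 0) :
  normalized_chains_map (bredon_sab_map M q) n (op_chain phiF (nclass M V m
    (germ_of x))) =
  \sum_(w : gprod Z A | orb_rep w == w)
    lin (fun t => @probe U n w (q n t)) (phi w.1 (val w.2)).
Proof.
rewrite op_sum // raddf_sum; apply: eq_bigr => w _; rewrite raddf_lin.
apply: eq_lin_supp ((family_on_prod A phiF).2 w) _ => t ft.
by rewrite [LHS]nclass_map; congr (nclass M U n _);
  apply: (point_cov_map (level_map q n)).
Qed.

End Operator.
End Sums.

Lemma op_out_sum (V W : gspace gT) m n (A : finsub (level V m)) (x : M A)
    (phi : Z -> level V m.-1 -> free (level W n)) (phiF : linear_family phi)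
    (phi_deg : forall z s, degenerate s -> phi z s = 0) :
  op_chain phiF (chain_out (normalized_chains (bredon_sab M V)) m
    (nclass M V m (germ_of x))) =
  \sum_(w : gprod Z A | orb_rep w == w)
    out_fun (fun s => lin (@probe V m A x W n w) (phi w.1 s)) (val w.2).
Proof.
case: m A x phi phiF phi_deg => [|k] A x phi phiF phi_deg.
  by rewrite op_chain0 // big1.
rewrite [chain_out _ _ _]nclass_alt_face op_chainE // /alt_face.
rewrite (raddf_sum (rel_cov_hom sigma phiF)) (raddf_sum (nclass M W n)).
rewrite /= /delta_fun [RHS]exchange_big. apply: eq_bigr => i _ /=.
rewrite !raddfMz /= -mulrz_suml; congr (_ *~ _).
rewrite [rel_cov_hom _ _ _]rel_cov_map // (rel_cov_sum sigma (nclass M W n)) //.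
exact: linear_family_comp.
Qed.

Lemma op_d_sum (V W : gspace gT) m n (A : finsub (level V m.+1)) (x : M A)
    (phi : Z -> level V m -> free (level W n)) (phiF : linear_family phi)
    (phi_deg : forall z s, degenerate s -> phi z s = 0) :
  op_chain phiF (chain_d (normalized_chains (bredon_sab M V)) m
    (nclass M V m.+1 (germ_of x))) =
  \sum_(w : gprod Z A | orb_rep w == w)
    delta_fun (fun s => lin (@probe V m.+1 A x W n w) (phi w.1 s)) (val w.2).
Proof. exact: (@op_out_sum V W m.+1 n A x phi phiF phi_deg). Qed.

Section Equivalence.
Variables (X Y : gspace gT) (p : gspace_map Y X).
Hypothesis pwe : forall (K : {group gT}) (z : gset_of_fgset Z),
  is_fixed K z -> weak_equiv (fixed_map K p).

(** Each identity between r, h and k holds summand by summand, where it is an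
    identity of deformation for the cochain probe. *)
Lemma homology_bijective n : bijective (bredon_homology_map M p n).
Proof.
have [r [h [k [F D rd fr rf]]]] := deformation pwe.
have rF m := let: And3 a _ _ := F m in a.
have hF m := let: And3 _ a _ := F m in a.
have kF m := let: And3 _ _ a := F m in a.
have rD m z := let: And3 a _ _ := D m z in a.
have hD m z := let: And3 _ a _ := D m z in a.
have kD m z := let: And3 _ _ a := D m z in a.
apply: (@chain_equiv_bijective (normalized_chains (bredon_sab M Y))
  (normalized_chains (bredon_sab M X)) (normalized_chains_map (bredon_sab_map M p))
  (fun m => @op_chain X Y m m (r m) (rF m)) (fun m => @op_chain X X m.-1 m (h
    m) (hF m))
  (fun m => @op_chain Y Y m.-1 m (k m) (kF m))) => m.
- exact/op_chain0/hD.
- exact/op_chain0/kD.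
- exact/op_chain0/rD.
- move=> c; have [a ->] := nclassP c; have [A [x ->]] := ecovP a.
  rewrite d_op_sum; last exact: rD.
  rewrite op_d_sum; last exact: rD.
  by apply: eq_bigr => w _; apply: rd => t; apply: probe_degenerate.
- move=> c; have [a ->] := nclassP c; have [A [x ->]] := ecovP a.
  rewrite d_op_sum; last exact: hD.
  rewrite map_op_sum; last exact: rD.
  rewrite op_out_sum; last exact: hD.
  rewrite germ_sum -!big_split.
  by apply: eq_bigr => w _; apply: fr => t; apply: probe_degenerate.
move=> c; have [a ->] := nclassP c; have [A [x ->]] := ecovP a.
rewrite d_op_sum; last exact: kD.
rewrite op_out_sum; last exact: kD.
rewrite [X in op_chain _ X]nclass_map op_chainE; last exact: rD.
rewrite germ_sum -!big_split.
rewrite [rel_cov_hom _ _ _]rel_cov_map // (rel_cov_sum sigma (nclass M Y m));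
  last first.
  exact: (linear_family_comp (level_map p m)).
by apply: eq_bigr => w _; apply: rf => t; apply: probe_degenerate.
Qed.

End Equivalence.
End Comparison.

Section CohomologyComparison.
Variables (gT : finGroupType) (M : mackey gT) (Z : fgset gT).
Variable sigma : mackey_hom M (mshift M Z).
Hypothesis theta_sigma : forall S x, theta M Z S (sigma S x) = x.

(** Operators on Bredon cochains have, over A, values of this form, where F w is the
    value at a linear combination of points of the normalized cochain
    point_con w. *)
Definition assemble (S : gset gT) (A : finsub S) (F : forall w : gprod Z A,
  M (orb w)) : M A :=
  retr sigma (\sum_(w : gprod Z A | orb_rep w == w) mcov M (sub_val (orb w)) (F w)).

Lemma assembleD S (A : finsub S) (F F' : forall w : gprod Z A, M (orb w)) :
  assemble F + assemble F' = assemble (fun w => F w + F' w).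
Proof.
rewrite /assemble -raddfD -big_split; congr (retr _ _).
by apply: eq_bigr => w _; rewrite raddfD.
Qed.

Lemma eq_assemble S (A : finsub S) (F F' : forall w : gprod Z A, M (orb w)) :
  (forall w, F w = F' w) -> assemble F = assemble F'.
Proof. by move=> e; congr (retr _ _); apply: eq_bigr => w _; rewrite e. Qed.

Lemma assemble_sumz S (A : finsub S) n (F : 'I_n -> forall w : gprod Z A,
  M (orb w)) :
  \sum_(i < n) assemble (F i) *~ (-1) ^+ i =
  assemble (fun w => \sum_(i < n) F i w *~ (-1) ^+ i).
Proof.
rewrite /assemble; under eq_bigr => i _ do rewrite -raddfMz /=.
rewrite -raddf_sum; congr (retr _ _); under eq_bigr => i _ do rewrite mulrz_suml.
rewrite exchange_big; apply: eq_bigr => w _; rewrite raddf_sum.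
by apply: eq_bigr => i _; rewrite raddfMz.
Qed.

Definition cval (W : gspace gT) n (c : ncochain (bredon_csab M W) n) : econ M
  (level W n) := val c.

Lemma cvalP (W : gspace gT) n (c : ncochain (bredon_csab M W) n) :
  cval c \in @is_normalized (bredon_csab M W) n.
Proof. exact: (valP c). Qed.

Lemma point_con_normalized (W : gspace gT) n (c : ncochain (bredon_csab M W) n)
    (V : fgset gT) (w : V) t : degenerate t -> point_con w (cval c) t = 0.
Proof. exact/point_con_degenerate/cvalP. Qed.

Section CochainOperator.
Variables (V W : gspace gT) (m n : nat) (phi : Z -> level V m -> free (level W n)).
Hypothesis phiF : linear_family phi.
Hypothesis phi_deg : forall z s, degenerate s -> phi z s = 0.

Lemma rel_con_normalized y : rel_con sigma phiF y \in @is_normalized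
  (bredon_csab M V) m.
Proof.
case: m phi phiF phi_deg => // k psi psiF psi_deg; apply/forallP => i; apply/eqP.
rewrite [LHS]rel_con_map; apply: econ_ext => A;
  rewrite rel_con_sum big1 ?raddf0 // => w _.
by rewrite /on_prod psi_deg ?raddf0 //; apply: degenerate_codegen.
Qed.

Definition op_cochain (c : ncochain (bredon_csab M W) n) : ncochain
  (bredon_csab M V) m :=
  NCochain (rel_con_normalized (cval c)).

Lemma op_cochain0 : op_cochain 0 = 0.
Proof. by apply: val_inj; apply: (raddf0 (rel_con sigma phiF)). Qed.

Lemma op_cochain_sum c (A : finsub (level V m)) :
  cval (op_cochain c) A = assemble (fun w => lin (point_con w (cval c)) (phi
    w.1 (val w.2))).
Proof. by []. Qed.

End CochainOperator.

Lemma cval_sum (V : gspace gT) m (c : ncochain (bredon_csab M V) m) A :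
  cval c A = assemble (fun w : gprod Z A => point_con w (cval c) (val w.2)).
Proof.
rewrite -{1}(rel_con_single theta_sigma (cval c)) rel_con_sum.
by apply: eq_assemble => w; rewrite /on_prod lin_single.
Qed.

Lemma cval_d (V : gspace gT) m (c : ncochain (bredon_csab M V) m) :
  cval (cochain_d (normalized_cochains (bredon_csab M V)) m c) =
  \sum_(i < m.+2) econ_map (level_act V (coface i)) (cval c) *~ (-1) ^+ i.
Proof. by []. Qed.

Lemma econ_eval_sumz (S : gset gT) n (F : 'I_n -> econ M S) A :
  (\sum_(i < n) F i *~ (-1) ^+ i : econ M S) A = \sum_(i < n) F i A *~ (-1) ^+ i.
Proof.
have evB : zmod_morphism (fun y : econ M S => y A) by [].
pose ev : {additive econ M S -> M A} :=
  HB.pack (fun y : econ M S => y A) (GRing.isZmodMorphism.Build _ _ _ evB).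
rewrite -[LHS]/(ev _) raddf_sum; apply: eq_bigr => i _; exact: (raddfMz ev).
Qed.

Section Operator.
Variables (V W : gspace gT) (m n : nat).

Lemma op_cochain_d_sum (phi : Z -> level V m -> free (level W n.+1))
    (phiF : linear_family phi) (phi_deg : forall z s, degenerate s -> phi z s = 0) c A :
  cval (op_cochain phiF phi_deg (cochain_d (normalized_cochains (bredon_csab M
    W)) n c)) A =
  assemble (fun w : gprod Z A => lin (delta_fun (point_con w (cval c))) (phi
    w.1 (val w.2))).
Proof.
rewrite op_cochain_sum; apply: eq_assemble => w.
apply: eq_lin_supp ((family_on_prod A phiF).2 w) _ => t ft.
exact: (point_con_d (cval c) ft).
Qed.

Lemma op_cochain_map_sum (U : gspace gT) (q : gspace_map W U)
    (phi : Z -> level V m -> free (level W n))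
    (phiF : linear_family phi) (phi_deg : forall z s, degenerate s -> phi z s = 0) c A :
  cval (op_cochain phiF phi_deg (normalized_cochains_map (bredon_csab_map M q)
    n c)) A =
  assemble (fun w : gprod Z A =>
    lin (fun t => point_con w (cval c) (q n t)) (phi w.1 (val w.2))).
Proof.
rewrite op_cochain_sum; apply: eq_assemble => w.
apply: eq_lin_supp ((family_on_prod A phiF).2 w) _ => t ft.
exact: (point_con_map (level_map q n) (cval c) ft).
Qed.

Lemma map_op_cochain_sum (U : gspace gT) (q : gspace_map U V)
    (phi : Z -> level V m -> free (level W n))
    (phiF : linear_family phi) (phi_deg : forall z s, degenerate s -> phi z s = 0) c A :
  cval (normalized_cochains_map (bredon_csab_map M q) m (op_cochain phiF
    phi_deg c)) A =
  assemble (fun w : gprod Z A => lin (point_con w (cval c)) (phi w.1 (q m (val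
    w.2)))).
Proof.
rewrite -[cval (normalized_cochains_map _ _ _)]/(econ_map (level_map q m)
  (rel_con sigma phiF (cval c))).
by rewrite rel_con_map.
Qed.

End Operator.

Lemma in_op_cochain_sum (V W : gspace gT) m n
    (phi : Z -> level V m.-1 -> free (level W n))
    (phiF : linear_family phi) (phi_deg : forall z s, degenerate s -> phi z s = 0)
    c (A : finsub (level V m)) :
  cval (cochain_in (normalized_cochains (bredon_csab M V)) m (op_cochain phiF
    phi_deg c)) A =
  assemble (fun w : gprod Z A =>
    out_fun (fun s => lin (point_con w (cval c)) (phi w.1 s)) (val w.2)).
Proof.
case: m phi phiF phi_deg A => [|k] phi phiF phi_deg A.
  by rewrite /assemble big1 ?raddf0 // => w _; rewrite raddf0.
rewrite [cval _]cval_d econ_eval_sumz /= /delta_fun -assemble_sumz;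
  apply: eq_bigr => i _.
congr (_ *~ _).
have := rel_con_map sigma phiF (level_act V (coface i)) (cval c).
by move/(congr1 (fun y : econ M _ => y A)).
Qed.

Section Equivalence.
Variables (X Y : gspace gT) (p : gspace_map Y X).
Hypothesis pwe : forall (K : {group gT}) (z : gset_of_fgset Z),
  is_fixed K z -> weak_equiv (fixed_map K p).

Lemma cohomology_bijective n : bijective (bredon_cohomology_map M p n).
Proof.
have [r [h [k [F D rd fr rf]]]] := deformation pwe.
have rF m := let: And3 a _ _ := F m in a.
have hF m := let: And3 _ a _ := F m in a.
have kF m := let: And3 _ _ a := F m in a.
have rD m z := let: And3 a _ _ := D m z in a.
have hD m z := let: And3 _ a _ := D m z in a.
have kD m z := let: And3 _ _ a := D m z in a.
apply: (@cochain_equiv_bijective (normalized_cochains (bredon_csab M Y))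
  (normalized_cochains (bredon_csab M X)) (normalized_cochains_map
    (bredon_csab_map M p))
  (fun m => @op_cochain X Y m m (r m) (rF m) (rD m))
  (fun m => @op_cochain X X m.-1 m (h m) (hF m) (hD m))
  (fun m => @op_cochain Y Y m.-1 m (k m) (kF m) (kD m))) => m.
- exact: op_cochain0.
- exact: op_cochain0.
- exact: op_cochain0.
- move=> c; apply: val_inj; apply: econ_ext => A.
  rewrite [LHS](@in_op_cochain_sum X Y m.+1 m (r m) (rF m) (rD m)).
  rewrite [RHS](op_cochain_d_sum (rF m.+1) (rD m.+1)).
  apply: eq_assemble => w.
  by rewrite [RHS]rd // => t; apply: point_con_normalized.
- move=> c; apply: val_inj; apply: econ_ext => A.
  rewrite -[LHS]/(cval (op_cochain (hF m.+1) (hD m.+1) (cochain_d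
    (normalized_cochains (bredon_csab M X)) m c)) A +
    cval (op_cochain (rF m) (rD m) (normalized_cochains_map (bredon_csab_map M p) m c)) A +
    cval (cochain_in (normalized_cochains (bredon_csab M X)) m (op_cochain (hF
      m) (hD m) c)) A).
  rewrite (op_cochain_d_sum (hF m.+1) (hD m.+1)) (op_cochain_map_sum p (rF m)
    (rD m)).
  rewrite (in_op_cochain_sum (hF m) (hD m)) [RHS]cval_sum !assembleD.
  by apply: eq_assemble => w; apply: fr => t; apply: point_con_normalized.
move=> c; apply: val_inj; apply: econ_ext => A.
rewrite -[RHS]/(cval c A +
  cval (op_cochain (kF m.+1) (kD m.+1) (cochain_d (normalized_cochains
    (bredon_csab M Y)) m c)) A +
  cval (cochain_in (normalized_cochains (bredon_csab M Y)) m (op_cochain (kF m)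
    (kD m) c)) A).
rewrite [LHS](map_op_cochain_sum p (rF m) (rD m)) (op_cochain_d_sum (kF m.+1)
  (kD m.+1)).
rewrite (in_op_cochain_sum (kF m) (kD m)) (cval_sum c) !assembleD.
by apply: eq_assemble => w; apply: rf => t; apply: point_con_normalized.
Qed.

End Equivalence.
End CohomologyComparison.

(** The isotropy group of a coset of H is a conjugate of H. *)
Lemma coset_isotropy (gT : finGroupType) (F : {set {group gT}}) (K : {group gT})
    (z : gset_of_fgset (coset_gset (orbit_transversal 'JG [set: gT] F))) :
  is_family F -> is_fixed K z -> K \in F.
Proof.
move=> [conjF subF] /is_fixedP fz.
have acts : [acts [set: gT], on F | 'JG].
  apply/actsP => g _ H /=; apply/idP/idP; last exact: conjF.
  move=> /(conjF _ g^-1%g); congr (_ \in F); apply: val_inj; exact: conjsgK.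
have [_ /subsetP sub _ _] := orbit_transversalP acts.
case: z fz => -[H A] /= zP fz; have /andP[/= HR /rcosetsP[y _ eA]] := zP.
apply: (subF (H :^ y)%G); first exact/conjF/sub.
apply/subsetP => g gK; have /(congr1 val) /= [e] := fz g gK.
have : (y * g)%g \in (A :* g)%g by rewrite mem_rcoset mulgK eA rcoset_refl.
by rewrite e eA mem_rcoset /= mem_conjg conjgE invgK mulgA.
Qed.

Theorem proposition4p6 (gT : finGroupType) (F : {set {group gT}})
    (X XF : gspace gT) (p : gspace_map XF X) (M : mackey gT) :
  is_family F ->
  is_approximation F p ->
  projective_relative M F ->
  forall n : nat,
    bijective (bredon_homology_map M p n) /\
    bijective (bredon_cohomology_map M p n).
Proof.
move=> famF [_ pwe] [sigma theta_sigma] n.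
have pweZ (K : {group gT}) (z : gset_of_fgset (coset_gset (orbit_transversal
  'JG [set: gT] F))) :
    is_fixed K z -> weak_equiv (fixed_map K p).
  by move=> fz; apply/pwe/(coset_isotropy famF fz).
split; first exact: homology_bijective theta_sigma _ _ _ pweZ n.
exact: cohomology_bijective theta_sigma _ _ _ pweZ n.
Qed.
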